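(* Let $\ell_0>4\pi$ and $T>0$, and let $\Phi_0\in H^m_\sharp(\ell_0)$ be $\ell_0$-periodic. Let $\Phi$ be the $\ell_0$-periodic solution on $[0,T]$ of the Kuramoto–Sivashinsky equation $$\Phi_\tau+4\Phi_{\eta\eta\eta\eta}+\Phi_{\eta\eta}+\tfrac12(\Phi_\eta)^2=0,\qquad \Phi(0,\cdot)=\Phi_0 .$$ If $m$ is large enough, then there exists $\varepsilon_0=\varepsilon_0(T)\in(0,1)$ with the following property. For every $0<\varepsilon\le\varepsilon_0$, set $\alpha=1+\varepsilon$ and $\ell=\ell_0/\sqrt\varepsilon$. Then the problem $$\frac{d}{dt}\mathscr B\varphi=\mathscr S\varphi+\mathscr F((\varphi_y)^2)$$ has a unique classical solution $\varphi$ on $[0,T/\varepsilon^2]$. This solution is $\ell_0/\sqrt\varepsilon$-periodic in $y$ and satisfies $\varphi(0,y)=\varepsilon\Phi_0(y\sqrt\varepsilon)$ for $|y|\le \ell_0/(2\sqrt\varepsilon)$. Moreover, there is $C>0$, independent of $\varepsilon\in(0,\varepsilon_0]$, such that $$|\varphi(t,y)-\varepsilon\Phi(t\varepsilon^2,y\sqrt\varepsilon)|\le C\varepsilon^2,\qquad 0\le t\le T/\varepsilon^2,\ |y|\le\frac{\ell_0}{2\sqrt\varepsilon}.$$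
   Context: For a period $\ell>0$, let $\{w_k\}_{k\ge0}$ be an orthonormal basis of $L^2(-\ell/2,\ell/2)$ of eigenfunctions of $D_{yy}$ with periodic boundary conditions: $D_{yy}w_k=-\lambda_kw_k$, with $\lambda_0=0$ and $\lambda_{2j-1}=\lambda_{2j}=4\pi^2j^2/\ell^2$ for $j\ge1$. Write $\widehat f(k)$ for the coefficients. $H^s_\sharp(\ell)$ is the Sobolev space of $\ell$-periodic functions. An operator with symbol $(c_k)$ acts by $\widehat{(\mathscr Cf)}(k)=c_k\widehat f(k)$. With $X_k=\sqrt{1+4\lambda_k}$, the operators $\mathscr B,\mathscr S,\mathscr F$ (depending on $\alpha$ and $\ell$) have symbols $$b_k=X_k^2+\alpha X_k-\alpha,\qquad s_k=-4\lambda_k^2+(\alpha-1)\lambda_k,\qquad f_k=\tfrac14(X_k^3-3X_k^2-4\alpha X_k+4\alpha).$$ *)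

(* Defs.v *)
From Stdlib Require Import Reals Lra.
Open Scope R_scope.

Definition jidx (k : nat) : R := INR (Nat.div (k + 1) 2).

(* eigenvalues of -D_yy with l-periodic b.c. *)
Definition lam (l : R) (k : nat) : R := 4 * PI ^ 2 * (jidx k) ^ 2 / l ^ 2.

(* orthonormal eigenbasis of L^2(-l/2,l/2): w_0 = 1/sqrt l,
   w_{2j-1} = sqrt(2/l) cos(2 pi j y/l), w_{2j} = sqrt(2/l) sin(2 pi j y/l) *)
Definition w (l : R) (k : nat) (y : R) : R :=
  match k with
  | O => / sqrt l
  | _ => if Nat.odd k then sqrt (2 / l) * cos (2 * PI * jidx k * y / l)
         else sqrt (2 / l) * sin (2 * PI * jidx k * y / l)
  end.

Definition periodic (l : R) (f : R -> R) : Prop := forall y, f (y + l) = f y.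

Definition is_coef (l : R) (f : R -> R) (k : nat) (c : R) : Prop :=
  exists pr : Riemann_integrable (fun y => f y * w l k y) (- (l / 2)) (l / 2),
    RiemannInt pr = c.

(* h = C g for the operator C with symbol (c_k): h is a continuous l-periodic
   function whose Fourier coefficients are c_k * ghat(k). *)
Definition op_image (l : R) (c : nat -> R) (g h : R -> R) : Prop :=
  continuity h /\ periodic l h /\
  forall k, exists a, is_coef l g k a /\ is_coef l h k (c k * a).

(* H^m_sharp(l), represented by continuous l-periodic functions *)
Definition in_Hsharp (m : nat) (l : R) (f : R -> R) : Prop :=
  continuity f /\ periodic l f /\
  exists a : nat -> R, (forall k, is_coef l f k (a k)) /\
    exists s, infinite_sum (fun k => (1 + lam l k) ^ m * (a k) ^ 2) s.

Definition Xk (l : R) (k : nat) : R := sqrt (1 + 4 * lam l k).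
Definition bsym (alpha l : R) (k : nat) : R :=
  Xk l k ^ 2 + alpha * Xk l k - alpha.
Definition ssym (alpha l : R) (k : nat) : R :=
  - 4 * lam l k ^ 2 + (alpha - 1) * lam l k.
Definition fsym (alpha l : R) (k : nat) : R :=
  / 4 * (Xk l k ^ 3 - 3 * Xk l k ^ 2 - 4 * alpha * Xk l k + 4 * alpha).

Definition cont2_on (a b : R) (F : R -> R -> R) : Prop :=
  forall t y, a <= t <= b -> forall eps, eps > 0 -> exists delta, delta > 0 /\
    forall t' y', a <= t' <= b -> Rabs (t' - t) < delta -> Rabs (y' - y) < delta ->
      Rabs (F t' y' - F t y) < eps.

Definition KS_solution (l0 T : R) (Phi0 : R -> R) (Phi : R -> R -> R) : Prop :=
  exists P1 P2 P3 P4 Pt : R -> R -> R,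
    (forall tau eta, 0 <= tau <= T -> Phi tau (eta + l0) = Phi tau eta) /\
    (forall eta, Phi 0 eta = Phi0 eta) /\
    cont2_on 0 T Phi /\ cont2_on 0 T P1 /\ cont2_on 0 T P2 /\
    cont2_on 0 T P3 /\ cont2_on 0 T P4 /\
    (forall tau eta, 0 <= tau <= T ->
       derivable_pt_lim (fun e => Phi tau e) eta (P1 tau eta) /\
       derivable_pt_lim (fun e => P1 tau e) eta (P2 tau eta) /\
       derivable_pt_lim (fun e => P2 tau e) eta (P3 tau eta) /\
       derivable_pt_lim (fun e => P3 tau e) eta (P4 tau eta)) /\
    (forall tau eta, 0 < tau < T ->
       derivable_pt_lim (fun s => Phi s eta) tau (Pt tau eta) /\
       Pt tau eta + 4 * P4 tau eta + P2 tau eta + / 2 * (P1 tau eta) ^ 2 = 0).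

Definition classical_sol (alpha l Tf : R) (phi : R -> R -> R) : Prop :=
  exists py U V : R -> R -> R,
    (forall t y, 0 <= t <= Tf -> phi t (y + l) = phi t y) /\
    cont2_on 0 Tf phi /\ cont2_on 0 Tf py /\ cont2_on 0 Tf U /\ cont2_on 0 Tf V /\
    (forall t y, 0 <= t <= Tf -> derivable_pt_lim (fun z => phi t z) y (py t y)) /\
    (forall t, 0 <= t <= Tf -> op_image l (bsym alpha l) (phi t) (U t)) /\
    (forall t, 0 <= t <= Tf -> exists Sp Fq : R -> R,
       op_image l (ssym alpha l) (phi t) Sp /\
       op_image l (fsym alpha l) (fun y => (py t y) ^ 2) Fq /\
       forall y, V t y = Sp y + Fq y) /\
    (forall t y, 0 < t < Tf -> derivable_pt_lim (fun s => U s y) t (V t y)).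

Definition init_cond (eps l0 : R) (Phi0 : R -> R) (phi : R -> R -> R) : Prop :=
  forall y, Rabs y <= l0 / (2 * sqrt eps) -> phi 0 y = eps * Phi0 (y * sqrt eps).

(* Main.v *)
(* The rescaling [phi = eps psi(eps^2 t, sqrt eps y)] fixes the period and turns the equation into
   [b_k psi_k' = sigma_k psi_k + f_k ((psi_eta)^2)_k] with [sigma_k = mu_k - 4 mu_k^2], a perturbation of the
   Kuramoto--Sivashinsky equation in which [b_k = 1 + O(eps mu_k)] and [f_k = -1/2 + O(eps mu_k (1 + mu_k))].
   All estimates are made in the norm [sup_{k,t} e^{-Mt} (1+j)^r |a_k(t)|], [j] the wave number of mode [k]:
   products are bounded by a convolution estimate, and Duhamel's formula gains the factor [1/(nu_k + M)],
   [nu_k = -sigma_k/b_k].  Since [(|f_k|/b_k) (1+j)/(nu_k + M)] is uniformly small for [M] large and [eps]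
   small, Picard iteration started at the Fourier coefficients of [Phi] contracts on the whole of [0,T]; the
   starting residual is [O(eps)], which gives existence and the error bound at once.  The loss of derivatives
   in the residual is paid for by the smoothing of the Kuramoto--Sivashinsky flow.
   The problem is quasilinear at high frequency, so uniqueness uses an L^2 energy estimate valid while two
   solutions have close gradients, followed by continuation in time. *)

Require Import Defs.
From Stdlib Require Import Reals Psatz ZArith Ranalysis5.
From Coquelicot Require Import Coquelicot.
Open Scope R_scope.

(** The perturbation is singular: once [eps * mu] is large, [b] is of order two, so the damping
    drops from fourth to second order in the wave number. At the same time [f/b] grows like the
    first power and the gradient in the quadratic term costs another. Gain and loss then have equal
    order, and the estimate closes only because the damping carries a factor [1/eps] that the flux
    lacks. The exponents are forced by counting powers of [1 + j]. The iteration lives in decay 6: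
    the quadratic term costs one power, [f] three, and two must remain for summability. The residual
    costs six more, since [sigma (1 - 1/b)] is of that order. Four continuous derivatives give decay
    4 for the Kuramoto--Sivashinsky modes, and three rounds of smoothing, each worth three powers,
    reach 13. The contraction says nothing about an arbitrary classical solution, which has decay 4
    at each time with a constant that may vary with time. The energy argument therefore uses only
    what is uniform in time, a bound on [b] times the coefficients and a bound on the gradients, and
    lets the remaining regularity enter qualitatively. *)

(** * Continuity and integrals of real functions *)

Lemma cont_plus f g : continuity f -> continuity g -> continuity (fun y => f y + g y).
Proof. exact (continuity_plus f g). Qed.
Lemma cont_minus f g : continuity f -> continuity g -> continuity (fun y => f y - g y).
Proof. exact (continuity_minus f g). Qed.
Lemma cont_mult f g : continuity f -> continuity g -> continuity (fun y => f y * g y).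
Proof. exact (continuity_mult f g). Qed.
Lemma cont_const c : continuity (fun _ => c).
Proof. apply continuity_const. intros x y; reflexivity. Qed.
Lemma cont_id : continuity (fun y => y).
Proof. exact (derivable_continuous _ derivable_id). Qed.
Lemma cont_scal c f : continuity f -> continuity (fun y => c * f y).
Proof. intro; apply cont_mult; auto using cont_const. Qed.
Lemma cont_sq f : continuity f -> continuity (fun y => f y ^ 2).
Proof.
  intros H x; apply continuity_pt_ext with (f := fun y => f y * f y).
  - intros; ring.
  - now apply cont_mult.
Qed.
Lemma cont_cos_lin a b : continuity (fun y => cos (a * y - b)).
Proof.
  apply (continuity_comp (fun y => a * y - b) cos); [|apply continuity_cos].
  apply cont_minus; [apply cont_scal, cont_id | apply cont_const].
Qed.
Lemma cont_sum (u : nat -> R -> R) n :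
  (forall k, continuity (u k)) -> continuity (fun y => sum_f_R0 (fun k => u k y) n).
Proof.
  intro H; induction n; simpl; [apply H | apply cont_plus; auto].
Qed.
Lemma continuity_ext (f g : R -> R) : (forall x, f x = g x) -> continuity f -> continuity g.
Proof. intros E H x; apply continuity_pt_ext with (f := f); auto. Qed.

Lemma cont_integrable f a b : continuity f -> ex_RInt f a b.
Proof.
  intro H; apply (@ex_RInt_continuous R_CompleteNormedModule).
  intros z _; apply continuity_pt_filterlim, H.
Qed.

(** Specialises [RInt] to real values, so that the algebra of integrals is stated with real addition
    and multiplication. *)
Definition integral (f : R -> R) (a b : R) : R := RInt f a b.

Lemma integral_ext (f g : R -> R) a b : (forall x, f x = g x) -> integral f a b = integral g a b.
Proof. intro H; apply RInt_ext; intros; apply H. Qed.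

Lemma integral_plus f g a b : continuity f -> continuity g ->
  integral (fun y => f y + g y) a b = integral f a b + integral g a b.
Proof. intros; apply (@RInt_plus R_CompleteNormedModule); now apply cont_integrable. Qed.
Lemma integral_minus f g a b : continuity f -> continuity g ->
  integral (fun y => f y - g y) a b = integral f a b - integral g a b.
Proof. intros; apply (@RInt_minus R_CompleteNormedModule); now apply cont_integrable. Qed.
Lemma integral_scal c f a b : continuity f ->
  integral (fun y => c * f y) a b = c * integral f a b.
Proof. intros; apply (@RInt_scal R_CompleteNormedModule); now apply cont_integrable. Qed.
Lemma integral_const c a b : integral (fun _ => c) a b = (b - a) * c.
Proof. unfold integral; rewrite RInt_const; reflexivity. Qed.
Lemma integral_sum (u : nat -> R -> R) n a b : (forall k, continuity (u k)) ->
  integral (fun y => sum_f_R0 (fun k => u k y) n) a b = sum_f_R0 (fun k => integral (u k) a b) n.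
Proof.
  intro H; induction n; simpl.
  - reflexivity.
  - rewrite integral_plus, IHn; auto. now apply cont_sum.
Qed.

Lemma integral_le f g a b : a <= b -> continuity f -> continuity g ->
  (forall x, a <= x <= b -> f x <= g x) -> integral f a b <= integral g a b.
Proof.
  intros H Hf Hg Hle; unfold integral; apply RInt_le; auto using cont_integrable.
  intros x Hx; apply Hle; lra.
Qed.

Lemma integral_bound f a b M : a <= b -> continuity f ->
  (forall x, a <= x <= b -> Rabs (f x) <= M) -> Rabs (integral f a b) <= (b - a) * M.
Proof.
  intros H Hf HM. apply Rabs_le; split.
  - replace (- ((b - a) * M)) with (integral (fun _ => - M) a b) by (rewrite integral_const; ring).
    apply integral_le; auto using cont_const. intros x Hx; specialize (HM x Hx); apply Rabs_le_between in HM; lra.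
  - replace ((b - a) * M) with (integral (fun _ => M) a b) by (rewrite integral_const; ring).
    apply integral_le; auto using cont_const. intros x Hx; specialize (HM x Hx); apply Rabs_le_between in HM; lra.
Qed.

Lemma integral_derivative f f' a b : (forall x, derivable_pt_lim f x (f' x)) -> continuity f' ->
  integral f' a b = f b - f a.
Proof.
  intros H Hc. apply is_RInt_unique.
  apply (is_RInt_derive f f').
  - intros x _; apply is_derive_Reals, H.
  - intros x _; apply continuity_pt_filterlim, Hc.
Qed.

(** * The Fourier basis *)

(** With [kap], [amp] and [phase] every basis function is a single cosine, the sines being shifted
    by a quarter period. Products and bounds of modes then need no case distinction on parity. *)
Definition kap (L : R) (k : nat) : R := 2 * PI * jidx k / L.
Definition amp (L : R) (k : nat) : R := match k with O => / sqrt L | _ => sqrt (2 / L) end.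
Definition phase (k : nat) : R :=
  match k with O => 0 | _ => if Nat.odd k then 0 else PI / 2 end.
(* Differentiation swaps sine and cosine: [w_k' = sgn k * kap k * w_(partner k)]. *)
Definition partner (k : nat) : nat :=
  match k with O => O | S k' => if Nat.odd k then S k else k' end.
Definition sgn (k : nat) : R := if Nat.odd k then - 1 else 1.

Lemma jidx_odd n : jidx (2 * n + 1) = INR (n + 1).
Proof. unfold jidx. f_equal. symmetry. apply (Nat.div_unique _ 2 (n+1) 0); lia. Qed.
Lemma jidx_even n : jidx (2 * n) = INR n.
Proof. unfold jidx. f_equal. symmetry. apply (Nat.div_unique _ 2 n 1); lia. Qed.
Lemma jidx_pos k : 0 <= jidx k.
Proof. apply pos_INR. Qed.
Lemma jidx_0 : jidx 0 = 0.
Proof. reflexivity. Qed.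
Lemma jidx_S k : 1 <= jidx (S k).
Proof.
  unfold jidx. change 1 with (INR 1). apply le_INR.
  apply Nat.div_le_lower_bound; lia.
Qed.

Lemma parity k : k = 0%nat \/ (exists n, k = (2 * n + 1)%nat) \/ (exists n, k = (2 * n + 2)%nat).
Proof.
  destruct (Nat.Even_or_Odd k) as [[n H]|[n H]].
  - destruct n; [left; lia | right; right; exists n; lia].
  - right; left; exists n; lia.
Qed.
Lemma odd_odd n : Nat.odd (2 * n + 1) = true.
Proof. rewrite Nat.odd_spec; exists n; lia. Qed.
Lemma odd_even n : Nat.odd (2 * n + 2) = false.
Proof. rewrite <- Nat.negb_even. replace (Nat.even (2*n+2)) with true; auto. symmetry; rewrite Nat.even_spec; exists (n+1)%nat; lia. Qed.

Lemma phase_odd n : phase (2 * n + 1) = 0.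
Proof. unfold phase. rewrite odd_odd. now replace (2 * n + 1)%nat with (S (2 * n)) by lia. Qed.
Lemma phase_even n : phase (2 * n + 2) = PI / 2.
Proof. unfold phase. rewrite odd_even. now replace (2 * n + 2)%nat with (S (2 * n + 1)) by lia. Qed.
Lemma partner_odd n : partner (2 * n + 1) = (2 * n + 2)%nat.
Proof. unfold partner. rewrite odd_odd. replace (2*n+1)%nat with (S (2*n)) by lia. lia. Qed.
Lemma partner_even n : partner (2 * n + 2) = (2 * n + 1)%nat.
Proof. unfold partner. rewrite odd_even. replace (2*n+2)%nat with (S (2*n+1)) by lia. reflexivity. Qed.
Lemma partner_invol k : partner (partner k) = k.
Proof.
  destruct (parity k) as [->|[[n ->]|[n ->]]]; auto;
  rewrite ?partner_odd, ?partner_even, ?partner_odd; auto.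
Qed.
Lemma jidx_partner k : jidx (partner k) = jidx k.
Proof.
  destruct (parity k) as [->|[[n ->]|[n ->]]]; auto.
  - rewrite partner_odd. replace (2*n+2)%nat with (2*(n+1))%nat by lia.
    now rewrite jidx_even, jidx_odd.
  - rewrite partner_even. replace (2*n+2)%nat with (2*(n+1))%nat by lia.
    now rewrite jidx_even, jidx_odd.
Qed.
Lemma kap_partner L k : kap L (partner k) = kap L k.
Proof. unfold kap; now rewrite jidx_partner. Qed.
Lemma sgn_sq k : sgn k * sgn k = 1.
Proof. unfold sgn; destruct (Nat.odd k); ring. Qed.
Lemma sgn_abs k : Rabs (sgn k) = 1.
Proof. unfold sgn; destruct (Nat.odd k); [rewrite Rabs_left; lra | apply Rabs_R1]. Qed.
Lemma kap_0 L : kap L 0 = 0.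
Proof. unfold kap; rewrite jidx_0; unfold Rdiv; ring. Qed.
(** Partners have opposite signs except for the constant mode, which is its own partner; there the
    factor [kap L 0 = 0] saves the identity. *)
Lemma sgn_partner L k : sgn (partner k) * kap L k = - sgn k * kap L k.
Proof.
  destruct (parity k) as [->|[[n ->]|[n ->]]].
  - rewrite kap_0; ring.
  - rewrite partner_odd; unfold sgn; rewrite odd_odd, odd_even; ring.
  - rewrite partner_even; unfold sgn; rewrite odd_odd, odd_even; ring.
Qed.
Lemma lam_kap L k : lam L k = kap L k ^ 2.
Proof. unfold lam, kap, Rdiv. rewrite !Rpow_mult_distr, pow_inv. ring. Qed.
Lemma kap_pos L k : 0 < L -> 0 <= kap L k.
Proof.
  intros HL; unfold kap. apply Rmult_le_pos.
  - apply Rmult_le_pos; [|apply jidx_pos]. pose proof PI_RGT_0; lra.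
  - now left; apply Rinv_0_lt_compat.
Qed.

Lemma w_phase L k y : w L k y = amp L k * cos (kap L k * y - phase k).
Proof.
  destruct k as [|k].
  - simpl. rewrite kap_0. replace (0 * y - 0) with 0 by ring. rewrite cos_0; ring.
  - unfold w, amp, phase. replace (kap L (S k) * y) with (2 * PI * jidx (S k) * y / L)
      by (unfold kap, Rdiv; ring).
    destruct (Nat.odd (S k)).
    + now rewrite Rminus_0_r.
    + f_equal. rewrite cos_minus, cos_PI2, sin_PI2. ring.
Qed.

Lemma wder_partner L k y :
  - amp L k * kap L k * sin (kap L k * y - phase k) = sgn k * kap L k * w L (partner k) y.
Proof.
  rewrite w_phase, kap_partner.
  destruct (parity k) as [->|[[n ->]|[n ->]]].
  - rewrite kap_0; ring.
  - rewrite partner_odd, phase_odd, phase_even, cos_minus, cos_PI2, sin_PI2, Rminus_0_r.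
    unfold sgn. rewrite odd_odd, Nat.add_1_r, <- plus_n_Sm. simpl amp. ring.
  - rewrite partner_even, phase_odd, phase_even, sin_minus, cos_PI2, sin_PI2, Rminus_0_r.
    unfold sgn. rewrite odd_even, Nat.add_1_r, <- plus_n_Sm. simpl amp. ring.
Qed.

Lemma w_der L k y :
  derivable_pt_lim (w L k) y (sgn k * kap L k * w L (partner k) y).
Proof.
  rewrite <- wder_partner. apply is_derive_Reals.
  apply (is_derive_ext (fun y => amp L k * cos (kap L k * y - phase k))).
  - intro; now rewrite w_phase.
  - auto_derive; auto. unfold Rminus; ring.
Qed.

Lemma w_cont L k : continuity (w L k).
Proof.
  apply continuity_ext with (f := fun y => amp L k * cos (kap L k * y - phase k)).
  - intro; now rewrite w_phase.
  - apply cont_scal, cont_cos_lin.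
Qed.

Definition wmax (L : R) : R := sqrt (2 / L).

Lemma wmax_pos L : 0 < L -> 0 < wmax L.
Proof. intro H; apply sqrt_lt_R0, Rdiv_lt_0_compat; lra. Qed.
Lemma wmax_sq L : 0 < L -> wmax L * wmax L = 2 / L.
Proof. intro H; apply sqrt_sqrt; left; apply Rdiv_lt_0_compat; lra. Qed.

Lemma amp_bound L k : 0 < L -> 0 < amp L k <= wmax L.
Proof.
  intro H. destruct k; simpl.
  - split. apply Rinv_0_lt_compat, sqrt_lt_R0; auto.
    rewrite <- sqrt_inv. apply sqrt_le_1_alt. unfold Rdiv.
    assert (0 < / L) by (apply Rinv_0_lt_compat; lra). lra.
  - split; [apply wmax_pos; auto | apply Rle_refl].
Qed.

Lemma w_bound L k y : 0 < L -> Rabs (w L k y) <= wmax L.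
Proof.
  intro H. rewrite w_phase, Rabs_mult. destruct (amp_bound L k H).
  rewrite (Rabs_right (amp L k)) by lra.
  assert (Rabs (cos (kap L k * y - phase k)) <= 1) by (apply Rabs_le, COS_bound).
  pose proof (Rabs_pos (cos (kap L k * y - phase k))). nra.
Qed.

Lemma cos_shift_nat x n : cos (x + 2 * PI * INR n) = cos x.
Proof. rewrite <- (cos_period x n). f_equal; ring. Qed.
Lemma sin_shift_nat x n : sin (x + 2 * PI * INR n) = sin x.
Proof. rewrite <- (sin_period x n). f_equal; ring. Qed.

Lemma w_per L k : 0 < L -> periodic L (w L k).
Proof.
  intros H y. rewrite !w_phase. f_equal.
  replace (kap L k * (y + L) - phase k) with (kap L k * y - phase k + 2 * PI * jidx k)
   by (unfold kap; field; lra).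
  apply cos_shift_nat.
Qed.

(** At the two ends of the period the argument is one common number plus [2 PI a] and [2 PI b]
    respectively, so the antiderivative takes the same value. Writing the frequency as a difference
    of naturals covers negative frequencies too. *)
Lemma int_cos_zero L a b chi : 0 < L -> INR a - INR b <> 0 ->
  integral (fun y => cos (2 * PI * (INR a - INR b) / L * y - chi)) (- (L / 2)) (L / 2) = 0.
Proof.
  intros HL Hn. set (K := 2 * PI * (INR a - INR b) / L).
  assert (HK : K <> 0).
  { intro E. assert (E2 : 2 * PI * (INR a - INR b) = 0).
    { replace (2 * PI * (INR a - INR b)) with (K * L) by (unfold K; field; lra). rewrite E; ring. }
    apply Rmult_integral in E2 as [E2|E2]; auto. pose proof PI_RGT_0; lra. }
  rewrite (integral_derivative (fun y => / K * sin (K * y - chi))).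
  - replace (K * (L/2) - chi) with (- (PI * INR a) - PI * INR b - chi + 2 * PI * INR a)
      by (unfold K; field; lra).
    replace (K * - (L/2) - chi) with (- (PI * INR a) - PI * INR b - chi + 2 * PI * INR b)
      by (unfold K; field; lra).
    rewrite !sin_shift_nat. ring.
  - intro x. apply is_derive_Reals. auto_derive; auto. unfold Rminus; field; auto.
  - apply cont_cos_lin.
Qed.

Lemma cos_cos a b : cos a * cos b = / 2 * (cos (a - b) + cos (a + b)).
Proof. rewrite cos_minus, cos_plus. field. Qed.

Lemma w_mul L i k y : w L i y * w L k y =
  / 2 * amp L i * amp L k *
   (cos ((kap L i - kap L k) * y - (phase i - phase k))
    + cos ((kap L i + kap L k) * y - (phase i + phase k))).
Proof.
  rewrite !w_phase.
  replace ((kap L i - kap L k) * y - (phase i - phase k)) with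
    ((kap L i * y - phase i) - (kap L k * y - phase k)) by ring.
  replace ((kap L i + kap L k) * y - (phase i + phase k)) with
    ((kap L i * y - phase i) + (kap L k * y - phase k)) by ring.
  replace (/ 2 * amp L i * amp L k * (cos ((kap L i * y - phase i) - (kap L k * y - phase k)) + cos ((kap L i * y - phase i) + (kap L k * y - phase k))))
   with (amp L i * amp L k * (/ 2 * (cos ((kap L i * y - phase i) - (kap L k * y - phase k)) + cos ((kap L i * y - phase i) + (kap L k * y - phase k))))) by ring.
  rewrite <- cos_cos. ring.
Qed.

(** A function in place of the relation [is_coef]; on continuous functions the two agree. *)
Definition coef (L : R) (f : R -> R) (k : nat) : R :=
  integral (fun y => f y * w L k y) (- (L / 2)) (L / 2).

(** Two different modes with one wave number are a cosine and a sine; the quarter-period phase shift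
    is what makes them orthogonal although their frequencies do not separate them. *)
Lemma jidx_eq_cases i k : i <> k -> jidx i = jidx k ->
  (phase i - phase k = PI / 2 \/ phase i - phase k = - (PI / 2)) /\ 0 < jidx i.
Proof.
  intros Hne He.
  destruct (parity i) as [->|[[n ->]|[n ->]]]; destruct (parity k) as [->|[[m ->]|[m ->]]];
    try (replace (2*n+2)%nat with (2*(n+1))%nat in * by lia);
    try (replace (2*m+2)%nat with (2*(m+1))%nat in * by lia);
    rewrite ?jidx_0, ?jidx_odd, ?jidx_even in *;
    try (change 0 with (INR 0) in He); try (apply INR_eq in He; exfalso; lia); apply INR_eq in He.
  all: replace m with n by lia; (split; [|apply lt_0_INR; lia]).
  - right. replace (2*(n+1))%nat with (2*n+2)%nat by lia. rewrite phase_odd, phase_even. ring.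
  - left. replace (2*(n+1))%nat with (2*n+2)%nat by lia. rewrite phase_odd, phase_even. ring.
Qed.

(** By the product formula only a vanishing sum or difference of wave numbers contributes. The
    difference vanishes for [i = k], which gives the norm, and for a sine-cosine pair, where the
    constant is [cos (PI/2) = 0]. The sum vanishes only for [i = k = 0], which is why the constant
    mode has its own amplitude. *)
Lemma w_orth L i k : 0 < L -> coef L (w L i) k = if Nat.eq_dec i k then 1 else 0.
Proof.
  intro HL. unfold coef.
  rewrite (integral_ext _ (fun y => / 2 * amp L i * amp L k *
   (cos ((kap L i - kap L k) * y - (phase i - phase k))
    + cos ((kap L i + kap L k) * y - (phase i + phase k))))) by (intro; apply w_mul).
  rewrite integral_scal by (apply cont_plus; apply cont_cos_lin).
  rewrite integral_plus by apply cont_cos_lin.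
  assert (Hp : kap L i + kap L k <> 0 ->
     integral (fun y => cos ((kap L i + kap L k) * y - (phase i + phase k))) (- (L / 2)) (L / 2) = 0).
  { intro Hn. replace (kap L i + kap L k) with (2 * PI * (INR ((i+1)/2 + (k+1)/2) - INR 0) / L) in *.
    - apply int_cos_zero; auto. intro E; apply Hn; rewrite E. unfold Rdiv; ring.
    - rewrite plus_INR. change (INR 0) with 0. unfold kap, jidx, Rdiv. ring. }
  assert (Hm : kap L i - kap L k <> 0 ->
     integral (fun y => cos ((kap L i - kap L k) * y - (phase i - phase k))) (- (L / 2)) (L / 2) = 0).
  { intro Hn. replace (kap L i - kap L k) with (2 * PI * (INR ((i+1)/2) - INR ((k+1)/2)) / L) in *.
    - apply int_cos_zero; auto. intro E; apply Hn; rewrite E. unfold Rdiv; ring.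
    - unfold kap, jidx, Rdiv. ring. }
  assert (HK : forall a, 0 < jidx a -> 0 < kap L a).
  { intros a Ha. unfold kap. apply Rdiv_lt_0_compat; auto. pose proof PI_RGT_0; nra. }
  pose proof (kap_pos L i HL); pose proof (kap_pos L k HL).
  destruct (Nat.eq_dec i k) as [<-|Hne].
  - replace (kap L i - kap L i) with 0 by ring. replace (phase i - phase i) with 0 by ring.
    rewrite (integral_ext _ (fun _ => 1)) by (intro; replace (0 * x - 0) with 0 by ring; apply cos_0).
    rewrite integral_const. destruct i as [|i].
    + rewrite kap_0. rewrite (integral_ext _ (fun _ => 1)), integral_const.
      * simpl amp. assert (sqrt L * sqrt L = L) by (apply sqrt_sqrt; lra).
        assert (0 < sqrt L) by (apply sqrt_lt_R0; auto).
        replace (L/2 - - (L/2)) with (sqrt L * sqrt L) by lra. field. lra.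
      * intro; replace ((0+0) * x - (phase 0 + phase 0)) with 0 by (simpl; ring). apply cos_0.
    + rewrite Hp. 2:{ specialize (HK (S i)). pose proof (jidx_S i). lra. }
      assert (wmax L * wmax L = 2 / L) by now apply wmax_sq. unfold wmax in H1. simpl amp.
      replace (/2 * sqrt (2/L) * sqrt (2/L)) with (/2 * (sqrt (2/L) * sqrt (2/L))) by ring.
      rewrite H1. field. lra.
  - destruct (Req_dec (jidx i) (jidx k)) as [E|E].
    + destruct (jidx_eq_cases i k Hne E) as [Hph Hj].
      rewrite Hp by (specialize (HK i Hj); lra).
      replace (kap L i - kap L k) with 0 by (unfold kap; rewrite E; ring).
      rewrite (integral_ext _ (fun _ => 0)), integral_const. ring.
      intro x. replace (0 * x - (phase i - phase k)) with (- (phase i - phase k)) by ring.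
      rewrite cos_neg. destruct Hph as [-> | ->]; rewrite ?cos_neg; apply cos_PI2.
    + assert (kap L i - kap L k <> 0).
      { unfold kap. intro Hz. apply E. pose proof PI_RGT_0.
        assert (2 * PI * (jidx i - jidx k) = 0).
        { replace (2 * PI * (jidx i - jidx k)) with ((2 * PI * jidx i / L - 2 * PI * jidx k / L) * L) by (field; lra).
          rewrite Hz; ring. }
        nra. }
      rewrite Hm by auto. rewrite Hp. ring.
      intro Hz. assert (kap L i = 0) by lra. assert (kap L k = 0) by lra. lra.
Qed.

(** * Limits with an explicit rate and dominated series *)

(** Limits of truncations are taken through an explicit error [C / (N + 2)], the shape of the tails
    of [tel]. *)
Lemma lim_le x y C N0 : (forall N, (N0 <= N)%nat -> x <= y + C / (INR N + 2)) -> x <= y.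
Proof.
  intro H. apply le_epsilon. intros eps He.
  destruct (archimed_cor1 (eps / (Rabs C + 1))) as [n [Hn Hn0]].
  { apply Rdiv_lt_0_compat; auto. pose proof (Rabs_pos C); lra. }
  specialize (H (n + N0)%nat ltac:(lia)).
  apply Rle_trans with (1 := H). apply Rplus_le_compat_l.
  assert (0 < INR n) by (apply lt_0_INR; auto).
  assert (HC : C <= Rabs C + 1) by (pose proof (Rle_abs C); lra).
  assert (INR n <= INR (n + N0) + 2) by (rewrite plus_INR; pose proof (pos_INR N0); lra).
  pose proof (Rabs_pos C).
  apply Rle_trans with ((Rabs C + 1) / (INR (n+N0) + 2)).
  - apply Rmult_le_compat_r; auto. left; apply Rinv_0_lt_compat; lra.
  - apply Rle_trans with ((Rabs C + 1) * / INR n).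
    + apply Rmult_le_compat_l; [lra|]. apply Rinv_le_contravar; auto.
    + apply Rmult_lt_compat_l with (r := Rabs C + 1) in Hn; [|lra].
      replace ((Rabs C + 1) * (eps / (Rabs C + 1))) with eps in Hn by (field; lra). lra.
Qed.

Lemma lim_eq x y C N0 : (forall N, (N0 <= N)%nat -> Rabs (x - y) <= C / (INR N + 2)) -> x = y.
Proof.
  intro H. assert (Rabs (x - y) <= 0).
  { apply (lim_le _ _ C N0). intros N HN; specialize (H N HN); lra. }
  pose proof (Rabs_pos (x-y)). assert (E : Rabs (x - y) = 0) by lra.
  destruct (Req_dec (x - y) 0); [lra|]. apply Rabs_no_R0 in H2; lra.
Qed.

(* Summable majorant with the telescoping partial sums [1 - 1/(n+2)]. *)
Definition tel (k : nat) : R := / ((INR k + 1) * (INR k + 2)).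

Lemma tel_pos k : 0 < tel k.
Proof. unfold tel. pose proof (pos_INR k). apply Rinv_0_lt_compat; nra. Qed.

Lemma tel_diff k : tel k = / (INR k + 1) - / (INR k + 2).
Proof. unfold tel; pose proof (pos_INR k); field; lra. Qed.

Lemma tel_sum n : sum_f_R0 tel n = 1 - / (INR n + 2).
Proof.
  induction n.
  - simpl. rewrite tel_diff; simpl; field.
  - simpl sum_f_R0. rewrite IHn, tel_diff, S_INR. pose proof (pos_INR n). field; lra.
Qed.

Lemma sum_diff_tel u A N n : (forall k, Rabs (u k) <= A * tel k) ->
  Rabs (sum_f_R0 u (N + n) - sum_f_R0 u N) <= A * (/ (INR N + 2) - / (INR (N + n) + 2)).
Proof.
  intro H; induction n.
  - rewrite Nat.add_0_r, !Rminus_diag, Rabs_R0. lra.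
  - replace (N + S n)%nat with (S (N + n)) by lia. simpl sum_f_R0.
    specialize (H (S (N+n))). rewrite tel_diff, S_INR in H.
    replace (sum_f_R0 u (N+n) + u (S (N+n)) - sum_f_R0 u N) with
      ((sum_f_R0 u (N+n) - sum_f_R0 u N) + u (S (N+n))) by ring.
    apply Rle_trans with (1 := Rabs_triang _ _). rewrite S_INR.
    replace (INR (N+n) + 1 + 1) with (INR (N+n) + 2) in H by ring.
    lra.
Qed.

Lemma ex_series_tel u A : (forall k, Rabs (u k) <= A * tel k) -> ex_series u.
Proof.
  intro H. apply (ex_series_le (V := R_CompleteNormedModule)) with (b := fun k => A * tel k); auto.
  apply (ex_series_scal_l A tel).
  exists 1. apply is_series_Reals. intros eps He.
  destruct (archimed_cor1 eps He) as [N [HN HN0]]. exists N. intros n Hn.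
  unfold R_dist. rewrite tel_sum. replace (1 - / (INR n + 2) - 1) with (- / (INR n + 2)) by ring.
  assert (0 < INR N) by (apply lt_0_INR; auto). assert (INR N <= INR n) by (apply le_INR; auto).
  rewrite Rabs_Ropp, Rabs_right. 2:{ left; apply Rinv_0_lt_compat; lra. }
  apply Rle_lt_trans with (2 := HN). apply Rinv_le_contravar; lra.
Qed.

Lemma series_tail u A N : (forall k, Rabs (u k) <= A * tel k) ->
  Rabs (Series u - sum_f_R0 u N) <= A / (INR N + 2).
Proof.
  intro H. pose proof (Series_correct u (ex_series_tel u A H)) as HS.
  apply is_series_Reals in HS. apply le_epsilon. intros eps He.
  destruct (HS eps He) as [M HM]. specialize (HM (N + M)%nat ltac:(lia)).
  unfold R_dist in HM. rewrite Rabs_minus_sym in HM.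
  pose proof (sum_diff_tel u A N M H).
  replace (Series u - sum_f_R0 u N) with ((Series u - sum_f_R0 u (N+M)) + (sum_f_R0 u (N+M) - sum_f_R0 u N)) by ring.
  apply Rle_trans with (1 := Rabs_triang _ _).
  assert (0 <= A). { specialize (H O). pose proof (Rabs_pos (u O)). pose proof (tel_pos 0). nra. }
  assert (0 < / (INR (N+M) + 2)). { apply Rinv_0_lt_compat. pose proof (pos_INR (N+M)); lra. }
  unfold Rdiv. nra.
Qed.

(** The first term and the tail after it contribute at most [A / 2] each. *)
Lemma series_bound u A : (forall k, Rabs (u k) <= A * tel k) -> Rabs (Series u) <= A.
Proof.
  intro H. pose proof (series_tail u A 0 H). specialize (H O).
  unfold tel in H; simpl in *. replace (/ ((0+1)*(0+2))) with (/2) in H by field.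
  replace (A / (0+2)) with (A/2) in * by field.
  replace (Series u) with ((Series u - u O) + u O) by ring.
  apply Rle_trans with (1 := Rabs_triang _ _). lra.
Qed.

(** * Sequences of algebraic decay and their Fourier series *)

(** The weight depends on the wave number only, so both modes of a pair weigh the same and [partner]
    preserves the class. It does not involve the period. *)
Definition decay (r : nat) (A : R) (a : nat -> R) : Prop :=
  forall k, Rabs (a k) <= A / (1 + jidx k) ^ r.

Lemma jidx_half k : INR k / 2 <= jidx k <= (INR k + 1) / 2.
Proof.
  destruct (parity k) as [->|[[n ->]|[n ->]]].
  - rewrite jidx_0; simpl; lra.
  - rewrite jidx_odd, !plus_INR, mult_INR; simpl; lra.
  - replace (2*n+2)%nat with (2*(n+1))%nat by lia.
    rewrite jidx_even, !mult_INR, plus_INR; simpl; lra.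
Qed.

Lemma pow_ge1 x n : 1 <= x -> 1 <= x ^ n.
Proof. apply pow_R1_Rle. Qed.
Lemma inv_pow_mono x n m : 1 <= x -> (n <= m)%nat -> / x ^ m <= / x ^ n.
Proof.
  intros H Hnm. apply Rinv_le_contravar.
  - apply pow_lt; lra.
  - now apply Rle_pow.
Qed.

(** Since [jidx k] is at least [k / 2], the square of [1 + jidx k] is at least [(k + 2)^2 / 4];
    hence the factor 4 that reappears in every bound of a series. *)
Lemma inv_jidx_tel k r : (2 <= r)%nat -> / (1 + jidx k) ^ r <= 4 * tel k.
Proof.
  intro H. pose proof (jidx_pos k). apply Rle_trans with (/ (1 + jidx k) ^ 2).
  - apply inv_pow_mono; auto; lra.
  - pose proof (jidx_half k). pose proof (pos_INR k). unfold tel.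
    replace (4 * / ((INR k + 1) * (INR k + 2))) with (/ (((INR k + 1) * (INR k + 2)) / 4)) by (field; lra).
    apply Rinv_le_contravar; nra.
Qed.

Lemma decay_nonneg r A a : decay r A a -> 0 <= A.
Proof.
  intro H. specialize (H O). rewrite jidx_0 in H. replace ((1+0)^r) with 1 in H.
  - pose proof (Rabs_pos (a O)). unfold Rdiv in H; rewrite Rinv_1 in H. lra.
  - rewrite Rplus_0_r; now rewrite pow1.
Qed.

Lemma decay_tel r A a k : (2 <= r)%nat -> decay r A a -> Rabs (a k) <= 4 * A * tel k.
Proof.
  intros Hr H. pose proof (decay_nonneg _ _ _ H). apply Rle_trans with (1 := H k).
  pose proof (inv_jidx_tel k r Hr). unfold Rdiv. nra.
Qed.

Lemma decay_le_exp r s A a : (r <= s)%nat -> decay s A a -> decay r A a.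
Proof.
  intros Hr H k. pose proof (decay_nonneg _ _ _ H). apply Rle_trans with (1 := H k).
  apply Rmult_le_compat_l; auto. apply inv_pow_mono; auto. pose proof (jidx_pos k); lra.
Qed.
Lemma decay_le r A B a : A <= B -> decay r A a -> decay r B a.
Proof.
  intros Hr H k. apply Rle_trans with (1 := H k).
  apply Rmult_le_compat_r; auto. left; apply Rinv_0_lt_compat, pow_lt. pose proof (jidx_pos k); lra.
Qed.

(** Fourier synthesis, inverse to [coef] on sequences of decay at least 2. As [Series] is total,
    periodicity holds for any sequence. *)
Definition syn (L : R) (a : nat -> R) (y : R) : R := Series (fun k => a k * w L k y).

Lemma series_cont2 (u : nat -> R -> R -> R) A :
  (forall k t y, continuity_2d_pt (u k) t y) ->
  (forall k t y, Rabs (u k t y) <= A * tel k) ->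
  forall t y, continuity_2d_pt (fun t y => Series (fun k => u k t y)) t y.
Proof.
  intros Hc Hb t y eps.
  assert (HA : 0 <= A). { specialize (Hb O 0 0). pose proof (Rabs_pos (u O 0 0)). pose proof (tel_pos 0). nra. }
  destruct (archimed_cor1 (eps / (3 * (A + 1)))) as [N [HN HN0]].
  { apply Rdiv_lt_0_compat; [apply cond_pos | lra]. }
  assert (HNp : 0 < INR N) by (apply lt_0_INR; auto).
  assert (Hfin : forall n, continuity_2d_pt (fun t y => sum_f_R0 (fun k => u k t y) n) t y).
  { induction n; simpl; [apply Hc | apply continuity_2d_pt_plus; auto]. }
  assert (He3 : 0 < eps / 3) by (pose proof (cond_pos eps); lra).
  destruct (Hfin N (mkposreal _ He3)) as [d Hd]. exists d. intros t' y' Ht Hy.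
  specialize (Hd t' y' Ht Hy). simpl in Hd.
  pose proof (series_tail (fun k => u k t' y') A N (fun k => Hb k t' y')) as T1.
  pose proof (series_tail (fun k => u k t y) A N (fun k => Hb k t y)) as T2.
  assert (HT : A / (INR N + 2) < eps / 3).
  { apply Rle_lt_trans with ((A + 1) * / INR N).
    - unfold Rdiv. apply Rmult_le_compat; try lra.
      + left; apply Rinv_0_lt_compat; lra.
      + apply Rinv_le_contravar; lra.
    - apply Rmult_lt_compat_l with (r := A + 1) in HN; [|lra].
      replace ((A + 1) * (eps / (3 * (A + 1)))) with (eps / 3) in HN by (field; lra). lra. }
  apply Rabs_le_between in T1. apply Rabs_le_between in T2. apply Rabs_lt_between in Hd.
  apply Rabs_lt_between. lra.
Qed.

Lemma cont2_section F t : (forall t y, continuity_2d_pt F t y) -> continuity (F t).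
Proof.
  intros H y eps He. destruct (H t y (mkposreal eps He)) as [d Hd].
  exists d. split; [apply cond_pos|]. intros x [_ Hx]. apply Hd; auto.
  rewrite Rminus_diag, Rabs_R0. apply cond_pos.
Qed.
Lemma cont2_snd f t y : continuity f -> continuity_2d_pt (fun _ => f) t y.
Proof.
  intros H eps. destruct (H y eps (cond_pos eps)) as [d [Hd Hd2]].
  exists (mkposreal d Hd). intros u v _ Hv. destruct (Req_dec v y) as [->|Hn].
  - rewrite Rminus_diag, Rabs_R0. apply cond_pos.
  - apply Hd2. split; auto. split; auto. exact I.
Qed.
Lemma cont2_fst f t y : continuity f -> continuity_2d_pt (fun t _ => f t) t y.
Proof.
  intros H eps. destruct (H t eps (cond_pos eps)) as [d [Hd Hd2]].
  exists (mkposreal d Hd). intros u v Hv _. destruct (Req_dec u t) as [->|Hn].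
  - rewrite Rminus_diag, Rabs_R0. apply cond_pos.
  - apply Hd2. split; auto. split; auto. exact I.
Qed.

Lemma series_cont (u : nat -> R -> R) A :
  (forall k, continuity (u k)) -> (forall k y, Rabs (u k y) <= A * tel k) ->
  continuity (fun y => Series (fun k => u k y)).
Proof.
  intros Hc Hb. apply (cont2_section (fun _ y => Series (fun k => u k y)) 0).
  apply (series_cont2 (fun k _ => u k) A); auto.
  intros; now apply cont2_snd.
Qed.

(** Termwise integration against [g] in quantitative form: the uniform tail of the series is
    multiplied by the length of the period and the bound of [g]. *)
Lemma integral_series_tail L (u : nat -> R -> R) A g G N : 0 < L ->
  (forall k, continuity (u k)) -> (forall k y, Rabs (u k y) <= A * tel k) ->
  continuity g -> (forall y, - (L/2) <= y <= L/2 -> Rabs (g y) <= G) ->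
  Rabs (integral (fun y => Series (fun k => u k y) * g y) (- (L/2)) (L/2)
    - sum_f_R0 (fun k => integral (fun y => u k y * g y) (- (L/2)) (L/2)) N) <= L * A * G / (INR N + 2).
Proof.
  intros HL Hc Hb Hg HG.
  rewrite <- (integral_sum (fun k y => u k y * g y)) by (intro; apply cont_mult; auto).
  assert (HS : continuity (fun y => Series (fun k => u k y))) by (eapply series_cont; eauto).
  rewrite <- integral_minus; [|apply cont_mult; auto | apply cont_sum; intro; apply cont_mult; auto].
  replace (L * A * G / (INR N + 2)) with ((L/2 - - (L/2)) * (A / (INR N + 2) * G)) by (unfold Rdiv; field; pose proof (pos_INR N); lra).
  apply integral_bound; [lra | |].
  - apply cont_minus; [apply cont_mult; auto | apply cont_sum; intro; apply cont_mult; auto].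
  - intros y Hy.
    replace (sum_f_R0 (fun k => u k y * g y) N) with (sum_f_R0 (fun k => u k y) N * g y).
    2:{ rewrite Rmult_comm, scal_sum. apply sum_eq; intros; ring. }
    rewrite <- Rmult_minus_distr_r, Rabs_mult.
    apply Rmult_le_compat; try apply Rabs_pos; auto.
    apply (series_tail (fun k => u k y)). intro; apply Hb.
Qed.

Lemma syn_term_bound L r A a k y : 0 < L -> (2 <= r)%nat -> decay r A a ->
  Rabs (a k * w L k y) <= 4 * A * wmax L * tel k.
Proof.
  intros HL Hr H. rewrite Rabs_mult. pose proof (decay_tel r A a k Hr H). pose proof (w_bound L k y HL).
  pose proof (Rabs_pos (a k)). pose proof (Rabs_pos (w L k y)).
  replace (4 * A * wmax L * tel k) with ((4 * A * tel k) * wmax L) by ring.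
  apply Rmult_le_compat; auto.
Qed.

Lemma syn_cont L r A a : 0 < L -> (2 <= r)%nat -> decay r A a -> continuity (syn L a).
Proof.
  intros HL Hr H. apply (series_cont (fun k y => a k * w L k y) (4 * A * wmax L)).
  - intro; apply cont_scal, w_cont.
  - intros; eapply syn_term_bound; eauto.
Qed.

Lemma syn_per L a : 0 < L -> periodic L (syn L a).
Proof. intros HL y. unfold syn. apply Series_ext. intro k. now rewrite (w_per L k HL). Qed.

Lemma syn_bound L r A a y : 0 < L -> (2 <= r)%nat -> decay r A a -> Rabs (syn L a y) <= 4 * A * wmax L.
Proof. intros. apply (series_bound (fun k => a k * w L k y)). intros; eapply syn_term_bound; eauto. Qed.

Lemma sum_delta (a : nat -> R) k N : (k <= N)%nat ->
  sum_f_R0 (fun i => a i * (if Nat.eq_dec i k then 1 else 0)) N = a k.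
Proof.
  induction N; intro H.
  - replace k with 0%nat by lia. simpl; ring.
  - rewrite tech5. destruct (Nat.eq_dec (S N) k) as [<-|Hn].
    + rewrite (sum_eq _ (fun _ => 0)), sum_cte; [ring|].
      intros i Hi. destruct (Nat.eq_dec i (S N)); [lia | ring].
    + rewrite IHN by lia. ring.
Qed.

Lemma coef_syn L r A a k : 0 < L -> (2 <= r)%nat -> decay r A a -> coef L (syn L a) k = a k.
Proof.
  intros HL Hr H. apply (lim_eq _ _ (L * (4 * A * wmax L) * wmax L) k). intros N HN.
  rewrite <- (sum_delta a k N HN).
  rewrite (sum_eq _ (fun i => integral (fun y => a i * w L i y * w L k y) (-(L/2)) (L/2))).
  - apply (integral_series_tail L (fun i y => a i * w L i y)); auto using w_cont.
    + intro; apply cont_scal, w_cont.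
    + intros; eapply syn_term_bound; eauto.
    + intros; now apply w_bound.
  - intros i _. rewrite <- (w_orth L i k HL). unfold coef. rewrite <- integral_scal.
    + apply integral_ext; intro; ring.
    + apply cont_mult; apply w_cont.
Qed.

Lemma coef_ext L f g k : (forall y, f y = g y) -> coef L f k = coef L g k.
Proof. intro H; unfold coef; apply integral_ext; intro; now rewrite H. Qed.
Lemma coef_plus L f g k : continuity f -> continuity g ->
  coef L (fun y => f y + g y) k = coef L f k + coef L g k.
Proof.
  intros; unfold coef. rewrite <- integral_plus by (apply cont_mult; auto using w_cont).
  apply integral_ext; intro; ring.
Qed.
Lemma coef_minus L f g k : continuity f -> continuity g ->
  coef L (fun y => f y - g y) k = coef L f k - coef L g k.
Proof.
  intros; unfold coef. rewrite <- integral_minus by (apply cont_mult; auto using w_cont).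
  apply integral_ext; intro; ring.
Qed.
Lemma coef_scal L c f k : continuity f -> coef L (fun y => c * f y) k = c * coef L f k.
Proof.
  intros; unfold coef. rewrite <- integral_scal by (apply cont_mult; auto using w_cont).
  apply integral_ext; intro; ring.
Qed.
Lemma coef_bound L f M k : 0 < L -> continuity f -> (forall y, - (L/2) <= y <= L/2 -> Rabs (f y) <= M) ->
  Rabs (coef L f k) <= L * M * wmax L.
Proof.
  intros HL Hf HM. replace (L * M * wmax L) with ((L/2 - - (L/2)) * (M * wmax L)) by field.
  apply integral_bound; [lra | apply cont_mult; auto using w_cont |].
  intros x Hx; rewrite Rabs_mult. apply Rmult_le_compat; auto using Rabs_pos, w_bound.
Qed.

(** * Periodicity and completeness of the trigonometric system *)

Lemma per_nat L f n y : periodic L f -> f (y + INR n * L) = f y.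
Proof.
  intro H. induction n.
  - f_equal; simpl; ring.
  - rewrite S_INR. replace (y + (INR n + 1) * L) with ((y + INR n * L) + L) by ring. now rewrite H.
Qed.
Lemma per_Z L f n y : periodic L f -> f (y + IZR n * L) = f y.
Proof.
  intro H. destruct (Z_le_gt_dec 0 n).
  - rewrite <- (Z2Nat.id n), <- INR_IZR_INZ by auto. now apply per_nat.
  - rewrite <- (per_nat L f (Z.to_nat (- n)) (y + IZR n * L) H). f_equal.
    rewrite INR_IZR_INZ, Z2Nat.id by lia. rewrite opp_IZR. ring.
Qed.

Lemma per_reduce L y : 0 < L -> exists y0, - (L/2) <= y0 <= L/2 /\
  forall f, periodic L f -> f y = f y0.
Proof.
  intro HL. set (n := up (y / L - / 2)). destruct (archimed (y / L - / 2)) as [H1 H2].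
  fold n in H1, H2. exists (y - IZR n * L).
  assert (E : y = y / L * L) by (field; lra).
  split; [nra|]. intros f Hf.
  rewrite <- (per_Z L f n (y - IZR n * L) Hf). f_equal; ring.
Qed.

Lemma interval_bound f a b : a <= b -> continuity f -> exists M, 0 < M /\ forall y, a <= y <= b -> Rabs (f y) <= M.
Proof.
  intros Hab Hf. destruct (continuity_ab_maj (fun y => Rabs (f y)) a b Hab) as [m [Hm _]].
  - intros c _. apply (continuity_pt_comp f Rabs); [apply Hf | apply Rcontinuity_abs].
  - exists (Rabs (f m) + 1). split; [pose proof (Rabs_pos (f m)); lra|].
    intros y Hy; specialize (Hm y Hy); simpl in Hm; lra.
Qed.

Lemma integral_lin c d f g a b : continuity f -> continuity g ->
  integral (fun y => c * f y + d * g y) a b = c * integral f a b + d * integral g a b.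
Proof.
  intros. rewrite integral_plus by now apply cont_scal. now rewrite !integral_scal.
Qed.

Lemma integral_subinterval f a b c d : a <= c -> c <= d -> d <= b -> continuity f -> (forall x, 0 <= f x) ->
  integral f c d <= integral f a b.
Proof.
  intros H1 H2 H3 Hf Hp. unfold integral.
  rewrite <- (RInt_Chasles f a c b) by now apply cont_integrable.
  rewrite <- (RInt_Chasles f c d b) by now apply cont_integrable.
  assert (0 <= RInt f a c) by (apply RInt_ge_0; auto using cont_integrable).
  assert (0 <= RInt f d b) by (apply RInt_ge_0; auto using cont_integrable).
  unfold plus; simpl. lra.
Qed.

Lemma cont_pow f n : continuity f -> continuity (fun y => f y ^ n).
Proof.
  intro H; induction n; simpl; [apply cont_const | now apply cont_mult].
Qed.

(** The free phase [chi] treats sines and cosines at once. The second argument is a weight, which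
    will be a power of the concentrating kernel. *)
Definition trig_orth (L : R) (f g : R -> R) : Prop :=
  forall n chi, integral (fun y => f y * g y * cos (2 * PI * INR n / L * y - chi)) (- (L/2)) (L/2) = 0.

(** A cosine of frequency [n] with arbitrary phase is a combination of the cosine and the sine mode
    of that wave number. *)
Lemma trig_orth_one L f : 0 < L -> continuity f -> (forall k, coef L f k = 0) ->
  trig_orth L f (fun _ => 1).
Proof.
  intros HL Hf H n chi.
  assert (Hw : forall k, amp L k * integral (fun y => f y * cos (kap L k * y - phase k)) (- (L/2)) (L/2) = 0).
  { intro k. rewrite <- (H k). unfold coef. rewrite <- integral_scal by (apply cont_mult; auto; apply cont_cos_lin).
    apply integral_ext; intro; rewrite w_phase; ring. }
  assert (Hw2 : forall k, integral (fun y => f y * cos (kap L k * y - phase k)) (- (L/2)) (L/2) = 0).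
  { intro k. destruct (Rmult_integral _ _ (Hw k)); auto. destruct (amp_bound L k HL); lra. }
  destruct n as [|n].
  - rewrite (integral_ext _ (fun y => cos chi * (f y * cos (kap L 0 * y - phase 0)))).
    + rewrite integral_scal, Hw2; [ring | apply cont_mult; auto; apply cont_cos_lin].
    + intro y. rewrite kap_0. simpl. replace (0 * y - 0) with 0 by ring.
      replace (2 * PI * 0 / L * y - chi) with (- chi) by (unfold Rdiv; ring). rewrite cos_neg, cos_0. ring.
  - rewrite (integral_ext _ (fun y => cos chi * (f y * cos (kap L (2*n+1) * y - phase (2*n+1)))
       + sin chi * (f y * cos (kap L (2*n+2) * y - phase (2*n+2))))).
    + rewrite integral_lin, !Hw2; [ring | apply cont_mult; auto; apply cont_cos_lin ..].
    + intro y. rewrite phase_odd, phase_even. unfold kap.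
      replace (jidx (2*n+2)) with (INR (S n)) by (rewrite <- jidx_even; f_equal; lia).
      replace (jidx (2*n+1)) with (INR (S n)) by (rewrite jidx_odd; f_equal; lia).
      rewrite Rminus_0_r, !cos_minus, cos_PI2, sin_PI2. ring.
Qed.

(** Multiplication by a cosine of frequency one shifts frequencies by one in both directions, so
    orthogonality to all frequencies survives. At [n = 0] the downward shift is frequency one with
    reversed phase, since the cosine is even. *)
Lemma trig_orth_mul L f g psi : continuity f -> continuity g -> trig_orth L f g ->
  trig_orth L f (fun y => g y * (1 + cos (2 * PI / L * y - psi))).
Proof.
  intros Hf Hg H n chi.
  assert (Hc : forall n chi, continuity (fun y => f y * g y * cos (2 * PI * INR n / L * y - chi))).
  { intros; repeat apply cont_mult; auto; apply cont_cos_lin. }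
  assert (Hm : exists m chi', forall y, cos (2 * PI * INR n / L * y - chi - (2 * PI / L * y - psi)) =
     cos (2 * PI * INR m / L * y - chi')).
  { destruct n as [|n].
    - exists 1%nat, (psi - chi). intro y. rewrite <- cos_neg. f_equal. simpl. unfold Rdiv; ring.
    - exists n, (chi - psi). intro y. f_equal. rewrite S_INR. unfold Rdiv; ring. }
  destruct Hm as [m [chi' Hm]].
  rewrite (integral_ext _ (fun y => f y * g y * cos (2 * PI * INR n / L * y - chi) +
    / 2 * (f y * g y * cos (2 * PI * INR m / L * y - chi') +
           f y * g y * cos (2 * PI * INR (S n) / L * y - (chi + psi))))).
  - rewrite integral_plus, integral_scal, integral_plus, !H; try ring; auto. apply cont_plus; auto. apply cont_scal, cont_plus; auto.
  - intro y. rewrite <- Hm.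
    replace (2 * PI * INR (S n) / L * y - (chi + psi)) with
      (2 * PI * INR n / L * y - chi + (2 * PI / L * y - psi)) by (rewrite S_INR; unfold Rdiv; ring).
    set (X := 2 * PI * INR n / L * y - chi). set (Y := 2 * PI / L * y - psi).
    pose proof (cos_cos X Y) as E.
    replace (f y * g y * cos X + / 2 * (f y * g y * cos (X - Y) + f y * g y * cos (X + Y)))
      with (f y * g y * (cos X + / 2 * (cos (X - Y) + cos (X + Y)))) by ring.
    rewrite <- E. ring.
Qed.

Lemma trig_orth_pow L f psi n : 0 < L -> continuity f -> (forall k, coef L f k = 0) ->
  trig_orth L f (fun y => (1 + cos (2 * PI / L * y - psi)) ^ n).
Proof.
  intros HL Hf H. induction n.
  - now apply trig_orth_one.
  - intros m chi. rewrite <- (trig_orth_mul L f (fun y => (1 + cos (2 * PI / L * y - psi)) ^ n) psi Hf) with (n := m) (chi := chi); auto.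
    + apply integral_ext; intro y; simpl; ring.
    + apply cont_pow, cont_plus; [apply cont_const | apply cont_cos_lin].
Qed.

Lemma cos_le_outside x d : 0 < d < PI -> d <= Rabs x <= 2 * PI - d -> cos x <= cos d.
Proof.
  intros Hd Hx. assert (E : cos x = cos (Rabs x)).
  { unfold Rabs; destruct (Rcase_abs x); auto. now rewrite cos_neg. }
  rewrite E. destruct (Rle_dec (Rabs x) PI).
  - apply cos_decr_1; lra.
  - replace (cos (Rabs x)) with (cos (2 * PI - Rabs x)).
    + apply cos_decr_1; lra.
    + rewrite <- (cos_neg (Rabs x)). rewrite <- (cos_period (- Rabs x) 1). f_equal; simpl; ring.
Qed.

(* Testing against [(1 + cos (2 pi (y - x0) / L))^n] concentrates at [x0]. *)
Lemma zero_coef_nonpos L f x0 : 0 < L -> continuity f -> (forall k, coef L f k = 0) ->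
  - (L/2) < x0 < L/2 -> f x0 <= 0.
Proof.
  intros HL Hf H Hx0. destruct (Rle_dec (f x0) 0) as [|Hn]; auto. exfalso.
  set (c := f x0 / 2). assert (Hc : 0 < c) by (unfold c; lra).
  destruct (Hf x0 c Hc) as [d0 [Hd0 Hd]].
  (* Half the distance to each end keeps the neighbourhood inside the period and every point of the
     period within [L - d] of [x0], so the kernel does not peak again at the far side. *)
  set (d := Rmin (d0 / 2) (Rmin ((L/2 - x0) / 2) ((L/2 + x0) / 2))).
  assert (Hdp : 0 < d) by (unfold d; repeat apply Rmin_pos; lra).
  assert (Hd1 : d < d0). { unfold d. pose proof (Rmin_l (d0/2) (Rmin ((L/2 - x0) / 2) ((L/2 + x0) / 2))). lra. }
  assert (Hd23 : d <= (L/2 - x0)/2 /\ d <= (L/2 + x0)/2).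
  { unfold d. pose proof (Rmin_r (d0/2) (Rmin ((L/2 - x0) / 2) ((L/2 + x0) / 2))).
    pose proof (Rmin_l ((L/2 - x0) / 2) ((L/2 + x0) / 2)). pose proof (Rmin_r ((L/2 - x0) / 2) ((L/2 + x0) / 2)). lra. }
  clearbody d. destruct Hd23 as [Hd2 Hd3].
  assert (Hin : forall y, Rabs (y - x0) <= d -> c <= f y).
  { intros y Hy. destruct (Req_dec y x0) as [->|Hne]. unfold c; lra.
    specialize (Hd y). simpl in Hd; unfold R_dist in Hd.
    assert (Hlt : Rabs (f y - f x0) < c) by (apply Hd; split; [split; [exact I | auto] | lra]).
    apply Rabs_lt_between in Hlt. unfold c in *; lra. }
  destruct (interval_bound f (-(L/2)) (L/2) ltac:(lra) Hf) as [M [HM HMb]].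
  set (psi := 2 * PI / L * x0). pose proof PI_RGT_0 as HPI.
  set (th := 2 * PI / L * d).
  assert (Hth : 0 < th < PI).
  { unfold th. split. apply Rmult_lt_0_compat; auto. apply Rdiv_lt_0_compat; lra.
    replace PI with (2 * PI / L * (L / 2)) at 2 by (field; lra).
    apply Rmult_lt_compat_l; [|lra]. apply Rdiv_lt_0_compat; lra. }
  (* The kernel is at most [q] farther than [d] from [x0] and at least [q1 > q] within [d / 2];
     powers of the ratio [q1 / q] produce the contradiction. *)
  set (q := 1 + cos th). set (q1 := 1 + cos (th / 2)).
  assert (Hq : 0 < q).
  { unfold q. assert (cos PI < cos th) by (apply cos_decreasing_1; lra). rewrite cos_PI in H0; lra. }
  assert (Hq1 : q < q1). { unfold q, q1. assert (cos th < cos (th/2)) by (apply cos_decreasing_1; lra). lra. }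
  set (K := fun y => 1 + cos (2 * PI / L * y - psi)).
  assert (HK0 : forall y, 0 <= K y). { intro y; unfold K. pose proof (COS_bound (2 * PI / L * y - psi)). lra. }
  assert (HKc : continuity K) by (apply cont_plus; [apply cont_const | apply cont_cos_lin]).
  assert (Harg : forall y, 2 * PI / L * y - psi = 2 * PI / L * (y - x0)) by (intro; unfold psi; ring).
  assert (HPL : 0 < 2 * PI / L) by (apply Rdiv_lt_0_compat; lra).
  assert (HKin : forall y, Rabs (y - x0) <= d / 2 -> q1 <= K y).
  { intros y Hy. unfold K, q1. rewrite Harg.
    assert (E : cos (2 * PI / L * (y - x0)) = cos (2 * PI / L * Rabs (y - x0))).
    { unfold Rabs; destruct (Rcase_abs (y - x0)); auto. rewrite <- cos_neg. f_equal; ring. }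
    rewrite E. apply Rplus_le_compat_l.
    assert (2 * PI / L * Rabs (y - x0) <= th / 2).
    { unfold th. replace (2 * PI / L * d / 2) with (2 * PI / L * (d / 2)) by (unfold Rdiv; ring).
      apply Rmult_le_compat_l; lra. }
    assert (0 <= 2 * PI / L * Rabs (y - x0)) by (apply Rmult_le_pos; [lra | apply Rabs_pos]).
    apply cos_decr_1; lra. }
  assert (HKout : forall y, - (L/2) <= y <= L/2 -> d < Rabs (y - x0) -> K y <= q).
  { intros y Hy Hyd. unfold K, q. rewrite Harg. apply Rplus_le_compat_l.
    apply cos_le_outside; auto. rewrite Rabs_mult, (Rabs_right (2 * PI / L)) by lra.
    replace (2 * PI - th) with (2 * PI / L * (L - d)) by (unfold th; field; lra). unfold th.
    assert (Rabs (y - x0) <= L - d) by (apply Rabs_le; lra).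
    split; apply Rmult_le_compat_l; lra. }
  (* Near [x0] the function is at least [c], and elsewhere the kernel is at most [q], so
     [c K^n <= f K^n + (M + c) q^n] on the whole period. The integral of [f K^n] vanishes because
     [K^n] is a trigonometric polynomial. *)
  assert (Key : forall n, c * (d * q1 ^ n) <= L * ((M + c) * q ^ n)).
  { intro n.
    assert (HKnc : continuity (fun y => K y ^ n)) by now apply cont_pow.
    assert (Hz : integral (fun y => f y * K y ^ n) (-(L/2)) (L/2) = 0).
    { rewrite <- (trig_orth_pow L f psi n HL Hf H 0%nat 0). apply integral_ext; intro y.
      replace (2 * PI * INR 0 / L * y - 0) with 0 by (simpl; unfold Rdiv; ring). rewrite cos_0. unfold K; ring. }
    assert (H1 : integral (fun y => c * K y ^ n) (-(L/2)) (L/2) <= integral (fun y => f y * K y ^ n + (M + c) * q ^ n) (-(L/2)) (L/2)).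
    { apply integral_le; [lra | now apply cont_scal | apply cont_plus; [now apply cont_mult | apply cont_const] |].
      intros y Hy. pose proof (pow_le (K y) n (HK0 y)). pose proof (pow_lt q n Hq).
      destruct (Rle_dec (Rabs (y - x0)) d) as [Hi|Ho].
      - specialize (Hin y Hi). nra.
      - assert (K y ^ n <= q ^ n) by (apply pow_incr; split; [auto | apply HKout; auto; lra]).
        specialize (HMb y Hy). apply Rabs_le_between in HMb. nra. }
    rewrite integral_scal in H1 by auto. rewrite integral_plus in H1; [|now apply cont_mult | apply cont_const].
    rewrite Hz, integral_const in H1.
    assert (H2 : d * q1 ^ n <= integral (fun y => K y ^ n) (-(L/2)) (L/2)).
    { apply Rle_trans with (integral (fun y => K y ^ n) (x0 - d/2) (x0 + d/2)).
      - replace (d * q1 ^ n) with (integral (fun _ => q1 ^ n) (x0 - d/2) (x0 + d/2)) by (rewrite integral_const; field).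
        apply integral_le; [lra | apply cont_const | auto |]. intros y Hy. apply pow_incr. split; [lra|].
        apply HKin. apply Rabs_le; lra.
      - apply integral_subinterval; auto; try lra. intro; apply pow_le; auto. }
    nra. }
  (* Bernoulli's inequality turns the geometric growth of the ratio into linear growth, which
     already exceeds the fixed bound. *)
  set (r := q1 / q - 1).
  assert (Hr : 0 < r). { unfold r. assert (1 < q1 / q); [|lra]. apply Rmult_lt_reg_r with q; auto. unfold Rdiv. rewrite Rmult_assoc, Rinv_l; lra. }
  assert (Hb : forall n, 1 + INR n * r <= L * (M + c) / (c * d)).
  { intro n. apply Rle_trans with ((1 + r) ^ n). apply poly; auto.
    replace (1 + r) with (q1 / q) by (unfold r; ring).
    unfold Rdiv at 1. rewrite Rpow_mult_distr, pow_inv.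
    specialize (Key n). pose proof (pow_lt q n Hq).
    apply Rmult_le_reg_r with (q ^ n * (c * d)).
    { apply Rmult_lt_0_compat; [auto | apply Rmult_lt_0_compat; auto]. }
    replace (q1 ^ n * / q ^ n * (q ^ n * (c * d))) with (c * (d * q1 ^ n)) by (field; lra).
    replace (L * (M + c) / (c * d) * (q ^ n * (c * d))) with (L * ((M + c) * q ^ n)) by (field; lra). exact Key. }
  destruct (INR_unbounded (L * (M + c) / (c * d) / r)) as [n Hn'].
  specialize (Hb n). apply Rmult_gt_compat_r with (r := r) in Hn'; auto.
  unfold Rdiv in Hn' at 1. rewrite Rmult_assoc, Rinv_l, Rmult_1_r in Hn' by lra. lra.
Qed.

(** The one-sided result for [f] and for [-f] settles the open period; its end point follows by
    continuity and the rest by periodicity. *)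
Lemma zero_coef_zero L f : 0 < L -> continuity f -> periodic L f -> (forall k, coef L f k = 0) ->
  forall y, f y = 0.
Proof.
  intros HL Hf Hp H.
  assert (Hint : forall y, - (L/2) < y < L/2 -> f y = 0).
  { intros y Hy. apply Rle_antisym. now apply (zero_coef_nonpos L).
    assert (- 1 * f y <= 0); [|lra]. apply (zero_coef_nonpos L (fun y => - 1 * f y)); auto.
    - now apply cont_scal.
    - intro; rewrite coef_scal, H; auto; ring. }
  assert (Hend : f (L/2) = 0).
  { destruct (Req_dec (f (L/2)) 0) as [|Hn]; auto. exfalso.
    destruct (Hf (L/2) (Rabs (f (L/2)))) as [d [Hd H2]]. now apply Rabs_pos_lt.
    specialize (H2 (L/2 - Rmin (d/2) (L/2))). simpl in H2; unfold R_dist in H2.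
    assert (0 < Rmin (d/2) (L/2)) by (apply Rmin_pos; lra).
    pose proof (Rmin_l (d/2) (L/2)). pose proof (Rmin_r (d/2) (L/2)).
    rewrite Hint in H2 by lra. apply (Rlt_irrefl (Rabs (f (L/2)))).
    replace (Rabs (f (L/2))) with (Rabs (0 - f (L/2))) at 1.
    - apply H2. split. split; [exact I | lra]. rewrite Rabs_left; lra.
    - rewrite Rminus_0_l. apply Rabs_Ropp. }
  intro y. destruct (per_reduce L y HL) as [y0 [Hy0 E]]. rewrite (E f Hp).
  destruct (Rlt_dec y0 (L/2)). destruct (Rlt_dec (-(L/2)) y0).
  - apply Hint; lra.
  - replace y0 with (-(L/2)) by lra. rewrite <- Hp. replace (-(L/2) + L) with (L/2) by field. auto.
  - replace y0 with (L/2) by lra. auto.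
Qed.

Lemma coef_inj L f g : 0 < L -> continuity f -> continuity g -> periodic L f -> periodic L g ->
  (forall k, coef L f k = coef L g k) -> forall y, f y = g y.
Proof.
  intros HL Hf Hg Hpf Hpg H y.
  assert (f y - g y = 0); [|lra]. apply (zero_coef_zero L (fun y => f y - g y)); auto.
  - now apply cont_minus.
  - intro z; now rewrite Hpf, Hpg.
  - intro k. rewrite coef_minus, H; auto. ring.
Qed.

(** Inversion by completeness: both sides are continuous and periodic and have equal
    coefficients. *)
Lemma syn_coef L f r A : 0 < L -> continuity f -> periodic L f -> (2 <= r)%nat -> decay r A (coef L f) ->
  forall y, f y = syn L (coef L f) y.
Proof.
  intros HL Hf Hp Hr H. apply (coef_inj L); auto.
  - eapply syn_cont; eauto.
  - now apply syn_per.
  - intro k. symmetry. eapply coef_syn; eauto.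
Qed.

(** * Derivatives, products, and Bessel's inequality *)

(** Integration by parts, with boundary terms cancelling by periodicity; the derivative of a mode is
    a multiple of its partner. *)
Lemma coef_deriv L f f' k : 0 < L -> continuity f' -> periodic L f ->
  (forall y, derivable_pt_lim f y (f' y)) ->
  coef L f' k = - sgn k * kap L k * coef L f (partner k).
Proof.
  intros HL Hf' Hp Hd.
  assert (Hf : continuity f) by (intro y; apply derivable_continuous_pt; exists (f' y); apply Hd).
  assert (E : integral (fun y => f' y * w L k y + f y * (sgn k * kap L k * w L (partner k) y)) (-(L/2)) (L/2) = 0).
  { rewrite (integral_derivative (fun y => f y * w L k y)).
    - replace (L/2) with (-(L/2) + L) at 1 2 by field. rewrite Hp, (w_per L k HL). ring.
    - intro y. apply (derivable_pt_lim_mult f (w L k)); auto using w_der.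
    - apply cont_plus; apply cont_mult; auto using w_cont. apply cont_scal, w_cont. }
  rewrite integral_plus in E.
  - unfold coef. rewrite (integral_ext (fun y => f y * (sgn k * kap L k * w L (partner k) y))
      (fun y => (sgn k * kap L k) * (f y * w L (partner k) y))) in E by (intro; ring).
    rewrite integral_scal in E by (apply cont_mult; auto using w_cont). lra.
  - apply cont_mult; auto using w_cont.
  - apply cont_mult; auto. apply cont_scal, w_cont.
Qed.

Lemma coef_deriv2 L f f' f'' k : 0 < L -> continuity f' -> continuity f'' -> periodic L f -> periodic L f' ->
  (forall y, derivable_pt_lim f y (f' y)) -> (forall y, derivable_pt_lim f' y (f'' y)) ->
  coef L f'' k = - lam L k * coef L f k.
Proof.
  intros. rewrite (coef_deriv L f' f''), (coef_deriv L f f'); auto.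
  rewrite partner_invol, kap_partner, lam_kap.
  replace (- sgn k * kap L k * (- sgn (partner k) * kap L k * coef L f k)) with
    (sgn k * kap L k * (sgn (partner k) * kap L k) * coef L f k) by ring.
  rewrite sgn_partner. 
  replace (sgn k * kap L k * (- sgn k * kap L k) * coef L f k) with
    (- (sgn k * sgn k) * kap L k ^ 2 * coef L f k) by ring. rewrite sgn_sq. ring.
Qed.

Lemma deriv_per L f f' : periodic L f -> (forall y, derivable_pt_lim f y (f' y)) -> periodic L f'.
Proof.
  intros Hp Hd y. apply (uniqueness_limite f y); auto.
  intros eps He. destruct (Hd (y + L) eps He) as [d Hdd]. exists d. intros h Hh1 Hh2.
  specialize (Hdd h Hh1 Hh2). rewrite Hp in Hdd.
  replace (y + L + h) with (y + h + L) in Hdd by ring. now rewrite Hp in Hdd.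
Qed.

Lemma kap_le L k : 0 < L -> kap L k <= 2 * PI / L * (1 + jidx k).
Proof.
  intro HL. unfold kap. replace (2 * PI * jidx k / L) with (2 * PI / L * jidx k) by (unfold Rdiv; ring).
  apply Rmult_le_compat_l; [|lra]. pose proof PI_RGT_0. apply Rlt_le, Rdiv_lt_0_compat; lra.
Qed.

Lemma coef_deriv_decay L f f' r A : 0 < L -> continuity f' -> periodic L f ->
  (forall y, derivable_pt_lim f y (f' y)) -> decay (S r) A (coef L f) ->
  decay r (2 * PI / L * A) (coef L f').
Proof.
  intros HL Hf' Hp Hd H k. rewrite (coef_deriv L f f') by auto.
  rewrite !Rabs_mult, Rabs_Ropp, sgn_abs, Rmult_1_l.
  specialize (H (partner k)). rewrite jidx_partner in H.
  pose proof (kap_pos L k HL). pose proof (kap_le L k HL). rewrite (Rabs_right (kap L k)) by lra.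
  pose proof (jidx_pos k). pose proof (Rabs_pos (coef L f (partner k))).
  apply Rle_trans with (2 * PI / L * (1 + jidx k) * (A / (1 + jidx k) ^ S r)).
  - apply Rmult_le_compat; auto.
  - right. simpl. assert ((1 + jidx k) ^ r <> 0) by (apply pow_nonzero; lra). field. repeat split; auto; lra.
Qed.

(** A cosine of frequency [m] and any phase is a combination of at most two modes with coefficients
    at most one. Each of them costs [sqrt L], because amplitudes are at least [1 / sqrt L]. The sign
    [s] admits the negative frequencies that differences of wave numbers produce. *)
Lemma integral_cos_decay L g r B m s chi : 0 < L -> continuity g -> decay r B (coef L g) -> (s = 1 \/ s = - 1) ->
  Rabs (integral (fun y => g y * cos (s * (2 * PI * INR m / L) * y - chi)) (-(L/2)) (L/2))
  <= 2 * sqrt L * (B / (1 + INR m) ^ r).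
Proof.
  intros HL Hg H Hs. pose proof (decay_nonneg _ _ _ H) as HB.
  assert (HB2 : 0 <= B / (1 + INR m) ^ r).
  { apply Rmult_le_pos; auto. left; apply Rinv_0_lt_compat, pow_lt. pose proof (pos_INR m); lra. }
  assert (HsL : 0 < sqrt L) by (apply sqrt_lt_R0; auto).
  assert (Hw : forall k, jidx k = INR m ->
    Rabs (integral (fun y => g y * cos (kap L k * y - phase k)) (- (L/2)) (L/2)) <= sqrt L * (B / (1 + INR m) ^ r)).
  { intros k Hk. specialize (H k). rewrite Hk in H.
    assert (E : coef L g k = amp L k * integral (fun y => g y * cos (kap L k * y - phase k)) (- (L/2)) (L/2)).
    { unfold coef. rewrite <- integral_scal by (apply cont_mult; auto; apply cont_cos_lin).
      apply integral_ext; intro; rewrite w_phase; ring. }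
    rewrite E, Rabs_mult in H. destruct (amp_bound L k HL) as [Ha _]. rewrite (Rabs_right (amp L k)) in H by lra.
    assert (Ha2 : / sqrt L <= amp L k).
    { destruct k; simpl; [lra|]. rewrite <- sqrt_inv. apply sqrt_le_1_alt. unfold Rdiv.
      assert (0 < / L) by (apply Rinv_0_lt_compat; lra). lra. }
    apply Rmult_le_reg_l with (/ sqrt L). apply Rinv_0_lt_compat; auto.
    rewrite <- Rmult_assoc, Rinv_l, Rmult_1_l by lra. apply Rle_trans with (2 := H).
    apply Rmult_le_compat_r; auto using Rabs_pos. }
  destruct m as [|n].
  - rewrite (integral_ext _ (fun y => cos chi * (g y * cos (kap L 0 * y - phase 0)))).
    + rewrite integral_scal by (apply cont_mult; auto; apply cont_cos_lin). rewrite Rabs_mult.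
      specialize (Hw O eq_refl). assert (Rabs (cos chi) <= 1) by (apply Rabs_le, COS_bound).
      pose proof (Rabs_pos (cos chi)). pose proof (Rabs_pos (integral (fun y => g y * cos (kap L 0 * y - phase 0)) (- (L/2)) (L/2))).
      nra.
    + intro y. rewrite kap_0. simpl. replace (0 * y - 0) with 0 by ring.
      replace (s * (2 * PI * 0 / L) * y - chi) with (- chi) by (unfold Rdiv; ring). rewrite cos_neg, cos_0. ring.
  - assert (E1 : jidx (2*n+1) = INR (S n)) by (rewrite jidx_odd; f_equal; lia).
    assert (E2 : jidx (2*n+2) = INR (S n)) by (rewrite <- jidx_even; f_equal; lia).
    rewrite (integral_ext _ (fun y => cos chi * (g y * cos (kap L (2*n+1) * y - phase (2*n+1)))
       + (s * sin chi) * (g y * cos (kap L (2*n+2) * y - phase (2*n+2))))).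
    + rewrite integral_lin by (apply cont_mult; auto; apply cont_cos_lin).
      pose proof (Hw _ E1) as H1. pose proof (Hw _ E2) as H2.
      apply Rle_trans with (1 := Rabs_triang _ _). rewrite !Rabs_mult.
      assert (Rabs (cos chi) <= 1) by (apply Rabs_le, COS_bound).
      assert (Rabs (sin chi) <= 1) by (apply Rabs_le, SIN_bound).
      assert (Rabs s = 1) by (destruct Hs as [-> | ->]; unfold Rabs; destruct Rcase_abs; lra).
      rewrite H4.
      pose proof (Rabs_pos (cos chi)). pose proof (Rabs_pos (sin chi)).
      pose proof (Rabs_pos (integral (fun y => g y * cos (kap L (2*n+1) * y - phase (2*n+1))) (- (L/2)) (L/2))).
      pose proof (Rabs_pos (integral (fun y => g y * cos (kap L (2*n+2) * y - phase (2*n+2))) (- (L/2)) (L/2))).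
      nra.
    + intro y. rewrite phase_odd, phase_even. unfold kap. rewrite E1, E2.
      rewrite Rminus_0_r, !cos_minus, cos_PI2, sin_PI2.
      replace (s * (2 * PI * INR (S n) / L) * y) with (s * (2 * PI * INR (S n) / L * y)) by ring.
      destruct Hs as [-> | ->].
      * rewrite Rmult_1_l. ring.
      * replace (-1 * (2 * PI * INR (S n) / L * y)) with (- (2 * PI * INR (S n) / L * y)) by ring.
        rewrite cos_neg, sin_neg. ring.
Qed.

(** The matrix of multiplication by [g] decays away from the diagonal. A product of two modes has
    the difference and the sum of their wave numbers as frequencies, and the sum is the larger one,
    so its contribution obeys the same bound. *)
Lemma integral_w_w_decay L g r B i k : 0 < L -> continuity g -> decay r B (coef L g) ->
  Rabs (integral (fun y => w L i y * (g y * w L k y)) (-(L/2)) (L/2))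
  <= 4 / sqrt L * (B / (1 + Rabs (jidx i - jidx k)) ^ r).
Proof.
  intros HL Hg H. pose proof (decay_nonneg _ _ _ H) as HB.
  assert (HsL : 0 < sqrt L) by (apply sqrt_lt_R0; auto).
  set (D := B / (1 + Rabs (jidx i - jidx k)) ^ r).
  rewrite (integral_ext _ (fun y => / 2 * amp L i * amp L k *
   (g y * cos ((kap L i - kap L k) * y - (phase i - phase k))
    + g y * cos ((kap L i + kap L k) * y - (phase i + phase k))))).
  2:{ intro y. rewrite <- Rmult_plus_distr_l. 
      replace (w L i y * (g y * w L k y)) with (g y * (w L i y * w L k y)) by ring. rewrite w_mul. ring. }
  rewrite integral_scal, integral_plus; try apply cont_plus; try (apply cont_mult; auto; apply cont_cos_lin).
  assert (Hm : Rabs (integral (fun y => g y * cos ((kap L i - kap L k) * y - (phase i - phase k))) (-(L/2)) (L/2)) <= 2 * sqrt L * D).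
  { assert (exists s m, (s = 1 \/ s = -1) /\ kap L i - kap L k = s * (2 * PI * INR m / L) /\ INR m = Rabs (jidx i - jidx k)) as [s [m [Hs [E1 E2]]]].
    { unfold kap, jidx. destruct (le_ge_dec ((k+1)/2) ((i+1)/2)) as [Hle|Hge].
      - exists 1, ((i+1)/2 - (k+1)/2)%nat. rewrite minus_INR by auto. split; [auto|]. split. unfold Rdiv; ring.
        rewrite Rabs_right; auto. apply le_INR in Hle. lra.
      - exists (-1), ((k+1)/2 - (i+1)/2)%nat. rewrite minus_INR by auto. split; [auto|]. split. unfold Rdiv; ring.
        apply le_INR in Hge. rewrite Rabs_left1; lra. }
    rewrite E1. unfold D. rewrite <- E2. now apply integral_cos_decay. }
  assert (Hp : Rabs (integral (fun y => g y * cos ((kap L i + kap L k) * y - (phase i + phase k))) (-(L/2)) (L/2)) <= 2 * sqrt L * D).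
  { replace (kap L i + kap L k) with (1 * (2 * PI * INR ((i+1)/2 + (k+1)/2) / L)) by (rewrite plus_INR; unfold kap, jidx, Rdiv; ring).
    eapply Rle_trans. apply (integral_cos_decay L g r B); auto. unfold D.
    apply Rmult_le_compat_l; [lra|]. apply Rmult_le_compat_l; auto.
    apply Rinv_le_contravar. apply pow_lt. pose proof (Rabs_pos (jidx i - jidx k)); lra.
    apply pow_incr. pose proof (jidx_pos i). pose proof (jidx_pos k). rewrite plus_INR. fold (jidx i) (jidx k).
    split. pose proof (Rabs_pos (jidx i - jidx k)); lra. apply Rplus_le_compat_l, Rabs_le; lra. }
  rewrite !Rabs_mult. rewrite (Rabs_right (/2)) by lra.
  destruct (amp_bound L i HL), (amp_bound L k HL).
  rewrite (Rabs_right (amp L i)), (Rabs_right (amp L k)) by lra.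
  apply Rle_trans with (/2 * (2 / L) * (4 * sqrt L * D)).
  - apply Rmult_le_compat; try apply Rabs_pos. nra.
    + rewrite Rmult_assoc. apply Rmult_le_compat_l; [lra|]. rewrite <- wmax_sq by auto. apply Rmult_le_compat; lra.
    + apply Rle_trans with (1 := Rabs_triang _ _). lra.
  - right. unfold D. replace (2 / L) with (2 / (sqrt L * sqrt L)) by (rewrite sqrt_sqrt; lra).
    field. repeat split; try lra. apply pow_nonzero. pose proof (Rabs_pos (jidx i - jidx k)); lra.
Qed.

(* [x / (1 + |x|)] increases by at least [1 / (2 (1 + |x|)^2)] over each integer step. *)
Lemma sum_inv_sq_shift N n :
  sum_f_R0 (fun i => / (1 + Rabs (INR i - INR n)) ^ 2) N <= 4.
Proof.
  set (h := fun x => x / (1 + Rabs x)).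
  assert (Hh : forall x, Rabs (h x) <= 1).
  { intro x. unfold h, Rdiv. pose proof (Rabs_pos x). rewrite Rabs_mult, Rabs_inv, (Rabs_right (1 + Rabs x)) by lra.
    apply Rmult_le_reg_r with (1 + Rabs x). lra. rewrite Rmult_assoc, Rinv_l; lra. }
  assert (Hd : forall i, / (1 + Rabs (INR i - INR n)) ^ 2 <= 2 * (h (INR (S i) - INR n) - h (INR i - INR n))).
  { intro i. rewrite S_INR. unfold h. destruct (le_lt_dec n i) as [Hle|Hlt].
    - apply le_INR in Hle. set (d := INR i - INR n). replace (INR i + 1 - INR n) with (d + 1) by (unfold d; ring).
      assert (0 <= d) by (unfold d; lra). rewrite !Rabs_right by lra.
      replace (2 * ((d+1)/(1+(d+1)) - d/(1+d))) with (/ (((1+d)*(2+d))/2)) by (field; lra).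
      apply Rinv_le_contravar; nra.
    - assert (INR i + 1 <= INR n) by (rewrite <- S_INR; apply le_INR; lia).
      set (d := INR n - INR i). replace (INR i - INR n) with (- d) by (unfold d; ring).
      replace (INR i + 1 - INR n) with (- (d - 1)) by (unfold d; ring).
      assert (1 <= d) by (unfold d; lra). rewrite !Rabs_Ropp, !Rabs_right by lra.
      replace (2 * (- (d-1)/(1+(d-1)) - - d/(1+d))) with (/ ((d*(d+1))/2)) by (field; lra).
      apply Rinv_le_contravar; nra. }
  assert (Hs : sum_f_R0 (fun i => / (1 + Rabs (INR i - INR n)) ^ 2) N <= 2 * (h (INR (S N) - INR n) - h (INR 0 - INR n))).
  { induction N. apply Hd. rewrite tech5. specialize (Hd (S N)). lra. }
  pose proof (Hh (INR (S N) - INR n)) as H1. pose proof (Hh (INR 0 - INR n)) as H2.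
  apply Rabs_le_between in H1. apply Rabs_le_between in H2. lra.
Qed.

Lemma jidx_INR k : exists n, jidx k = INR n.
Proof. eexists; reflexivity. Qed.

(** Since [jidx i] is [i / 2] up to one half, the distance to [n] is compared with half the distance
    of [i] to [2 n]. The square of this half turns the integer bound 4 into 16. *)
Lemma sum_inv_jidx_shift N n :
  sum_f_R0 (fun i => / (1 + Rabs (jidx i - INR n)) ^ 2) N <= 16.
Proof.
  apply Rle_trans with (4 * sum_f_R0 (fun i => / (1 + Rabs (INR i - INR (2 * n))) ^ 2) N).
  - rewrite scal_sum. apply sum_Rle. intros i _.
    assert (E : 1 + Rabs (INR i - INR (2*n)) <= 2 * (1 + Rabs (jidx i - INR n))).
    { pose proof (jidx_half i). rewrite mult_INR. simpl (INR 2).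
      unfold Rabs; repeat destruct Rcase_abs; lra. }
    pose proof (Rabs_pos (INR i - INR (2*n))). pose proof (Rabs_pos (jidx i - INR n)).
    set (a := 1 + Rabs (INR i - INR (2*n))) in *. set (b := 1 + Rabs (jidx i - INR n)) in *.
    assert (0 < a) by (unfold a; lra). assert (0 < b) by (unfold b; lra).
    replace (/ a ^ 2 * 4) with (/ ((a / 2) ^ 2)) by (field; lra).
    apply Rinv_le_contravar. apply pow_lt; lra. apply pow_incr; lra.
  - pose proof (sum_inv_sq_shift N (2*n)). lra.
Qed.

(** The larger of [x] and [y] is at least [z / 2] and pays for the power of [z]; the other factor
    keeps a power of at least two, which is summable. *)
Lemma conv_term r x y z : (2 <= r)%nat -> 1 <= x -> 1 <= y -> 1 <= z -> z <= x + y ->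
  / x ^ r * / y ^ r <= 2 ^ r * / z ^ r * (/ x ^ 2 + / y ^ 2).
Proof.
  intros Hr Hx Hy Hz H.
  assert (P : forall v, 1 <= v -> 0 < v ^ r) by (intros; apply pow_lt; lra).
  pose proof (P x Hx). pose proof (P y Hy). pose proof (P z Hz).
  assert (Hzr : z ^ r <= 2 ^ r * (x ^ r + y ^ r)).
  { destruct (Rle_dec x y).
    - assert (z ^ r <= (2 * y) ^ r) by (apply pow_incr; lra). rewrite Rpow_mult_distr in H3.
      pose proof (pow_lt 2 r ltac:(lra)). nra.
    - assert (z ^ r <= (2 * x) ^ r) by (apply pow_incr; lra). rewrite Rpow_mult_distr in H3.
      pose proof (pow_lt 2 r ltac:(lra)). nra. }
  apply Rle_trans with (2 ^ r * / z ^ r * (/ x ^ r + / y ^ r)).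
  - apply Rmult_le_reg_r with (x ^ r * y ^ r * z ^ r). repeat apply Rmult_lt_0_compat; auto.
    replace (/ x ^ r * / y ^ r * (x ^ r * y ^ r * z ^ r)) with (z ^ r) by (field; lra).
    replace (2 ^ r * / z ^ r * (/ x ^ r + / y ^ r) * (x ^ r * y ^ r * z ^ r)) with (2 ^ r * (x ^ r + y ^ r)) by (field; lra).
    auto.
  - apply Rmult_le_compat_l.
    + apply Rmult_le_pos. apply pow_le; lra. left; now apply Rinv_0_lt_compat.
    + pose proof (inv_pow_mono x 2 r Hx Hr). pose proof (inv_pow_mono y 2 r Hy Hr). lra.
Qed.

(** The factor 128 is the 4 of the matrix bound times the 32 of two convolution sums bounded by 16
    each; [2 ^ r] comes from [conv_term]. *)
Definition cprod (L : R) (r : nat) : R := 128 * 2 ^ r / sqrt L.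

Lemma cprod_pos L r : 0 < L -> 0 < cprod L r.
Proof.
  intro H. unfold cprod. apply Rdiv_lt_0_compat. pose proof (pow_lt 2 r ltac:(lra)); lra. now apply sqrt_lt_R0.
Qed.

(** The weighted sup norm is an algebra norm up to a constant. Only [f] is expanded in its series,
    while [g] enters through its multiplication matrix, so the coefficient of the product is a
    discrete convolution of two decaying sequences. *)
Lemma prod_decay L r f g A B : 0 < L -> (2 <= r)%nat -> continuity f -> periodic L f -> continuity g ->
  decay r A (coef L f) -> decay r B (coef L g) ->
  decay r (cprod L r * A * B) (coef L (fun y => f y * g y)).
Proof.
  intros HL Hr Hf Hp Hg HA HB k.
  pose proof (decay_nonneg _ _ _ HA). pose proof (decay_nonneg _ _ _ HB).
  destruct (interval_bound (fun y => g y * w L k y) (-(L/2)) (L/2) ltac:(lra)) as [G [HG HGb]].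
  { apply cont_mult; auto using w_cont. }
  assert (HsL : 0 < sqrt L) by (apply sqrt_lt_R0; auto).
  apply (lim_le _ _ (L * (4 * A * wmax L) * G) 0). intros N _.
  pose proof (integral_series_tail L (fun i y => coef L f i * w L i y) (4 * A * wmax L) (fun y => g y * w L k y) G N HL) as T.
  assert (E : coef L (fun y => f y * g y) k =
    integral (fun y => Series (fun i => coef L f i * w L i y) * (g y * w L k y)) (-(L/2)) (L/2)).
  { unfold coef at 1. apply integral_ext. intro y. rewrite (syn_coef L f r A HL Hf Hp Hr HA y) at 1. unfold syn. ring. }
  rewrite E.
  assert (Hsum : Rabs (sum_f_R0 (fun i => integral (fun y => coef L f i * w L i y * (g y * w L k y)) (-(L/2)) (L/2)) N)
     <= cprod L r * A * B / (1 + jidx k) ^ r).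
  { apply Rle_trans with (1 := Rsum_abs _ _).
    apply Rle_trans with (sum_f_R0 (fun i => (/ (1 + Rabs (jidx i - INR 0)) ^ 2 + / (1 + Rabs (jidx i - jidx k)) ^ 2)
       * (4 / sqrt L * 2 ^ r * A * B * / (1 + jidx k) ^ r)) N).
    - apply sum_Rle. intros i _. simpl (INR 0). rewrite Rminus_0_r.
      pose proof (jidx_pos i). rewrite (Rabs_right (jidx i)) by lra.
      rewrite (integral_ext _ (fun y => coef L f i * (w L i y * (g y * w L k y)))) by (intro; ring).
      rewrite integral_scal by (repeat apply cont_mult; auto using w_cont). rewrite Rabs_mult.
      pose proof (integral_w_w_decay L g r B i k HL Hg HB). specialize (HA i).
      pose proof (jidx_pos k). pose proof (Rabs_pos (jidx i - jidx k)).
      assert (T2 : / (1 + jidx i) ^ r * / (1 + Rabs (jidx i - jidx k)) ^ r <=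
        2 ^ r * / (1 + jidx k) ^ r * (/ (1 + jidx i) ^ 2 + / (1 + Rabs (jidx i - jidx k)) ^ 2)).
      { apply conv_term; auto; try lra. unfold Rabs; destruct Rcase_abs; lra. }
      apply Rle_trans with (A / (1 + jidx i) ^ r * (4 / sqrt L * (B / (1 + Rabs (jidx i - jidx k)) ^ r))).
      { apply Rmult_le_compat; auto using Rabs_pos. }
      apply Rle_trans with ((4 / sqrt L * A * B) * (/ (1 + jidx i) ^ r * / (1 + Rabs (jidx i - jidx k)) ^ r)).
      { right; unfold Rdiv; ring. }
      apply Rle_trans with ((4 / sqrt L * A * B) * (2 ^ r * / (1 + jidx k) ^ r * (/ (1 + jidx i) ^ 2 + / (1 + Rabs (jidx i - jidx k)) ^ 2))).
      { apply Rmult_le_compat_l; auto. assert (0 < 4 / sqrt L) by (apply Rdiv_lt_0_compat; lra).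
        repeat apply Rmult_le_pos; lra. }
      right; ring.
    - rewrite <- scal_sum, sum_plus.
      destruct (jidx_INR k) as [n Hn].
      pose proof (sum_inv_jidx_shift N 0) as S1. pose proof (sum_inv_jidx_shift N n) as S2. rewrite <- Hn in S2.
      apply Rle_trans with ((4 / sqrt L * 2 ^ r * A * B * / (1 + jidx k) ^ r) * 32).
      + apply Rmult_le_compat_l; [|lra]. assert (0 < 4 / sqrt L) by (apply Rdiv_lt_0_compat; lra).
        pose proof (pow_lt 2 r ltac:(lra)). pose proof (jidx_pos k).
        repeat apply Rmult_le_pos; try lra. left; apply Rinv_0_lt_compat, pow_lt; lra.
      + right. unfold cprod, Rdiv. ring. }
  replace (integral (fun y => Series (fun i => coef L f i * w L i y) * (g y * w L k y)) (-(L/2)) (L/2)) with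
    ((integral (fun y => Series (fun i => coef L f i * w L i y) * (g y * w L k y)) (-(L/2)) (L/2) -
      sum_f_R0 (fun i => integral (fun y => coef L f i * w L i y * (g y * w L k y)) (-(L/2)) (L/2)) N) +
      sum_f_R0 (fun i => integral (fun y => coef L f i * w L i y * (g y * w L k y)) (-(L/2)) (L/2)) N) by ring.
  apply Rle_trans with (1 := Rabs_triang _ _). rewrite Rplus_comm. apply Rplus_le_compat; auto.
  apply T; auto.
  - intro; apply cont_scal, w_cont.
  - intros; eapply syn_term_bound; eauto.
  - apply cont_mult; auto using w_cont.
Qed.

Lemma integral_sq_step L g k : 0 < L -> continuity g ->
  integral (fun y => (g y - coef L g k * w L k y) ^ 2) (-(L/2)) (L/2)
  = integral (fun y => g y ^ 2) (-(L/2)) (L/2) - coef L g k ^ 2.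
Proof.
  intros HL Hg. set (c := coef L g k).
  rewrite (integral_ext _ (fun y => g y ^ 2 + (- 2 * c * (g y * w L k y) + c ^ 2 * (w L k y * w L k y)))) by (intro; ring).
  rewrite integral_plus, integral_lin.
  - change (integral (fun y => w L k y * w L k y) (-(L/2)) (L/2)) with (coef L (w L k) k).
    change (integral (fun y => g y * w L k y) (-(L/2)) (L/2)) with c. rewrite w_orth by auto.
    destruct (Nat.eq_dec k k); [ring | congruence].
  - apply cont_mult; auto using w_cont.
  - apply cont_mult; auto using w_cont.
  - now apply cont_sq.
  - apply cont_plus; apply cont_scal; apply cont_mult; auto using w_cont.
Qed.

Lemma psum_cont L c N : continuity (fun y => sum_f_R0 (fun k => c k * w L k y) N).
Proof. apply (cont_sum (fun k y => c k * w L k y)). intro; apply cont_scal, w_cont. Qed.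

Lemma coef_psum L c N k : 0 < L ->
  coef L (fun y => sum_f_R0 (fun k => c k * w L k y) N) k =
  sum_f_R0 (fun i => c i * (if Nat.eq_dec i k then 1 else 0)) N.
Proof.
  intro HL. induction N.
  - change (coef L (fun y => c O * w L O y) k = c O * (if Nat.eq_dec 0 k then 1 else 0)).
    rewrite coef_scal by apply w_cont. now rewrite w_orth.
  - rewrite (tech5 (fun i => c i * (if Nat.eq_dec i k then 1 else 0))).
    rewrite (coef_ext L _ (fun y => sum_f_R0 (fun k => c k * w L k y) N + c (S N) * w L (S N) y)) by (intro; apply tech5).
    rewrite coef_plus, IHN, (coef_scal L (c (S N))), w_orth; auto using w_cont.
    + apply psum_cont.
    + apply cont_scal, w_cont.
Qed.

(** Modes are removed one at a time: by orthogonality the remainder after [N] still has the original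
    coefficient at [S N], and removing that mode lowers the square integral by its square. *)
Lemma bessel_identity L f N : 0 < L -> continuity f ->
  integral (fun y => (f y - sum_f_R0 (fun k => coef L f k * w L k y) N) ^ 2) (-(L/2)) (L/2)
  = integral (fun y => f y ^ 2) (-(L/2)) (L/2) - sum_f_R0 (fun k => coef L f k ^ 2) N.
Proof.
  intros HL Hf. induction N.
  - simpl sum_f_R0. now apply integral_sq_step.
  - rewrite tech5. set (g := fun y => f y - sum_f_R0 (fun k => coef L f k * w L k y) N).
    change (integral (fun y => g y ^ 2) (-(L/2)) (L/2) =
      integral (fun y => f y ^ 2) (-(L/2)) (L/2) - sum_f_R0 (fun k => coef L f k ^ 2) N) in IHN.
    assert (Hg : continuity g) by (apply cont_minus; auto; apply psum_cont).
    assert (E : coef L g (S N) = coef L f (S N)).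
    { unfold g. rewrite coef_minus, coef_psum; auto using psum_cont.
      rewrite (sum_eq _ (fun _ => 0)), sum_cte. ring.
      intros i Hi. destruct (Nat.eq_dec i (S N)); [lia | ring]. }
    rewrite (integral_ext _ (fun y => (g y - coef L g (S N) * w L (S N) y) ^ 2)).
    + rewrite integral_sq_step, IHN, E; auto. ring.
    + intro y. rewrite E. unfold g. rewrite tech5. ring.
Qed.

Lemma bessel L f N : 0 < L -> continuity f ->
  sum_f_R0 (fun k => coef L f k ^ 2) N <= integral (fun y => f y ^ 2) (-(L/2)) (L/2).
Proof.
  intros HL Hf. pose proof (bessel_identity L f N HL Hf).
  assert (0 <= integral (fun y => (f y - sum_f_R0 (fun k => coef L f k * w L k y) N) ^ 2) (-(L/2)) (L/2)).
  { apply RInt_ge_0; [lra | apply cont_integrable, cont_sq, cont_minus; auto; apply psum_cont |]. intros; apply pow2_ge_0. }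
  lra.
Qed.

(** The truncation remainder tends to zero as [M] grows with [N] fixed. The constant [A] serves that
    limit only and leaves no trace in the bound; this matters for the energy estimate, where [C] is
    uniform in time and [A] is not. *)
Lemma parseval_tail L f A C N : 0 < L -> continuity f -> periodic L f -> decay 2 A (coef L f) ->
  (forall k, coef L f k ^ 2 <= C / (1 + jidx k) ^ 2) ->
  integral (fun y => f y ^ 2) (-(L/2)) (L/2) <= sum_f_R0 (fun k => coef L f k ^ 2) N + 4 * C / (INR N + 2).
Proof.
  intros HL Hf Hp HA HC.
  apply (lim_le _ _ (L * (4 * A * wmax L) ^ 2) N). intros M HM.
  pose proof (bessel_identity L f M HL Hf) as E.
  assert (HC0 : 0 <= C).
  { specialize (HC O). rewrite jidx_0 in HC. pose proof (pow2_ge_0 (coef L f 0)). unfold Rdiv in HC. rewrite Rplus_0_r, pow1, Rinv_1 in HC. lra. }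
  assert (H1 : integral (fun y => (f y - sum_f_R0 (fun k => coef L f k * w L k y) M) ^ 2) (-(L/2)) (L/2)
     <= L * (4 * A * wmax L) ^ 2 / (INR M + 2)).
  { apply Rle_trans with (integral (fun _ => ((4 * A * wmax L) / (INR M + 2)) ^ 2) (-(L/2)) (L/2)).
    - apply integral_le; [lra | apply cont_sq, cont_minus; auto; apply psum_cont | apply cont_const |].
      intros y _. rewrite (syn_coef L f 2 A HL Hf Hp (le_n 2) HA y) at 1. unfold syn.
      pose proof (series_tail (fun k => coef L f k * w L k y) (4 * A * wmax L) M) as T.
      rewrite <- (pow2_abs (Series _ - _)). apply pow_incr. split. apply Rabs_pos.
      apply T. intro; eapply syn_term_bound; eauto.
    - rewrite integral_const. pose proof (pos_INR M). unfold Rdiv. rewrite Rpow_mult_distr, pow_inv.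
      assert (0 <= (4 * A * wmax L) ^ 2) by apply pow2_ge_0.
      replace (L * / 2 - - (L * / 2)) with L by field. rewrite <- Rmult_assoc.
      apply Rmult_le_compat_l. apply Rmult_le_pos; lra. apply Rinv_le_contravar; nra. }
  pose proof (sum_diff_tel (fun k => coef L f k ^ 2) (4 * C) N (M - N)) as D.
  replace (N + (M - N))%nat with M in D by lia.
  assert (HD : Rabs (sum_f_R0 (fun k => coef L f k ^ 2) M - sum_f_R0 (fun k => coef L f k ^ 2) N) <= 4 * C * (/ (INR N + 2) - / (INR M + 2))).
  { apply D. intro k. rewrite Rabs_right by (apply Rle_ge, pow2_ge_0). apply Rle_trans with (1 := HC k).
    pose proof (inv_jidx_tel k 2 (le_n 2)). unfold Rdiv. nra. }
  apply Rabs_le_between in HD.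
  assert (0 < / (INR M + 2)). { apply Rinv_0_lt_compat. pose proof (pos_INR M); lra. }
  unfold Rdiv in *. nra.
Qed.

(** * Differentiated series *)

Definition dsyn (L : R) (a : nat -> R) (y : R) : R :=
  Series (fun k => a k * (sgn k * kap L k * w L (partner k) y)).

Lemma dsyn_term_bound L A a k y : 0 < L -> decay 3 A a ->
  Rabs (a k * (sgn k * kap L k * w L (partner k) y)) <= 4 * (2 * PI / L * A) * wmax L * tel k.
Proof.
  intros HL H. rewrite !Rabs_mult, sgn_abs. pose proof (decay_nonneg _ _ _ H).
  pose proof (kap_pos L k HL). pose proof (kap_le L k HL). rewrite (Rabs_right (kap L k)) by lra.
  pose proof (w_bound L (partner k) y HL). specialize (H k). pose proof (jidx_pos k).
  pose proof (Rabs_pos (a k)). pose proof (Rabs_pos (w L (partner k) y)).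
  apply Rle_trans with (A / (1 + jidx k) ^ 3 * (2 * PI / L * (1 + jidx k) * wmax L)).
  - rewrite Rmult_1_l. apply Rmult_le_compat; auto. apply Rmult_le_pos; auto. apply Rmult_le_compat; auto.
  - apply Rle_trans with ((2 * PI / L * A * wmax L) * / (1 + jidx k) ^ 2).
    + right; field. repeat split; lra.
    + pose proof (inv_jidx_tel k 2 (le_n 2)). pose proof (wmax_pos L HL). pose proof PI_RGT_0.
      assert (0 < 2 * PI / L) by (apply Rdiv_lt_0_compat; lra).
      replace (4 * (2 * PI / L * A) * wmax L * tel k) with ((2 * PI / L * A * wmax L) * (4 * tel k)) by ring.
      apply Rmult_le_compat_l; auto. apply Rmult_le_pos; [apply Rmult_le_pos|]; lra.
Qed.

Lemma dsyn_bound L A a y : 0 < L -> decay 3 A a -> Rabs (dsyn L a y) <= 4 * (2 * PI / L * A) * wmax L.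
Proof.
  intros. apply (series_bound (fun k => a k * (sgn k * kap L k * w L (partner k) y))).
  intros; now apply dsyn_term_bound.
Qed.

Lemma dsyn_cont L A a : 0 < L -> decay 3 A a -> continuity (dsyn L a).
Proof.
  intros HL H. apply (series_cont (fun k y => a k * (sgn k * kap L k * w L (partner k) y)) (4 * (2 * PI / L * A) * wmax L)).
  - intro; repeat apply cont_scal; apply w_cont.
  - intros; now apply dsyn_term_bound.
Qed.

(** The derivatives of the terms are required only on a ball around [c]. For series in time this
    keeps the argument inside the open interval on which the mode equations hold. *)
Lemma series_der (u u' : nat -> R -> R) A B c r x : 0 < r -> Rabs (x - c) < r ->
  (forall k y, Rabs (y - c) < r -> derivable_pt_lim (u k) y (u' k y)) ->
  (forall k, continuity (u' k)) ->
  (forall k y, Rabs (u k y) <= A * tel k) -> (forall k y, Rabs (u' k y) <= B * tel k) ->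
  derivable_pt_lim (fun y => Series (fun k => u k y)) x (Series (fun k => u' k x)).
Proof.
  intros Hr Hx Hd Hc HA HB.
  assert (cv : forall (v : nat -> R -> R) D, (forall k y, Rabs (v k y) <= D * tel k) -> forall e, 0 < e -> exists N, forall n y, (N <= n)%nat ->
    Rabs (Series (fun k => v k y) - sum_f_R0 (fun k => v k y) n) < e).
  { intros v D HD e He. assert (0 <= D).
    { specialize (HD O 0). pose proof (Rabs_pos (v O 0)). pose proof (tel_pos 0). nra. }
    destruct (archimed_cor1 (e / (D + 1))) as [N [HN HN0]]. apply Rdiv_lt_0_compat; lra.
    exists N. intros n y Hn. apply Rle_lt_trans with (1 := series_tail _ D n (fun k => HD k y)).
    assert (0 < INR N) by (apply lt_0_INR; auto). apply le_INR in Hn.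
    apply Rmult_lt_compat_l with (r := D + 1) in HN; [|lra].
    replace ((D+1) * (e / (D+1))) with e in HN by (field; lra).
    apply Rle_lt_trans with (2 := HN). unfold Rdiv. apply Rmult_le_compat; try lra.
    left; apply Rinv_0_lt_compat; lra. apply Rinv_le_contravar; lra. }
  apply (derivable_pt_lim_CVU (fun n y => sum_f_R0 (fun k => u k y) n) (fun n y => sum_f_R0 (fun k => u' k y) n)
    (fun y => Series (fun k => u k y)) (fun y => Series (fun k => u' k y)) x c (mkposreal r Hr)).
  - exact Hx.
  - intros y n Hy. induction n; simpl; auto.
    apply (derivable_pt_lim_plus (fun y => sum_f_R0 (fun k => u k y) n) (u (S n))); auto.
  - intros y Hy e He. destruct (cv u A HA e He) as [N HN]. exists N. intros n Hn.
    unfold R_dist. rewrite Rabs_minus_sym. now apply HN.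
  - intros e He. destruct (cv u' B HB e He) as [N HN]. exists N. intros n y Hn Hy. now apply HN.
  - intros y _. eapply series_cont; eauto.
Qed.

Lemma syn_der L A a y : 0 < L -> decay 3 A a -> derivable_pt_lim (syn L a) y (dsyn L a y).
Proof.
  intros HL H.
  apply (series_der (fun k y => a k * w L k y) (fun k y => a k * (sgn k * kap L k * w L (partner k) y))
    (4 * A * wmax L) (4 * (2 * PI / L * A) * wmax L) y 1); try lra.
  - rewrite Rminus_diag, Rabs_R0; lra.
  - intros k z _. apply (derivable_pt_lim_scal (w L k)), w_der.
  - intro; repeat apply cont_scal; apply w_cont.
  - intros; apply (syn_term_bound L 3); auto.
  - intros; now apply dsyn_term_bound.
Qed.

Lemma dsyn_per L A a : 0 < L -> decay 3 A a -> periodic L (dsyn L a).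
Proof.
  intros HL H. apply (deriv_per L (syn L a)). now apply syn_per. intro; eapply syn_der; eauto.
Qed.

Lemma coef_dsyn_decay L r A a : 0 < L -> (2 <= r)%nat -> decay (S r) A a ->
  decay r (2 * PI / L * A) (coef L (dsyn L a)).
Proof.
  intros HL Hr H. assert (H3 : decay 3 A a) by (apply decay_le_exp with (S r); auto; lia).
  apply (coef_deriv_decay L (syn L a)); auto.
  - eapply dsyn_cont; eauto.
  - now apply syn_per.
  - intro; eapply syn_der; eauto.
  - intro k. rewrite (coef_syn L 3 A); auto.
Qed.

Lemma dsyn_minus L A B a b y : 0 < L -> decay 3 A a -> decay 3 B b ->
  dsyn L (fun k => a k - b k) y = dsyn L a y - dsyn L b y.
Proof.
  intros HL Ha Hb. unfold dsyn. rewrite <- Series_minus.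
  - apply Series_ext. intro; ring.
  - eapply ex_series_tel. intro; now apply dsyn_term_bound.
  - eapply ex_series_tel. intro; now apply dsyn_term_bound.
Qed.
Lemma syn_minus L A B a b y : 0 < L -> decay 2 A a -> decay 2 B b ->
  syn L (fun k => a k - b k) y = syn L a y - syn L b y.
Proof.
  intros HL Ha Hb. unfold syn. rewrite <- Series_minus.
  - apply Series_ext. intro; ring.
  - eapply ex_series_tel. intro; now apply (syn_term_bound L 2).
  - eapply ex_series_tel. intro; now apply (syn_term_bound L 2).
Qed.
Lemma decay_plus r A B a b : decay r A a -> decay r B b -> decay r (A + B) (fun k => a k + b k).
Proof.
  intros Ha Hb k. specialize (Ha k). specialize (Hb k). apply Rle_trans with (1 := Rabs_triang _ _).
  unfold Rdiv in *. lra.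
Qed.
Lemma decay_minus r A B a b : decay r A a -> decay r B b -> decay r (A + B) (fun k => a k - b k).
Proof.
  intros Ha Hb k. specialize (Ha k). specialize (Hb k). apply Rle_trans with (1 := Rabs_triang _ _).
  rewrite Rabs_Ropp. unfold Rdiv in *. lra.
Qed.

Definition quad (L : R) (a : nat -> R) (k : nat) : R := coef L (fun y => dsyn L a y ^ 2) k.

(* Measured in [decay], the quadratic term loses one derivative. *)
Lemma quad_diff_decay L r A B D a b : 0 < L -> (2 <= r)%nat ->
  decay (S r) A a -> decay (S r) B b -> decay (S r) D (fun k => a k - b k) ->
  decay r (cprod L r * (2 * PI / L) ^ 2 * D * (A + B)) (fun k => quad L a k - quad L b k).
Proof.
  intros HL Hr Ha Hb Hd.
  assert (Ha3 : decay 3 A a) by (apply decay_le_exp with (S r); auto; lia).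
  assert (Hb3 : decay 3 B b) by (apply decay_le_exp with (S r); auto; lia).
  assert (Hd3 : decay 3 D (fun k => a k - b k)) by (apply decay_le_exp with (S r); auto; lia).
  pose proof (dsyn_cont L _ _ HL Ha3). pose proof (dsyn_cont L _ _ HL Hb3). pose proof (dsyn_cont L _ _ HL Hd3).
  assert (Hs : decay r (2 * PI / L * A + 2 * PI / L * B) (coef L (fun y => dsyn L a y + dsyn L b y))).
  { intro k. rewrite coef_plus by auto. apply (decay_plus r _ _ (coef L (dsyn L a)) (coef L (dsyn L b))); now apply coef_dsyn_decay. }
  pose proof (prod_decay L r (dsyn L (fun k => a k - b k)) (fun y => dsyn L a y + dsyn L b y) (2 * PI / L * D) (2 * PI / L * A + 2 * PI / L * B) HL Hr) as P.
  intro k. unfold quad. rewrite <- coef_minus by now apply cont_sq.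
  rewrite (coef_ext L _ (fun y => dsyn L (fun k => a k - b k) y * (dsyn L a y + dsyn L b y))).
  - replace (cprod L r * (2 * PI / L) ^ 2 * D * (A + B)) with (cprod L r * (2 * PI / L * D) * (2 * PI / L * A + 2 * PI / L * B)) by ring.
    apply P; auto.
    + eapply dsyn_per; eauto.
    + now apply cont_plus.
    + now apply coef_dsyn_decay.
  - intro y. rewrite (dsyn_minus L A B) by auto. ring.
Qed.

Lemma quad_decay L r A a : 0 < L -> (2 <= r)%nat -> decay (S r) A a ->
  decay r (cprod L r * (2 * PI / L) ^ 2 * A * A) (quad L a).
Proof.
  intros HL Hr Ha k.
  assert (Ha3 : decay 3 A a) by (apply decay_le_exp with (S r); auto; lia).
  pose proof (dsyn_cont L _ _ HL Ha3).
  unfold quad. rewrite (coef_ext L _ (fun y => dsyn L a y * dsyn L a y)) by (intro; ring).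
  replace (cprod L r * (2 * PI / L) ^ 2 * A * A) with (cprod L r * (2 * PI / L * A) * (2 * PI / L * A)) by ring.
  apply prod_decay; auto.
  - eapply dsyn_per; eauto.
  - now apply coef_dsyn_decay.
  - now apply coef_dsyn_decay.
Qed.

(** * Time dependence *)

(** Freezing a function of time outside [[0,T]] makes it continuous on the whole line; derivatives
    are then claimed on the open interval only. *)
Definition clamp (T t : R) : R := Rmax 0 (Rmin t T).

Lemma clamp_range T t : 0 <= T -> 0 <= clamp T t <= T.
Proof.
  intro H. unfold clamp. split; [apply Rmax_l|]. apply Rmax_lub; auto. apply Rmin_r.
Qed.
Lemma clamp_id T t : 0 <= t <= T -> clamp T t = t.
Proof. intro H. unfold clamp. rewrite Rmin_left by lra. apply Rmax_right; lra. Qed.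
Lemma clamp_lip T t s : Rabs (clamp T t - clamp T s) <= Rabs (t - s).
Proof.
  unfold clamp, Rmax, Rmin. repeat destruct Rle_dec; unfold Rabs; repeat destruct Rcase_abs; lra.
Qed.
Lemma clamp_cont T : continuity (clamp T).
Proof.
  intros t e He. exists e. split; auto. intros s [_ Hs]. simpl in *. unfold R_dist in *.
  apply Rle_lt_trans with (2 := Hs). apply clamp_lip.
Qed.

Lemma cont2_clamp T F : 0 <= T -> cont2_on 0 T F ->
  forall t y, continuity_2d_pt (fun t y => F (clamp T t) y) t y.
Proof.
  intros HT H t y eps. destruct (H (clamp T t) y (clamp_range T t HT) eps (cond_pos eps)) as [d [Hd H2]].
  exists (mkposreal d Hd). intros u v Hu Hv. simpl in *. apply H2; auto using clamp_range.
  apply Rle_lt_trans with (2 := Hu). apply clamp_lip.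
Qed.

Lemma cont2_on_of F a b : (forall t y, continuity_2d_pt F t y) -> cont2_on a b F.
Proof.
  intros H t y Ht e He. destruct (H t y (mkposreal e He)) as [d Hd].
  exists d. split. apply cond_pos. intros t' y' _ H1 H2. now apply Hd.
Qed.

Lemma cont2_on_section T F t : 0 <= t <= T -> cont2_on 0 T F -> continuity (F t).
Proof.
  intros Ht H y e He. destruct (H t y Ht e He) as [d [Hd H2]]. exists d. split; auto.
  intros x [_ Hx]. apply H2; auto. rewrite Rminus_diag, Rabs_R0; auto.
Qed.

(** Uniform continuity provides a step over which [F] changes by less than one. The rectangle is
    star-shaped about the origin, so scaling a point by [n / (n + 1)] stays inside and walks back to
    the origin in finitely many such steps. *)
Lemma strip_bound F T L : 0 <= T -> 0 < L -> (forall t y, continuity_2d_pt F t y) ->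
  exists M, 0 < M /\ forall t y, 0 <= t <= T -> - (L/2) <= y <= L/2 -> Rabs (F t y) <= M.
Proof.
  intros HT HL HF.
  destruct (uniform_continuity_2d F 0 T (-(L/2)) (L/2) (fun x y _ _ => HF x y) (mkposreal 1 Rlt_0_1)) as [d Hd].
  set (eta := d / 2). assert (Heta : 0 < eta) by (unfold eta; pose proof (cond_pos d); lra).
  assert (Hn : forall n t y, 0 <= t <= T -> - (L/2) <= y <= L/2 -> Rabs t <= INR n * eta -> Rabs y <= INR n * eta ->
     Rabs (F t y) <= Rabs (F 0 0) + INR n).
  { induction n; intros t y Ht Hy H1 H2.
    - simpl in *. rewrite Rmult_0_l in *. pose proof (Rabs_pos t). pose proof (Rabs_pos y).
      assert (t = 0) by (destruct (Req_dec t 0); auto; apply Rabs_no_R0 in H3; lra).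
      assert (y = 0) by (destruct (Req_dec y 0); auto; apply Rabs_no_R0 in H4; lra). subst. lra.
    - rewrite S_INR in *. pose proof (pos_INR n) as Hp. set (q := INR n / (INR n + 1)).
      assert (Hq : 0 <= q <= 1). { unfold q. split. apply Rmult_le_pos; auto. left; apply Rinv_0_lt_compat; lra.
        apply Rmult_le_reg_r with (INR n + 1). lra. unfold Rdiv. rewrite Rmult_assoc, Rinv_l; lra. }
      assert (Hs : forall x, Rabs x <= (INR n + 1) * eta -> Rabs (x - q * x) < d /\ Rabs (q * x) <= INR n * eta).
      { intros x Hx. split.
        - replace (x - q * x) with (x * / (INR n + 1)) by (unfold q; field; lra).
          rewrite Rabs_mult, (Rabs_right (/ _)) by (left; apply Rinv_0_lt_compat; lra).
          apply Rle_lt_trans with eta; [|unfold eta; pose proof (cond_pos d); lra].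
          apply Rmult_le_reg_r with (INR n + 1). lra. rewrite Rmult_assoc, Rinv_l; lra.
        - rewrite Rabs_mult, (Rabs_right q) by lra. replace (INR n * eta) with (q * ((INR n + 1) * eta)) by (unfold q; field; lra).
          apply Rmult_le_compat_l; lra. }
      destruct (Hs t H1) as [A1 A2]. destruct (Hs y H2) as [B1 B2].
      assert (Rabs (F (q * t) (q * y)) <= Rabs (F 0 0) + INR n) by (apply IHn; auto; nra).
      assert (Rabs (F t y - F (q * t) (q * y)) < 1) by (apply Hd; auto; nra).
      replace (F t y) with (F (q * t) (q * y) + (F t y - F (q * t) (q * y))) by ring.
      apply Rle_trans with (1 := Rabs_triang _ _). lra. }
  destruct (INR_unbounded ((T + L) / eta)) as [n Hn1].
  exists (Rabs (F 0 0) + INR n + 1). split. { pose proof (Rabs_pos (F 0 0)). pose proof (pos_INR n). lra. }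
  assert (T + L <= INR n * eta).
  { apply Rmult_gt_compat_r with (r := eta) in Hn1; auto. unfold Rdiv in Hn1. rewrite Rmult_assoc, Rinv_l in Hn1; lra. }
  intros t y Ht Hy. apply Rle_trans with (Rabs (F 0 0) + INR n); [|lra].
  apply Hn; auto; apply Rabs_le; lra.
Qed.

Lemma cont2_mult_w L F k : (forall t y, continuity_2d_pt F t y) ->
  forall t y, continuity_2d_pt (fun t y => F t y * w L k y) t y.
Proof.
  intros H t y. apply continuity_2d_pt_mult; auto. apply (cont2_snd (w L k)), w_cont.
Qed.

Lemma coef_time_cont L F k : 0 < L -> (forall t y, continuity_2d_pt F t y) ->
  continuity (fun t => coef L (F t) k).
Proof.
  intros HL HF t e He. pose proof (wmax_pos L HL) as HW.
  assert (He2 : 0 < e / (2 * L)) by (apply Rdiv_lt_0_compat; lra).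
  destruct (uniform_continuity_2d_1d' (fun t y => F t y * w L k y) (-(L/2)) (L/2) t
    (fun x _ => cont2_mult_w L F k HF t x) (mkposreal _ He2)) as [d Hd].
  exists d. split. apply cond_pos. intros s [_ Hs]. simpl in *. unfold R_dist in *.
  unfold coef. pose proof (cond_pos d).
  assert (HC : forall t, continuity (fun y => F t y * w L k y)).
  { intro u. apply cont_mult; auto using w_cont. now apply cont2_section. }
  rewrite <- integral_minus by auto.
  apply Rle_lt_trans with ((L/2 - -(L/2)) * (e / (2 * L))).
  - apply integral_bound; [lra | now apply cont_minus |]. intros x Hx. left.
    apply Rabs_lt_between in Hs. apply Hd; auto; try lra. rewrite Rminus_diag, Rabs_R0; lra.
  - replace ((L/2 - -(L/2)) * (e / (2 * L))) with (e / 2) by (field; lra). lra.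
Qed.

Lemma coef_time_der L T F G k : 0 < L -> (forall t y, continuity_2d_pt G t y) ->
  (forall t, 0 < t < T -> continuity (F t)) ->
  (forall t y, 0 < t < T -> derivable_pt_lim (fun s => F s y) t (G t y)) ->
  forall t, 0 < t < T -> derivable_pt_lim (fun s => coef L (F s) k) t (coef L (G t) k).
Proof.
  intros HL HG HF HD t Ht. apply is_derive_Reals.
  assert (Hd : forall s y, 0 < s < T -> is_derive (fun u => F u y * w L k y) s (G s y * w L k y)).
  { intros s y Hs. apply is_derive_Reals. 
    replace (G s y * w L k y) with (G s y * w L k y + F s y * 0) by ring.
    apply (derivable_pt_lim_mult (fun u => F u y) (fun _ => w L k y)); auto. apply derivable_pt_lim_const. }
  assert (HDe : forall s y, 0 < s < T -> Derive (fun u => F u y * w L k y) s = G s y * w L k y).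
  { intros; now apply is_derive_unique, Hd. }
  assert (Hloc : locally t (fun s => 0 < s < T)).
  { assert (Hm : 0 < Rmin t (T - t)) by (apply Rmin_pos; lra).
    exists (mkposreal _ Hm). intros s Hs. unfold ball in Hs; simpl in Hs. unfold AbsRing_ball, abs, minus, plus, opp in Hs; simpl in Hs.
    pose proof (Rmin_l t (T - t)). pose proof (Rmin_r t (T - t)). apply Rabs_lt_between in Hs. lra. }
  replace (coef L (G t) k) with (RInt (fun y => Derive (fun u => F u y * w L k y) t) (-(L/2)) (L/2)).
  2:{ apply RInt_ext. intros; now apply HDe. }
  unfold coef, integral. apply (is_derive_RInt_param (fun s y => F s y * w L k y)).
  - destruct Hloc as [d Hd2]. exists d. intros s Hs y _. eexists. apply Hd. auto.
  - intros y _. apply continuity_2d_pt_ext_loc with (fun s y => G s y * w L k y).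
    + destruct Hloc as [d Hd2]. exists d. intros u v Hu Hv. symmetry. apply HDe. apply Hd2. exact Hu.
    + now apply cont2_mult_w.
  - destruct Hloc as [d Hd2]. exists d. intros s Hs. apply cont_integrable, cont_mult; auto using w_cont.
Qed.

Lemma deriv_le a b u v u' v' t : continuity u -> continuity v ->
  (forall s, a < s < b -> derivable_pt_lim u s (u' s)) ->
  (forall s, a < s < b -> derivable_pt_lim v s (v' s)) ->
  (forall s, a < s < b -> u' s <= v' s) -> a <= t <= b -> u t - u a <= v t - v a.
Proof.
  intros Hu Hv Du Dv Hle Ht. destruct (Req_dec t a) as [->|Hn]; [lra|].
  set (g := fun s => v s - u s).
  assert (Dg : forall s, a < s < t -> derivable_pt_lim g s (v' s - u' s)).
  { intros s Hs. apply (derivable_pt_lim_minus v u); [apply Dv | apply Du]; lra. }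
  assert (pr1 : forall c, a < c < t -> derivable_pt g c) by (intros c Hc; exists (v' c - u' c); exact (Dg c Hc)).
  assert (pr2 : forall c, a < c < t -> derivable_pt id c) by (intros; apply derivable_pt_id).
  destruct (MVT g id a t pr1 pr2) as [c [P E]]; try lra.
  - intros; now apply cont_minus.
  - intros; apply cont_id.
  - rewrite (derive_pt_eq_0 g c _ (pr1 c P) (Dg c P)) in E.
    rewrite (derive_pt_eq_0 id c _ (pr2 c P) (derivable_pt_lim_id c)) in E.
    unfold g, id in E. assert (u' c <= v' c) by (apply Hle; lra). nra.
Qed.

Lemma exp_lin_der a t : derivable_pt_lim (fun s => exp (a * s)) t (a * exp (a * t)).
Proof. apply is_derive_Reals. auto_derive; auto. ring. Qed.
Lemma exp_lin_cont a : continuity (fun s => exp (a * s)).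
Proof. intro t. apply derivable_continuous_pt. eexists. apply exp_lin_der. Qed.

Lemma exp_nu_der nu h z t : derivable_pt_lim z t (- nu * z t + h) ->
  derivable_pt_lim (fun s => exp (nu * s) * z s) t (h * exp (nu * t)).
Proof.
  intro H. replace (h * exp (nu * t)) with (nu * exp (nu * t) * z t + exp (nu * t) * (- nu * z t + h)) by ring.
  apply (derivable_pt_lim_mult (fun s => exp (nu * s)) z); auto. apply exp_lin_der.
Qed.

(** After multiplication by [exp (nu s)] the function is compared with a primitive of
    [H exp ((nu + M) s)]. The rate [nu] may be negative; growth of the forcing like [exp (M s)] is
    what turns [1 / nu] into [1 / (nu + M)]. *)
Lemma ode_bound T nu M H z h t : continuity z -> 0 <= H -> 0 < nu + M ->
  (forall s, 0 < s < T -> derivable_pt_lim z s (- nu * z s + h s)) ->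
  (forall s, 0 < s < T -> Rabs (h s) <= H * exp (M * s)) -> 0 <= t <= T ->
  Rabs (z t) <= Rabs (z 0) * exp (- nu * t) + H * exp (M * t) / (nu + M).
Proof.
  intros Hz HH HnM Hd Hh Ht.
  set (u := fun s => exp (nu * s) * z s). set (v := fun s => H / (nu + M) * exp ((nu + M) * s)).
  assert (Du : forall s, 0 < s < T -> derivable_pt_lim u s (h s * exp (nu * s))) by (intros; apply exp_nu_der; auto).
  assert (Dv : forall s, derivable_pt_lim v s (H * exp ((nu + M) * s))).
  { intro s. replace (H * exp ((nu + M) * s)) with (H / (nu + M) * ((nu + M) * exp ((nu + M) * s))) by (field; lra).
    apply (derivable_pt_lim_scal (fun s => exp ((nu + M) * s))), exp_lin_der. }
  assert (Cu : continuity u) by (apply cont_mult; auto using exp_lin_cont).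
  assert (Cv : continuity v) by (apply cont_scal, exp_lin_cont).
  assert (Hb : forall s, 0 < s < T -> Rabs (h s * exp (nu * s)) <= H * exp ((nu + M) * s)).
  { intros s Hs. rewrite Rabs_mult, (Rabs_right (exp _)) by (left; apply exp_pos).
    replace ((nu + M) * s) with (M * s + nu * s) by ring. rewrite exp_plus, <- Rmult_assoc.
    apply Rmult_le_compat_r; auto. left; apply exp_pos. }
  assert (H1 : u t - u 0 <= v t - v 0).
  { apply (deriv_le 0 T u v _ _ t Cu Cv Du (fun s _ => Dv s)); auto. intros s Hs.
    specialize (Hb s Hs). apply Rabs_le_between in Hb; lra. }
  assert (H2 : (- 1 * u t) - (-1 * u 0) <= v t - v 0).
  { apply (deriv_le 0 T (fun s => -1 * u s) v (fun s => -1 * (h s * exp (nu * s))) (fun s => H * exp ((nu + M) * s)) t); auto using cont_scal.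
    - intros s Hs. apply (derivable_pt_lim_scal u); auto.
    - intros s Hs. specialize (Hb s Hs). apply Rabs_le_between in Hb; lra. }
  assert (Hv0 : 0 <= v 0). { unfold v. rewrite Rmult_0_r, exp_0. assert (0 < / (nu + M)) by (apply Rinv_0_lt_compat; auto). unfold Rdiv; nra. }
  assert (Hu : Rabs (u t) <= Rabs (z 0) + v t).
  { assert (E0 : u 0 = z 0) by (unfold u; rewrite Rmult_0_r, exp_0; ring). rewrite E0 in *.
    unfold Rabs; repeat destruct Rcase_abs; lra. }
  assert (Ez : z t = exp (- nu * t) * u t).
  { unfold u. rewrite <- Rmult_assoc, <- exp_plus. replace (- nu * t + nu * t) with 0 by ring. rewrite exp_0; ring. }
  rewrite Ez, Rabs_mult, (Rabs_right (exp _)) by (left; apply exp_pos).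
  pose proof (exp_pos (- nu * t)).
  apply Rle_trans with (exp (- nu * t) * (Rabs (z 0) + v t)). apply Rmult_le_compat_l; lra.
  right. unfold v. replace (exp (M * t)) with (exp (- nu * t) * exp ((nu + M) * t)).
  unfold Rdiv; ring. rewrite <- exp_plus. f_equal; ring.
Qed.

Definition duhamel (nu z0 : R) (h : R -> R) (t : R) : R :=
  exp (- nu * t) * (z0 + integral (fun s => exp (nu * s) * h s) 0 t).

Lemma duhamel_der nu z0 h t : continuity h ->
  derivable_pt_lim (duhamel nu z0 h) t (- nu * duhamel nu z0 h t + h t).
Proof.
  intro Hh. unfold duhamel.
  set (g := fun s => exp (nu * s) * h s). assert (Hg : continuity g) by (apply cont_mult; auto using exp_lin_cont).
  replace (- nu * (exp (- nu * t) * (z0 + integral g 0 t)) + h t) with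
    (- nu * exp (- nu * t) * (z0 + integral g 0 t) + exp (- nu * t) * (0 + g t)).
  - apply (derivable_pt_lim_mult (fun t => exp (- nu * t)) (fun t => z0 + integral g 0 t)). apply exp_lin_der.
    apply (derivable_pt_lim_plus (fun _ => z0) (fun t => integral g 0 t)). apply derivable_pt_lim_const.
    apply is_derive_Reals. apply (is_derive_RInt g (fun t => integral g 0 t) 0 t).
    + apply filter_forall. intro x. apply (RInt_correct g 0 x). now apply cont_integrable.
    + apply continuity_pt_filterlim, Hg.
  - unfold g. replace (exp (- nu * t) * (0 + exp (nu * t) * h t)) with (exp (- nu * t) * exp (nu * t) * h t) by ring.
    rewrite <- exp_plus. replace (- nu * t + nu * t) with 0 by ring. rewrite exp_0. ring.
Qed.

Lemma duhamel_cont nu z0 h : continuity h -> continuity (duhamel nu z0 h).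
Proof. intros Hh t. apply derivable_continuous_pt. eexists. now apply duhamel_der. Qed.
Lemma duhamel_0 nu z0 h : duhamel nu z0 h 0 = z0.
Proof.
  unfold duhamel, integral. rewrite RInt_point, Rmult_0_r, exp_0. unfold zero; simpl. ring.
Qed.

(** * Symbols of the rescaled problem *)

(* With [y = eta / sqrt eps] the eigenvalues become [eps * mu], [mu] an eigenvalue for the period [l0]. *)
Definition Xs (eps mu : R) : R := sqrt (1 + 4 * (eps * mu)).
Definition bs (eps mu : R) : R := Xs eps mu ^ 2 + (1 + eps) * Xs eps mu - (1 + eps).
Definition fs (eps mu : R) : R :=
  / 4 * (Xs eps mu ^ 3 - 3 * Xs eps mu ^ 2 - 4 * (1 + eps) * Xs eps mu + 4 * (1 + eps)).
Definition sigma (mu : R) : R := mu - 4 * mu ^ 2.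
(** Negative for [0 < mu < 1/4], the linearly unstable band; hence the shift by [M] in all
    estimates. *)
Definition rate (eps mu : R) : R := - sigma mu / bs eps mu.

Lemma Xs_sq eps mu : 0 <= eps -> 0 <= mu -> Xs eps mu ^ 2 = 1 + 4 * (eps * mu).
Proof. intros. unfold Xs. apply pow2_sqrt. nra. Qed.
Lemma Xs_ge1 eps mu : 0 <= eps -> 0 <= mu -> 1 <= Xs eps mu.
Proof. intros. unfold Xs. rewrite <- sqrt_1 at 1. apply sqrt_le_1_alt. nra. Qed.
Lemma Xs_le eps mu : 0 <= eps -> 0 <= mu -> Xs eps mu <= 1 + 2 * (eps * mu).
Proof.
  intros. pose proof (Xs_sq eps mu H H0). pose proof (Xs_ge1 eps mu H H0).
  assert (0 <= eps * mu) by nra. nra.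
Qed.
(** All parts follow from [b = X^2 + (1 + eps)(X - 1)] with [1 <= X <= 1 + 2 eps mu]; the 8 is 4
    from [X^2] plus twice 2 from [X - 1]. *)
Lemma bs_bounds eps mu : 0 <= eps <= 1 -> 0 <= mu ->
  1 <= bs eps mu /\ Xs eps mu ^ 2 <= bs eps mu <= 3 * Xs eps mu ^ 2 /\ bs eps mu - 1 <= 8 * (eps * mu).
Proof.
  intros He Hm. pose proof (Xs_ge1 eps mu (proj1 He) Hm). pose proof (Xs_le eps mu (proj1 He) Hm).
  pose proof (Xs_sq eps mu (proj1 He) Hm). unfold bs. repeat split; nra.
Qed.
Lemma fs_bound eps mu : 0 <= eps <= 1 -> 0 <= mu -> Rabs (fs eps mu) <= 5 * Xs eps mu * bs eps mu.
Proof.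
  intros He Hm. pose proof (Xs_ge1 eps mu (proj1 He) Hm) as H1.
  destruct (bs_bounds eps mu He Hm) as [_ [[H2 _] _]]. unfold fs. set (X := Xs eps mu) in *.
  apply Rle_trans with (5 * X * X ^ 2).
  - assert (X <= X ^ 2) by nra. assert (X ^ 2 <= X ^ 3) by nra.
    replace (5 * X * X ^ 2) with (5 * X ^ 3) by ring. apply Rabs_le. nra.
  - apply Rmult_le_compat_l; lra.
Qed.
Lemma fb_bound eps mu : 0 <= eps <= 1 -> 0 <= mu -> Rabs (fs eps mu / bs eps mu) <= 5 * Xs eps mu.
Proof.
  intros He Hm. destruct (bs_bounds eps mu He Hm) as [H1 _]. pose proof (fs_bound eps mu He Hm).
  unfold Rdiv. rewrite Rabs_mult, Rabs_inv, (Rabs_right (bs eps mu)) by lra.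
  apply Rmult_le_reg_r with (bs eps mu). lra. rewrite Rmult_assoc, Rinv_l; lra.
Qed.

Lemma fb_half eps mu : 0 <= eps <= 1 -> 0 <= mu ->
  Rabs (fs eps mu / bs eps mu + / 2) <= eps * (mu * (5 + 4 * mu)).
Proof.
  intros He Hm. destruct (bs_bounds eps mu He Hm) as [H1 _].
  replace (fs eps mu / bs eps mu + / 2) with ((fs eps mu + bs eps mu / 2) / bs eps mu) by (field; lra).
  unfold Rdiv at 1. rewrite Rabs_mult, Rabs_inv, (Rabs_right (bs eps mu)) by lra.
  apply Rle_trans with (Rabs (fs eps mu + bs eps mu / 2) * 1).
  { apply Rmult_le_compat_l. apply Rabs_pos. rewrite <- Rinv_1. apply Rinv_le_contravar; lra. }
  rewrite Rmult_1_r.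
  (* The factor [X - 1] shows that the combination vanishes at [eps * mu = 0]; it supplies the
     factor [eps] of the bound. *)
  replace (fs eps mu + bs eps mu / 2) with (/ 4 * (Xs eps mu - 1) * (Xs eps mu ^ 2 - 2 * (1 + eps))) by (unfold fs, bs; field).
  pose proof (Xs_ge1 eps mu (proj1 He) Hm). pose proof (Xs_le eps mu (proj1 He) Hm).
  rewrite Xs_sq by lra. rewrite !Rabs_mult, (Rabs_right (/4)), (Rabs_right (Xs eps mu - 1)) by lra.
  assert (0 <= eps * mu <= mu) by nra.
  assert (Rabs (1 + 4 * (eps * mu) - 2 * (1 + eps)) <= 5 + 4 * mu) by (apply Rabs_le; nra).
  apply Rle_trans with (/4 * (2 * (eps * mu)) * (5 + 4 * mu)).
  - apply Rmult_le_compat; auto using Rabs_pos; nra.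
  - nra.
Qed.

Lemma inv_bs_diff eps mu : 0 <= eps <= 1 -> 0 <= mu -> 0 <= 1 - / bs eps mu <= 8 * (eps * mu).
Proof.
  intros He Hm. destruct (bs_bounds eps mu He Hm) as [H1 [_ H2]].
  assert (0 < / bs eps mu <= 1). { split. apply Rinv_0_lt_compat; lra. rewrite <- Rinv_1. apply Rinv_le_contravar; lra. }
  split; [lra|]. replace (1 - / bs eps mu) with ((bs eps mu - 1) * / bs eps mu) by (field; lra). nra.
Qed.

(** In this range [b <= 3 X^2 <= 15], so the fourth-order damping survives up to a constant. *)
Lemma rate_low eps mu : 0 <= eps <= 1 -> 0 <= mu -> eps * mu <= 1 -> 4 / 15 * mu ^ 2 - mu <= rate eps mu.
Proof.
  intros He Hm H. destruct (bs_bounds eps mu He Hm) as [H1 [[_ H2] _]]. rewrite Xs_sq in H2 by lra.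
  unfold rate, sigma.
  apply Rmult_le_reg_r with (bs eps mu). lra. unfold Rdiv. rewrite (Rmult_assoc (- _)), Rinv_l by lra.
  assert (bs eps mu <= 15) by lra.
  assert (0 <= mu ^ 2) by nra. nra.
Qed.

(** In this range [b <= 15 eps mu]; one power of [mu] in the damping is exchanged for the factor
    [1 / eps]. *)
Lemma rate_high eps mu : 0 < eps <= 1 -> 0 <= mu -> 1 <= eps * mu -> mu * (4 / 15 * / eps - 1) <= rate eps mu.
Proof.
  intros He Hm H. assert (He' : 0 <= eps <= 1) by lra. destruct (bs_bounds eps mu He' Hm) as [H1 [[_ H2] _]]. rewrite Xs_sq in H2 by lra.
  unfold rate, sigma.
  apply Rmult_le_reg_r with (bs eps mu). lra. unfold Rdiv. rewrite (Rmult_assoc (- _)), Rinv_l by lra.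
  assert (bs eps mu <= 15 * (eps * mu)) by lra.
  assert (Hi : 0 < / eps) by (apply Rinv_0_lt_compat; lra).
  apply Rle_trans with (mu * (4 / 15 * / eps) * (15 * (eps * mu)) - mu).
  - assert (0 <= mu * (4/15 * / eps)) by (apply Rmult_le_pos; lra). 
    replace (mu * (4 * / 15 * / eps - 1) * bs eps mu) with (mu * (4/15 * / eps) * bs eps mu - mu * bs eps mu) by (field; lra).
    assert (mu * 1 <= mu * bs eps mu) by (apply Rmult_le_compat_l; lra).
    assert (mu * (4 / 15 * / eps) * bs eps mu <= mu * (4 / 15 * / eps) * (15 * (eps * mu))) by (apply Rmult_le_compat_l; lra).
    lra.
  - right. field. lra.
Qed.

(** The variable [kp] is a wave number, and [1 + kp] is the derivative lost in the quadratic term.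
    At low frequency [X <= 3], and growth like [mu] faces [mu^2]. At high frequency the left side is
    at most [30 mu] against a rate of order [mu / eps], so [eps] itself has to be small. *)
Lemma gain_small theta : 0 < theta -> exists M eps1, 2 <= M /\ 0 < eps1 < 1 /\
  forall eps kp, 0 < eps <= eps1 -> 0 <= kp ->
    1 <= rate eps (kp ^ 2) + M /\ 5 * Xs eps (kp ^ 2) * (1 + kp) <= theta * (rate eps (kp ^ 2) + M).
Proof.
  intro Ht.
  (* The two summanded terms over [theta] are what completing the square in [15 (2 + mu) <= theta
     (4/15 mu^2 - mu + M - 2)] demands. The 2 keeps the shifted rate above one, as [4/15 mu^2 - mu]
     is at least [-15/16]. *)
  set (M := 2 + (30 / theta + (15 * (15 + theta) ^ 2) / (16 * theta ^ 2))).
  assert (HM0 : theta * (M - 2) = 30 + (15 * (15 + theta) ^ 2) / (16 * theta)) by (unfold M; field; lra).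
  assert (HP : 0 < 30 + (15 * (15 + theta) ^ 2) / (16 * theta)).
  { assert (0 < (15 * (15 + theta) ^ 2) / (16 * theta)). apply Rdiv_lt_0_compat; nra. lra. }
  assert (HM : 2 <= M) by nra.
  (* The second threshold is equivalent to [theta (4 / (15 eps) - 1) >= 30], the high-frequency
     requirement. *)
  exists M, (Rmin (/2) (4 * theta / (15 * (30 + theta)))).
  assert (He0 : 0 < 4 * theta / (15 * (30 + theta))) by (apply Rdiv_lt_0_compat; lra).
  split; auto. split. { split. apply Rmin_pos; lra. pose proof (Rmin_l (/2) (4 * theta / (15 * (30 + theta)))); lra. }
  intros eps kp He Hk.
  pose proof (Rmin_l (/2) (4 * theta / (15 * (30 + theta)))). pose proof (Rmin_r (/2) (4 * theta / (15 * (30 + theta)))).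
  assert (Hmu : 0 <= kp ^ 2) by nra. set (mu := kp ^ 2) in *.
  assert (He1 : 0 <= eps <= 1) by lra.
  pose proof (Xs_ge1 eps mu (proj1 He1) Hmu). pose proof (Xs_sq eps mu (proj1 He1) Hmu).
  assert (Hkm : kp <= (1 + mu) / 2) by (unfold mu; pose proof (pow2_ge_0 (kp - 1)); lra).
  destruct (Rle_dec (eps * mu) 1) as [Hc|Hc].
  - pose proof (rate_low eps mu He1 Hmu Hc). split; [pose proof (pow2_ge_0 (mu - 15 / 8)); lra|].
    assert (Xs eps mu <= 3) by nra.
    apply Rle_trans with (5 * 3 * (2 + mu)).
    + apply Rmult_le_compat; nra.
    + apply Rle_trans with (theta * (4 / 15 * mu ^ 2 - mu + (M - 2))).
      * replace (theta * (4/15 * mu ^ 2 - mu + (M - 2))) with (theta * (4/15 * mu ^ 2 - mu) + theta * (M - 2)) by ring.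
        rewrite HM0.
        assert (E : theta * (4/15 * mu^2 - mu) + (30 + 15 * (15 + theta) ^ 2 / (16 * theta)) - 5 * 3 * (2 + mu)
           = 4 / 15 * / theta * (theta * mu - 15 / 8 * (15 + theta)) ^ 2) by (field; lra).
        assert (0 < / theta) by (apply Rinv_0_lt_compat; auto).
        assert (0 <= (theta * mu - 15 / 8 * (15 + theta)) ^ 2) by apply pow2_ge_0. nra.
      * apply Rmult_le_compat_l; lra.
  - assert (Hc' : 1 <= eps * mu) by lra. pose proof (rate_high eps mu ltac:(lra) Hmu Hc') as Hr.
    assert (Hi : (30 + theta) / theta <= 4 / 15 * / eps).
    { apply Rmult_le_reg_r with (15 * eps * theta). apply Rmult_lt_0_compat; lra.
      replace ((30 + theta) / theta * (15 * eps * theta)) with (eps * (15 * (30 + theta))) by (field; lra).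
      replace (4 / 15 * / eps * (15 * eps * theta)) with (4 * theta) by (field; lra).
      replace (4 * theta) with (4 * theta / (15 * (30 + theta)) * (15 * (30 + theta))) by (field; lra).
      apply Rmult_le_compat_r; lra. }
    assert (Hi2 : 30 <= theta * (4 / 15 * / eps - 1)).
    { apply Rle_trans with (theta * ((30 + theta) / theta - 1)). right; field; lra. apply Rmult_le_compat_l; lra. }
    assert (Hmu1 : 1 <= mu) by nra.
    assert (Hr2 : 30 * mu <= theta * rate eps mu).
    { apply Rle_trans with (mu * (theta * (4 / 15 * / eps - 1))). rewrite Rmult_comm. apply Rmult_le_compat_l; lra.
      replace (mu * (theta * (4 / 15 * / eps - 1))) with (theta * (mu * (4 / 15 * / eps - 1))) by ring.
      apply Rmult_le_compat_l; lra. }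
    assert (0 <= rate eps mu) by nra.
    split; [lra|].
    assert (Hk1 : 1 <= kp) by (unfold mu in Hmu1; nra).
    assert (HX : Xs eps mu <= 3 * kp). { assert (Xs eps mu ^ 2 <= (3 * kp) ^ 2). rewrite H2. unfold mu in *. nra. nra. }
    apply Rle_trans with (5 * (3 * kp) * (2 * kp)); [apply Rmult_le_compat; lra|].
    replace (5 * (3 * kp) * (2 * kp)) with (30 * mu) by (unfold mu; ring). nra.
Qed.

(** Here [25 X^2] is the square of the bound on [|f| / b], and [G^2 mu] is the gradient term that
    Young's and Bessel's inequalities leave over; the damping has to cover both up to a multiple of
    the energy. *)
Lemma energy_small G : 0 <= G -> exists M eps2, 0 < M /\ 0 < eps2 < 1 /\
  forall eps mu, 0 < eps <= eps2 -> 0 <= mu ->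
    25 * Xs eps mu ^ 2 + G ^ 2 * mu <= 2 * rate eps mu + 2 * M.
Proof.
  intro HG. set (g := G ^ 2). assert (Hg : 0 <= g) by (unfold g; nra).
  (* Twice 63 covers [25 X^2 <= 125] plus low-frequency terms, and the square absorbs [(2 + g) mu]
     into [mu^2]. The bound on [eps] makes the high-frequency rate at least [(63 + g) mu]. *)
  exists (63 + 2 * (2 + g) ^ 2), (4 / (15 * (64 + g))).
  assert (He0 : 0 < 4 / (15 * (64 + g))) by (apply Rdiv_lt_0_compat; lra).
  assert (He0' : 4 / (15 * (64 + g)) <= / 2).
  { apply Rmult_le_reg_r with (15 * (64 + g)). lra. unfold Rdiv. rewrite Rmult_assoc, Rinv_l; lra. }
  split; [nra|]. split; [lra|]. intros eps mu He Hmu.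
  assert (He1 : 0 <= eps <= 1) by lra. rewrite Xs_sq by lra.
  destruct (Rle_dec (eps * mu) 1) as [Hc|Hc].
  - pose proof (rate_low eps mu He1 Hmu Hc).
    assert (0 <= (mu - 2 * (2 + g)) ^ 2) by apply pow2_ge_0. nra.
  - pose proof (rate_high eps mu ltac:(lra) Hmu ltac:(lra)) as Hr.
    assert (Hi : 64 + g <= 4 / 15 * / eps).
    { apply Rmult_le_reg_r with (15 * eps). lra.
      replace (4 / 15 * / eps * (15 * eps)) with (4 / (15 * (64 + g)) * (15 * (64 + g))) by (field; lra).
      replace ((64 + g) * (15 * eps)) with (eps * (15 * (64 + g))) by ring. apply Rmult_le_compat_r; lra. }
    assert (mu * (63 + g) <= rate eps mu). { apply Rle_trans with (2 := Hr). apply Rmult_le_compat_l; lra. }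
    nra.
Qed.

(** * Index weights against wave numbers, and the orders of the symbols *)

(** Compares the index weight [1 + jidx k] with [1 + kap L k]; it depends on the period alone. *)
Definition cw (L : R) : R := 1 + L / (2 * PI).
Lemma cw_pos L : 0 < L -> 1 <= cw L.
Proof.
  intro H. unfold cw. pose proof PI_RGT_0. assert (0 < L / (2 * PI)) by (apply Rdiv_lt_0_compat; lra). lra.
Qed.
Lemma weight_kap L k : 0 < L -> 1 + jidx k <= cw L * (1 + kap L k).
Proof.
  intro H. pose proof PI_RGT_0. pose proof (kap_pos L k H).
  assert (E : jidx k = L / (2 * PI) * kap L k) by (unfold kap; field; lra).
  rewrite E. unfold cw. assert (0 < L / (2 * PI)) by (apply Rdiv_lt_0_compat; lra). nra.
Qed.
Lemma kap_weight L k : 0 < L -> kap L k ^ 2 <= (2 * PI / L) ^ 2 * (1 + jidx k) ^ 2.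
Proof.
  intro H. rewrite <- Rpow_mult_distr. apply pow_incr. split. now apply kap_pos. now apply kap_le.
Qed.
(** The polynomial [1 - mu + 4 mu^2] dominates a multiple of [(1 + mu)^2], so the shifted linear
    operator controls four powers of the wave number in spite of the unstable band. *)
Lemma weight4 L k : 0 < L -> (1 + jidx k) ^ 4 <= 16 * cw L ^ 4 * (1 - sigma (kap L k ^ 2)).
Proof.
  intro H. pose proof (weight_kap L k H). pose proof (kap_pos L k H). pose proof (jidx_pos k). pose proof (cw_pos L H).
  apply Rle_trans with ((cw L * (1 + kap L k)) ^ 4). apply pow_incr; lra.
  rewrite Rpow_mult_distr. replace (16 * cw L ^ 4 * (1 - sigma (kap L k ^ 2))) with (cw L ^ 4 * (16 * (1 - sigma (kap L k ^ 2)))) by ring.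
  apply Rmult_le_compat_l. apply pow_le; lra.
  unfold sigma. set (x := kap L k) in *. set (m := x ^ 2).
  assert ((1 + x) ^ 2 <= 2 * (1 + m)) by (unfold m; pose proof (pow2_ge_0 (x - 1)); lra).
  assert ((1 + x) ^ 4 <= (2 * (1 + m)) ^ 2).
  { replace ((1+x)^4) with (((1+x)^2)^2) by ring. apply pow_incr. split; auto. apply pow2_ge_0. }
  assert (0 <= m) by (unfold m; apply pow2_ge_0). pose proof (pow2_ge_0 (m - 1)).
  assert (0 <= m ^ 2) by apply pow2_ge_0. lra.
Qed.

(** The orders are 2, 4 and 3 with constants independent of [eps]; they determine how much decay the
    series of a classical solution needs. *)
Lemma symbol_growth eps L k : 0 < L -> 0 <= eps <= 1 ->
  let K := (2 * PI / L) ^ 2 in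
  Rabs (bs eps (kap L k ^ 2)) <= 3 * (1 + 4 * K) * (1 + jidx k) ^ 2 /\
  Rabs (sigma (kap L k ^ 2)) <= (K + 4 * K ^ 2) * (1 + jidx k) ^ 4 /\
  Rabs (fs eps (kap L k ^ 2)) <= 15 * (1 + 4 * K) ^ 2 * (1 + jidx k) ^ 3.
Proof.
  intros HL He K. set (mu := kap L k ^ 2). assert (Hmu : 0 <= mu) by (unfold mu; apply pow2_ge_0).
  assert (HK : 0 <= K) by (unfold K; apply pow2_ge_0).
  assert (Hmx : mu <= K * (1 + jidx k) ^ 2) by (apply kap_weight; auto). clearbody K mu.
  pose proof (jidx_pos k) as Hj. set (x := 1 + jidx k) in *. assert (Hx : 1 <= x) by (unfold x; lra). clearbody x.
  assert (Hx2 : 1 <= x ^ 2) by (apply pow_ge1; auto).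
  pose proof (Xs_sq eps mu ltac:(lra) Hmu) as HXs. pose proof (Xs_ge1 eps mu ltac:(lra) Hmu) as HX1.
  destruct (bs_bounds eps mu He Hmu) as [B1 [[B2 B3] _]].
  assert (HX2 : Xs eps mu ^ 2 <= (1 + 4 * K) * x ^ 2).
  { rewrite HXs. apply Rle_trans with (1 + 4 * mu). nra. nra. }
  assert (HX : Xs eps mu <= (1 + 4 * K) * x).
  { apply Rsqr_incr_0_var; [|nra]. unfold Rsqr. replace (Xs eps mu * Xs eps mu) with (Xs eps mu ^ 2) by ring.
    apply Rle_trans with (1 := HX2). nra. }
  assert (Hb : bs eps mu <= 3 * (1 + 4 * K) * x ^ 2) by lra.
  split; [|split].
  - rewrite Rabs_right by lra. exact Hb.
  - apply Rle_trans with (K * x ^ 2 + 4 * (K * x ^ 2) ^ 2).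
    + unfold sigma. apply Rabs_le. assert (mu ^ 2 <= (K * x ^ 2) ^ 2) by (apply pow_incr; lra). pose proof (pow2_ge_0 mu). lra.
    + replace ((K + 4 * K ^ 2) * x ^ 4) with (K * x ^ 2 * x ^ 2 + 4 * (K * x ^ 2) ^ 2) by ring.
      apply Rplus_le_compat_r. assert (0 <= K * x ^ 2) by nra. nra.
  - apply Rle_trans with (1 := fs_bound eps mu He Hmu).
    apply Rle_trans with (5 * ((1 + 4 * K) * x) * (3 * (1 + 4 * K) * x ^ 2)).
    + apply Rmult_le_compat; lra.
    + right; ring.
Qed.

(** * Regularity of the Kuramoto--Sivashinsky solution *)

Lemma deriv_clamp T f t l : 0 < t < T -> derivable_pt_lim f t l ->
  derivable_pt_lim (fun s => f (clamp T s)) t l.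
Proof.
  intros Ht H e He. destruct (H e He) as [d Hd].
  assert (Hm : 0 < Rmin d (Rmin t (T - t))) by (repeat apply Rmin_pos; try lra; apply cond_pos).
  exists (mkposreal _ Hm). intros h Hh0 Hh. simpl in Hh.
  pose proof (Rmin_l d (Rmin t (T - t))). pose proof (Rmin_r d (Rmin t (T - t))).
  pose proof (Rmin_l t (T - t)). pose proof (Rmin_r t (T - t)).
  pose proof Hh as Hh'. apply Rabs_lt_between in Hh'.
  rewrite !clamp_id by lra. apply Hd; auto; lra.
Qed.

Lemma is_coef_coef L f k c : is_coef L f k c -> coef L f k = c.
Proof.
  intros [pr E]. unfold coef, integral. rewrite <- E. apply RInt_Reals.
Qed.
Lemma coef_is_coef L f k : continuity f -> is_coef L f k (coef L f k).
Proof.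
  intro H. assert (E : ex_RInt (fun y => f y * w L k y) (-(L/2)) (L/2)) by (apply cont_integrable, cont_mult; auto using w_cont).
  exists (ex_RInt_Reals_0 _ _ _ E). unfold coef, integral. symmetry. apply RInt_Reals.
Qed.

Lemma weight2 L k : 0 < L -> (1 + jidx k) ^ 2 <= 2 * cw L ^ 2 * (1 + kap L k ^ 2).
Proof.
  intro H. pose proof (weight_kap L k H). pose proof (kap_pos L k H). pose proof (jidx_pos k). pose proof (cw_pos L H).
  apply Rle_trans with ((cw L * (1 + kap L k)) ^ 2). apply pow_incr; lra.
  rewrite Rpow_mult_distr. replace (2 * cw L ^ 2 * (1 + kap L k ^ 2)) with (cw L ^ 2 * (2 * (1 + kap L k ^ 2))) by ring.
  apply Rmult_le_compat_l. apply pow_le; lra. pose proof (pow2_ge_0 (kap L k - 1)). lra.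
Qed.

(** Elliptic regularity for sequences. It applies alike to the Kuramoto--Sivashinsky solution and to
    an arbitrary classical solution of the perturbed problem. *)
Lemma decay4_of_sigma L a C0 C1 : 0 < L -> (forall k, Rabs (a k) <= C0) ->
  (forall k, Rabs (sigma (kap L k ^ 2) * a k) <= C1) -> decay 4 (16 * cw L ^ 4 * (C0 + C1)) a.
Proof.
  intros HL H0 H1 k. specialize (H0 k). specialize (H1 k). rewrite Rabs_mult in H1.
  pose proof (weight4 L k HL) as W. pose proof (jidx_pos k).
  assert (Hw : 0 < (1 + jidx k) ^ 4) by (apply pow_lt; lra).
  apply Rmult_le_reg_r with ((1 + jidx k) ^ 4); auto.
  unfold Rdiv. rewrite (Rmult_assoc _ (/ _)), Rinv_l, Rmult_1_r by lra.
  pose proof (Rabs_pos (a k)) as Hx. set (x := Rabs (a k)) in *.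
  apply Rle_trans with (x * (16 * cw L ^ 4 * (1 - sigma (kap L k ^ 2)))). apply Rmult_le_compat_l; auto.
  replace (x * (16 * cw L ^ 4 * (1 - sigma (kap L k ^ 2)))) with (16 * cw L ^ 4 * (x * (1 - sigma (kap L k ^ 2)))) by ring.
  apply Rmult_le_compat_l. { pose proof (cw_pos L HL). pose proof (pow_lt (cw L) 4 ltac:(lra)). lra. }
  pose proof (Rle_abs (- sigma (kap L k ^ 2))) as Hs. rewrite Rabs_Ropp in Hs. nra.
Qed.

(** A single term of the Sobolev series is at most its sum, and the weight [(1 + lam)^m] is of order
    [2 m] in the wave number; after the square root [m] powers remain. *)
Lemma Hsharp_decay n m L f : 0 < L -> (n <= m)%nat -> in_Hsharp m L f -> exists A, decay n A (coef L f).
Proof.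
  intros HL Hnm [Hf [_ [a [Ha [s Hs]]]]].
  assert (HC : 0 < (2 * cw L ^ 2) ^ n).
  { apply pow_lt. pose proof (cw_pos L HL). pose proof (pow_lt (cw L) 2 ltac:(lra)). lra. }
  assert (Hpos : forall k, 0 <= (1 + lam L k) ^ m * a k ^ 2).
  { intro k. apply Rmult_le_pos; [apply pow_le | apply pow2_ge_0]. rewrite lam_kap. pose proof (pow2_ge_0 (kap L k)). lra. }
  assert (Hterm : forall k, (1 + lam L k) ^ m * a k ^ 2 <= s).
  { intro k. apply Rle_trans with (sum_f_R0 (fun k => (1 + lam L k) ^ m * a k ^ 2) k).
    - destruct k; [simpl sum_f_R0; lra|]. rewrite tech5.
      assert (0 <= sum_f_R0 (fun k => (1 + lam L k) ^ m * a k ^ 2) k) by (apply cond_pos_sum; auto). lra.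
    - apply (sum_incr (fun k => (1 + lam L k) ^ m * a k ^ 2)); auto. }
  assert (Hs0 : 0 <= s) by (specialize (Hterm O); specialize (Hpos O); lra).
  exists (sqrt ((2 * cw L ^ 2) ^ n * s)). intro k.
  rewrite (is_coef_coef _ _ _ _ (Ha k)).
  pose proof (jidx_pos k) as Hj. assert (Hw : 0 < (1 + jidx k) ^ n) by (apply pow_lt; lra).
  apply Rmult_le_reg_r with ((1 + jidx k) ^ n); auto. unfold Rdiv. rewrite Rmult_assoc, Rinv_l, Rmult_1_r by lra.
  apply Rsqr_incr_0_var; [|apply sqrt_pos]. rewrite Rsqr_sqrt by nra. unfold Rsqr.
  replace (Rabs (a k) * (1 + jidx k) ^ n * (Rabs (a k) * (1 + jidx k) ^ n)) with
    ((Rabs (a k)) ^ 2 * ((1 + jidx k) ^ n * (1 + jidx k) ^ n)) by ring.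
  rewrite pow2_abs, <- Rpow_mult_distr.
  replace ((1 + jidx k) * (1 + jidx k)) with ((1 + jidx k) ^ 2) by ring.
  assert (H1 : ((1 + jidx k) ^ 2) ^ n <= (2 * cw L ^ 2) ^ n * (1 + lam L k) ^ n).
  { rewrite <- Rpow_mult_distr. apply pow_incr. rewrite lam_kap. split; [apply pow2_ge_0 | now apply weight2]. }
  assert (H2 : (1 + lam L k) ^ n <= (1 + lam L k) ^ m).
  { apply Rle_pow; auto. rewrite lam_kap. pose proof (pow2_ge_0 (kap L k)). lra. }
  specialize (Hterm k). pose proof (pow2_ge_0 (a k)).
  apply Rle_trans with (a k ^ 2 * ((2 * cw L ^ 2) ^ n * (1 + lam L k) ^ m)).
  - apply Rmult_le_compat_l; auto. nra.
  - replace (a k ^ 2 * ((2 * cw L ^ 2) ^ n * (1 + lam L k) ^ m)) with ((2 * cw L ^ 2) ^ n * ((1 + lam L k) ^ m * a k ^ 2)) by ring.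
    apply Rmult_le_compat_l; lra.
Qed.

Record ks_modes (L T : R) (a : nat -> R -> R) : Prop := {
  ksm_cont : forall k, continuity (a k);
  ksm_ode : forall k t, 0 < t < T ->
    derivable_pt_lim (a k) t (sigma (kap L k ^ 2) * a k t - / 2 * quad L (fun k => a k t) k)
}.

(** Projects the equation on each mode. Continuity of the fourth and second space derivatives bounds
    [sigma] times the coefficients uniformly in time, which yields the decay 4 from which the
    bootstrap starts. *)
Lemma KS_solution_modes L T Phi0 Phi : 0 < L -> 0 < T -> KS_solution L T Phi0 Phi ->
  let a := fun k t => coef L (Phi (clamp T t)) k in
  ks_modes L T a /\ (exists A, forall t, decay 4 A (fun k => a k t)) /\
  (forall k, a k 0 = coef L Phi0 k) /\
  (forall t y, 0 <= t <= T -> Phi t y = syn L (fun k => a k t) y).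
Proof.
  intros HL HT [P1 [P2 [P3 [P4 [Pt [Hper [H0 [C0 [C1 [C2 [C3 [C4 [HD HE]]]]]]]]]]]]] a.
  assert (HT0 : 0 <= T) by lra.
  assert (Hclamp : forall t, 0 <= clamp T t <= T) by (intro; now apply clamp_range).
  assert (S0 : forall t, 0 <= t <= T -> continuity (Phi t)) by (intros; eapply cont2_on_section; eauto).
  assert (S1 : forall t, 0 <= t <= T -> continuity (P1 t)) by (intros; eapply cont2_on_section; eauto).
  assert (S2 : forall t, 0 <= t <= T -> continuity (P2 t)) by (intros; eapply cont2_on_section; eauto).
  assert (S3 : forall t, 0 <= t <= T -> continuity (P3 t)) by (intros; eapply cont2_on_section; eauto).
  assert (S4 : forall t, 0 <= t <= T -> continuity (P4 t)) by (intros; eapply cont2_on_section; eauto).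
  assert (Q0 : forall t, 0 <= t <= T -> periodic L (Phi t)) by (intros t Ht y; auto).
  assert (Q1 : forall t, 0 <= t <= T -> periodic L (P1 t)).
  { intros t Ht. apply (deriv_per L (Phi t)); auto. intro y; apply (HD t y Ht). }
  assert (Q2 : forall t, 0 <= t <= T -> periodic L (P2 t)).
  { intros t Ht. apply (deriv_per L (P1 t)); auto. intro y; apply (HD t y Ht). }
  assert (Q3 : forall t, 0 <= t <= T -> periodic L (P3 t)).
  { intros t Ht. apply (deriv_per L (P2 t)); auto. intro y; apply (HD t y Ht). }
  assert (E2 : forall t k, 0 <= t <= T -> coef L (P2 t) k = - lam L k * coef L (Phi t) k).
  { intros t k Ht. apply (coef_deriv2 L (Phi t) (P1 t)); auto; intro y; apply (HD t y Ht). }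
  assert (E4 : forall t k, 0 <= t <= T -> coef L (P4 t) k = lam L k ^ 2 * coef L (Phi t) k).
  { intros t k Ht. rewrite (coef_deriv2 L (P2 t) (P3 t) (P4 t)); auto; try (intro y; apply (HD t y Ht)).
    rewrite E2 by auto. ring. }
  destruct (strip_bound (fun t y => Phi (clamp T t) y) T L HT0 HL (cont2_clamp T Phi HT0 C0)) as [M0 [HM0 B0]].
  destruct (strip_bound (fun t y => P2 (clamp T t) y) T L HT0 HL (cont2_clamp T P2 HT0 C2)) as [M2 [HM2 B2]].
  destruct (strip_bound (fun t y => P4 (clamp T t) y) T L HT0 HL (cont2_clamp T P4 HT0 C4)) as [M4 [HM4 B4]].
  assert (Hdec : exists A, forall t, decay 4 A (fun k => a k t)).
  { eexists. intro t. specialize (Hclamp t). set (s := clamp T t) in *.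
    apply (decay4_of_sigma L (fun k => a k t) (L * M0 * wmax L) (4 * (L * M4 * wmax L) + L * M2 * wmax L)); auto; intro k.
    - apply coef_bound; auto. intros y Hy. specialize (B0 s y Hclamp Hy). simpl in B0. now rewrite clamp_id in B0.
    - assert (b2 : Rabs (coef L (P2 s) k) <= L * M2 * wmax L).
      { apply coef_bound; auto. intros y Hy. specialize (B2 s y Hclamp Hy). simpl in B2. now rewrite clamp_id in B2. }
      assert (b4 : Rabs (coef L (P4 s) k) <= L * M4 * wmax L).
      { apply coef_bound; auto. intros y Hy. specialize (B4 s y Hclamp Hy). simpl in B4. now rewrite clamp_id in B4. }
      replace (sigma (kap L k ^ 2) * a k t) with (- (4 * coef L (P4 s) k) - coef L (P2 s) k)
        by (rewrite E4, E2, lam_kap by auto; unfold sigma, a; fold s; ring).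
      apply Rabs_le_between in b2. apply Rabs_le_between in b4. apply Rabs_le. lra. }
  assert (Hsyn : forall t y, 0 <= t <= T -> Phi t y = syn L (fun k => a k t) y).
  { intros t y Ht. destruct Hdec as [A HA]. specialize (HA t). unfold a in *. rewrite clamp_id in * by auto.
    apply (syn_coef L (Phi t) 4 A); auto. }
  assert (HP1 : forall t y, 0 <= t <= T -> P1 t y = dsyn L (fun k => a k t) y).
  { intros t y Ht. destruct Hdec as [A HA]. apply (uniqueness_limite (Phi t) y). apply (HD t y Ht).
    apply is_derive_Reals. apply (is_derive_ext (syn L (fun k => a k t))). intro z; symmetry; now apply Hsyn.
    apply is_derive_Reals. apply (syn_der L A); auto. apply decay_le_exp with 4%nat; auto. }
  split; [|split; [|split]]; auto.
  - split.
    + intro k. unfold a. apply (coef_time_cont L (fun t y => Phi (clamp T t) y)); auto. now apply cont2_clamp.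
    + intros k t Ht. assert (Ht' : 0 <= t <= T) by lra.
      set (G := fun t y => - (4 * P4 (clamp T t) y + P2 (clamp T t) y + / 2 * (P1 (clamp T t) y * P1 (clamp T t) y))).
      assert (HG : forall t y, continuity_2d_pt G t y).
      { intros s y. apply continuity_2d_pt_opp, continuity_2d_pt_plus; [apply continuity_2d_pt_plus|].
        - apply continuity_2d_pt_mult; [apply continuity_2d_pt_const | now apply (cont2_clamp T P4)].
        - now apply (cont2_clamp T P2).
        - apply continuity_2d_pt_mult; [apply continuity_2d_pt_const |].
          apply continuity_2d_pt_mult; now apply (cont2_clamp T P1). }
      assert (HGd : forall t y, 0 < t < T -> derivable_pt_lim (fun s => Phi (clamp T s) y) t (G t y)).
      { intros s y Hs. apply (deriv_clamp T (fun s => Phi s y)); auto. destruct (HE s y Hs) as [Hd He].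
        replace (G s y) with (Pt s y); auto. unfold G. rewrite clamp_id by lra.
        replace (P1 s y * P1 s y) with (P1 s y ^ 2) by ring. lra. }
      pose proof (coef_time_der L T (fun t y => Phi (clamp T t) y) G k HL HG) as D.
      assert (EG : coef L (G t) k = sigma (kap L k ^ 2) * a k t - / 2 * quad L (fun k => a k t) k).
      { rewrite (coef_ext L (G t) (fun y => - 4 * P4 t y + (- 1 * P2 t y + - / 2 * P1 t y ^ 2))).
        - rewrite coef_plus, coef_plus, !coef_scal, E2, E4, lam_kap; auto using cont_scal, cont_sq.
          + unfold quad. rewrite (coef_ext L (fun y => P1 t y ^ 2) (fun y => dsyn L (fun k => a k t) y ^ 2)).
            * replace (coef L (Phi t) k) with (a k t) by (unfold a; now rewrite clamp_id by lra). unfold sigma. ring.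
            * intro y. now rewrite HP1.
          + apply cont_plus; apply cont_scal; auto using cont_sq.
        - intro y. unfold G. rewrite clamp_id by lra. ring. }
      rewrite <- EG. apply D; auto.
  - intro k. unfold a. rewrite clamp_id by lra. apply coef_ext. intro; apply H0.
Qed.

Lemma sigma_le1 mu : sigma mu <= / 16.
Proof. unfold sigma. pose proof (pow2_ge_0 (2 * mu - / 4)). lra. Qed.

(* The linear part gains four derivatives and the nonlinearity costs one. *)
Lemma ks_bootstrap L T a p A A0 : 0 < L -> 0 < T -> (3 <= p)%nat -> ks_modes L T a ->
  (forall t, decay p A (fun k => a k t)) -> decay (p + 3) A0 (fun k => a k 0) ->
  exists B, forall t, 0 <= t <= T -> decay (p + 3) B (fun k => a k t).
Proof.
  intros HL HT Hp [Hc Ho] HA H0.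
  destruct p as [|q]; [lia|].
  set (C := cprod L q * (2 * PI / L) ^ 2 * A * A).
  assert (HQ : forall t, decay q C (quad L (fun k => a k t))) by (intro; apply quad_decay; auto; lia).
  pose proof (decay_nonneg _ _ _ (HQ 0)) as HC. pose proof (decay_nonneg _ _ _ H0) as HA0.
  exists (A0 * exp T + 16 * cw L ^ 4 * (C * exp T)). intros t Ht k.
  pose proof (jidx_pos k) as Hj. pose proof (sigma_le1 (kap L k ^ 2)) as Hs.
  pose proof (cw_pos L HL) as Hcw. pose proof (pow_lt (cw L) 4 ltac:(lra)) as Hc4.
  assert (Hq : 0 < (1 + jidx k) ^ q) by (apply pow_lt; lra).
  assert (HH : 0 <= C / (1 + jidx k) ^ q) by (apply Rmult_le_pos; auto; left; now apply Rinv_0_lt_compat).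
  (* Duhamel with [M = 1]: as [sigma] is at most [1/16], the divisor [1 - sigma] is positive and of
     order four. The quadratic term has decay [q = p - 1], and [q + 4 = p + 3]. *)
  pose proof (ode_bound T (- sigma (kap L k ^ 2)) 1 (C / (1 + jidx k) ^ q) (a k)
    (fun s => - / 2 * quad L (fun k => a k s) k) t (Hc k) HH ltac:(lra)) as B.
  assert (Hb : Rabs (a k t) <= Rabs (a k 0) * exp (- - sigma (kap L k ^ 2) * t) +
     C / (1 + jidx k) ^ q * exp (1 * t) / (- sigma (kap L k ^ 2) + 1)).
  { apply B; auto.
    - intros s Hs'. replace (- - sigma (kap L k ^ 2) * a k s + - / 2 * quad L (fun k => a k s) k) with
       (sigma (kap L k ^ 2) * a k s - / 2 * quad L (fun k => a k s) k) by ring. now apply Ho.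
    - intros s Hs'. rewrite Rabs_mult, Rabs_Ropp, (Rabs_right (/2)) by lra. specialize (HQ s k).
      assert (1 <= exp (1 * s)) by (pose proof (exp_ineq1_le (1 * s)); lra).
      pose proof (Rabs_pos (quad L (fun k => a k s) k)). nra. }
  clear B. apply Rle_trans with (1 := Hb).
  rewrite Ropp_involutive.
  assert (He1 : exp (sigma (kap L k ^ 2) * t) <= exp T).
  { destruct (Rle_lt_or_eq_dec (sigma (kap L k ^ 2) * t) T) as [Hlt|Heq]; [nra | left; now apply exp_increasing | rewrite Heq; lra]. }
  assert (He2 : exp (1 * t) <= exp T).
  { destruct (Rle_lt_or_eq_dec (1 * t) T) as [Hlt|Heq]; [lra | left; now apply exp_increasing | rewrite Heq; lra]. }
  unfold Rdiv. rewrite Rmult_plus_distr_r. apply Rplus_le_compat.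
  - specialize (H0 k). simpl in H0. pose proof (exp_pos (sigma (kap L k ^ 2) * t)).
    apply Rle_trans with (A0 / (1 + jidx k) ^ (S q + 3) * exp T).
    + apply Rmult_le_compat; auto using Rabs_pos. lra.
    + right. unfold Rdiv. ring.
  - pose proof (weight4 L k HL) as W.
    assert (Hd : / (- sigma (kap L k ^ 2) + 1) <= 16 * cw L ^ 4 * / (1 + jidx k) ^ 4).
    { assert (0 < (1 + jidx k) ^ 4) by (apply pow_lt; lra).
      apply Rmult_le_reg_r with ((- sigma (kap L k ^ 2) + 1) * (1 + jidx k) ^ 4). nra.
      replace (/ (- sigma (kap L k ^ 2) + 1) * ((- sigma (kap L k ^ 2) + 1) * (1 + jidx k) ^ 4)) with ((1 + jidx k) ^ 4) by (field; lra).
      replace (16 * cw L ^ 4 * / (1 + jidx k) ^ 4 * ((- sigma (kap L k ^ 2) + 1) * (1 + jidx k) ^ 4)) with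
        (16 * cw L ^ 4 * (1 - sigma (kap L k ^ 2))) by (field; lra). auto. }
    replace (S q + 3)%nat with (q + 4)%nat by lia. rewrite pow_add, Rinv_mult.
    assert (0 < / (- sigma (kap L k ^ 2) + 1)) by (apply Rinv_0_lt_compat; lra).
    assert (Hi : 0 < / (1 + jidx k) ^ q) by now apply Rinv_0_lt_compat.
    pose proof (exp_pos (1 * t)).
    apply Rle_trans with (C * / (1 + jidx k) ^ q * exp T * (16 * cw L ^ 4 * / (1 + jidx k) ^ 4)).
    + apply Rmult_le_compat; try lra. apply Rmult_le_pos; lra. apply Rmult_le_compat_l; lra.
    + right; ring.
Qed.

(** Three rounds lead from 4 through 7 and 10 to 13, beyond the twelve powers that the residual
    estimate consumes. Each round also needs the initial coefficients to have the new decay, hence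
    the condition on [m]. *)
Lemma ks_regularity m L T Phi0 Phi : 0 < L -> 0 < T -> (13 <= m)%nat ->
  in_Hsharp m L Phi0 -> KS_solution L T Phi0 Phi ->
  let a := fun k t => coef L (Phi (clamp T t)) k in
  ks_modes L T a /\ (exists A, forall t, decay 13 A (fun k => a k t)) /\
  (forall k, a k 0 = coef L Phi0 k) /\
  (forall t y, 0 <= t <= T -> Phi t y = syn L (fun k => a k t) y).
Proof.
  intros HL HT Hm HH HK a.
  destruct (KS_solution_modes L T Phi0 Phi HL HT HK) as [Hmodes [[A4 H4] [Hi Hs]]]. change (forall k, a k 0 = coef L Phi0 k) in Hi.
  change (ks_modes L T a) in Hmodes. change (forall t, decay 4 A4 (fun k => a k t)) in H4.
  destruct (Hsharp_decay 13 m L Phi0 HL Hm HH) as [A0 H0].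
  assert (H0' : decay 13 A0 (fun k => a k 0)) by (intro k; rewrite Hi; apply H0).
  assert (Hcl : forall p B, (forall t, 0 <= t <= T -> decay p B (fun k => a k t)) -> forall t, decay p B (fun k => a k t)).
  { intros p B HB t k. specialize (HB (clamp T t) (clamp_range T t ltac:(lra)) k).
    unfold a in *. rewrite (clamp_id T (clamp T t)) in HB by (apply clamp_range; lra). auto. }
  destruct (ks_bootstrap L T a 4 A4 A0 HL HT ltac:(lia) Hmodes H4) as [A7 H7]. { apply decay_le_exp with 13%nat; auto; lia. }
  destruct (ks_bootstrap L T a 7 A7 A0 HL HT ltac:(lia) Hmodes (Hcl _ _ H7)) as [A10 H10]. { apply decay_le_exp with 13%nat; auto; lia. }
  destruct (ks_bootstrap L T a 10 A10 A0 HL HT ltac:(lia) Hmodes (Hcl _ _ H10)) as [A13 H13]; auto.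
  split; auto. split; auto. exists A13. apply Hcl. exact H13.
Qed.

(** * The perturbed Fourier system *)

(** Banach's theorem for the norm given by the least [d] with [|x p| <= d * om p], carried out
    pointwise so that no normed space has to be built. [P] is a side condition closed under such
    limits, here continuity in time. The radius [2 D] is the sum of the steps [D / 2^n], and
    contraction is asked for on that ball only. *)
Lemma contraction_fixed_point (X : Type) (om : X -> R) (P : (X -> R) -> Prop)
  (G : (X -> R) -> X -> R) (x0 : X -> R) (D : R) :
  (forall p, 0 <= om p) -> 0 <= D -> P x0 ->
  (forall x, P x -> (forall p, Rabs (x p - x0 p) <= 2 * D * om p) -> P (G x)) ->
  (forall x y d, P x -> P y -> (forall p, Rabs (x p - x0 p) <= 2 * D * om p) ->
     (forall p, Rabs (y p - x0 p) <= 2 * D * om p) -> 0 <= d ->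
     (forall p, Rabs (x p - y p) <= d * om p) -> forall p, Rabs (G x p - G y p) <= d / 2 * om p) ->
  (forall p, Rabs (G x0 p - x0 p) <= D * om p) ->
  (forall (xn : nat -> X -> R) x, (forall n, P (xn n)) ->
     (forall n p, Rabs (x p - xn n p) <= 2 * D * (/ 2) ^ n * om p) -> P x) ->
  exists x, P x /\ (forall p, Rabs (x p - x0 p) <= 2 * D * om p) /\ forall p, G x p = x p.
Proof.
  intros Hom HD HP0 HPG Hc Hr Hcl.
  set (xn := fun n => Nat.iter n G x0).
  assert (Hh : forall n, 0 < (/2) ^ n <= 1).
  { intro n. split. apply pow_lt; lra. rewrite <- (pow1 n). apply pow_incr; lra. }
  assert (Hn : forall n, P (xn n) /\ (forall p, Rabs (xn n p - x0 p) <= 2 * D * (1 - (/2) ^ n) * om p) /\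
     (forall p, Rabs (xn (S n) p - xn n p) <= D * (/2) ^ n * om p)).
  { induction n as [|n [IP [IB IC]]].
    - split; [exact HP0|split].
      + intro p. simpl. rewrite !Rminus_diag, Rabs_R0. lra.
      + intro p. simpl. rewrite Rmult_1_r. apply Hr.
    - assert (Hball : forall p, Rabs (xn n p - x0 p) <= 2 * D * om p).
      { intro p. apply Rle_trans with (1 := IB p). apply Rmult_le_compat_r; auto. specialize (Hh n). nra. }
      assert (IP' : P (xn (S n))) by (apply (HPG (xn n)); auto).
      assert (IB' : forall p, Rabs (xn (S n) p - x0 p) <= 2 * D * (1 - (/2) ^ S n) * om p).
      { intro p. specialize (IB p). specialize (IC p).
        replace (xn (S n) p - x0 p) with ((xn (S n) p - xn n p) + (xn n p - x0 p)) by ring.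
        apply Rle_trans with (1 := Rabs_triang _ _). simpl pow. nra. }
      split; auto. split; auto.
      intro p. replace (D * (/2) ^ S n * om p) with (D * (/2) ^ n / 2 * om p) by (simpl; field).
      apply (Hc (xn (S n)) (xn n) (D * (/2) ^ n)); auto.
      + intro q. apply Rle_trans with (1 := IB' q). apply Rmult_le_compat_r; auto. specialize (Hh (S n)). nra.
      + apply Rmult_le_pos; auto. specialize (Hh n); lra. }
  assert (Hd : forall p n m, Rabs (xn (n + m)%nat p - xn n p) <= 2 * D * (/2) ^ n * om p * (1 - (/2) ^ m)).
  { intros p n m. induction m.
    - rewrite Nat.add_0_r. simpl. rewrite !Rminus_diag, Rabs_R0. lra.
    - replace (n + S m)%nat with (S (n + m)) by lia.
      replace (xn (S (n + m)) p - xn n p) with ((xn (S (n+m)) p - xn (n+m)%nat p) + (xn (n+m)%nat p - xn n p)) by ring.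
      apply Rle_trans with (1 := Rabs_triang _ _).
      destruct (Hn (n+m)%nat) as [_ [_ H2]]. specialize (H2 p). rewrite pow_add in H2. simpl pow. 
      apply Rle_trans with (D * ((/2) ^ n * (/2) ^ m) * om p + 2 * D * (/2) ^ n * om p * (1 - (/2) ^ m)).
      apply Rplus_le_compat; auto. right; field. }
  assert (Hd2 : forall p n m, Rabs (xn (n + m)%nat p - xn n p) <= 2 * D * (/2) ^ n * om p).
  { intros. apply Rle_trans with (1 := Hd p n m).
    assert (0 <= 2 * D * (/2) ^ n * om p). { specialize (Hh n). repeat apply Rmult_le_pos; auto; lra. }
    specialize (Hh m). nra. }
  assert (Hz : forall p e, 0 < e -> exists N, forall n, (N <= n)%nat -> 2 * D * (/2) ^ n * om p < e).
  { intros p e He. destruct (pow_lt_1_zero (/2) ltac:(rewrite Rabs_right; lra) (e / (2 * D * om p + 1))) as [N HN].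
    - apply Rdiv_lt_0_compat; auto. specialize (Hom p). nra.
    - exists N. intros n Hn1. specialize (HN n Hn1). specialize (Hh n). rewrite Rabs_right in HN by lra.
      assert (0 <= 2 * D * om p) by (specialize (Hom p); nra).
      apply Rmult_lt_compat_r with (r := 2 * D * om p + 1) in HN; [|lra].
      replace (e / (2 * D * om p + 1) * (2 * D * om p + 1)) with e in HN by (field; lra). nra. }
  assert (Hcauchy : forall p, Cauchy_crit (fun n => xn n p)).
  { intros p e He. destruct (Hz p (e/2) ltac:(lra)) as [N HN]. exists N. intros n m H1 H2. unfold R_dist.
    specialize (HN N (le_n N)).
    pose proof (Hd2 p N (n - N)%nat) as A1. pose proof (Hd2 p N (m - N)%nat) as A2.
    replace (N + (n - N))%nat with n in A1 by lia. replace (N + (m - N))%nat with m in A2 by lia.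
    replace (xn n p - xn m p) with ((xn n p - xn N p) - (xn m p - xn N p)) by ring.
    apply Rle_lt_trans with (1 := Rabs_triang _ _). rewrite Rabs_Ropp. lra. }
  set (x := fun p => proj1_sig (Rcomplete.R_complete _ (Hcauchy p))).
  assert (Hx : forall n p, Rabs (x p - xn n p) <= 2 * D * (/2) ^ n * om p).
  { intros n p. unfold x. destruct (Rcomplete.R_complete _ (Hcauchy p)) as [l Hl]. simpl.
    apply le_epsilon. intros e He. destruct (Hl e He) as [N HN]. specialize (HN (n + N)%nat ltac:(lia)).
    unfold R_dist in HN. rewrite Rabs_minus_sym in HN. specialize (Hd2 p n N).
    replace (l - xn n p) with ((l - xn (n+N)%nat p) + (xn (n+N)%nat p - xn n p)) by ring.
    apply Rle_trans with (1 := Rabs_triang _ _). lra. }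
  assert (HPx : P x) by (apply (Hcl xn); [intro n; apply (proj1 (Hn n)) | exact Hx]).
  assert (Hbx : forall p, Rabs (x p - x0 p) <= 2 * D * om p).
  { intro p. specialize (Hx O p). simpl in Hx. now rewrite Rmult_1_r in Hx. }
  exists x. split; auto. split; auto. intro p.
  assert (Hs : forall n, Rabs (G x p - x p) <= 2 * (2 * D * (/2) ^ n * om p)).
  { intro n. destruct (Hn n) as [IP [IB _]].
    assert (H1 : Rabs (G x p - G (xn n) p) <= 2 * D * (/2) ^ n / 2 * om p).
    { apply Hc; auto.
      - intro q. apply Rle_trans with (1 := IB q). apply Rmult_le_compat_r; auto. specialize (Hh n). nra.
      - specialize (Hh n). apply Rmult_le_pos; lra. }
    specialize (Hx (S n) p). change (xn (S n) p) with (G (xn n) p) in Hx. simpl pow in Hx.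
    replace (G x p - x p) with ((G x p - G (xn n) p) - (x p - G (xn n) p)) by ring.
    apply Rle_trans with (1 := Rabs_triang _ _). rewrite Rabs_Ropp.
    assert (0 <= D * (/2) ^ n * om p). { specialize (Hh n). repeat apply Rmult_le_pos; auto; lra. } lra. }
  destruct (Req_dec (G x p) (x p)) as [|Hne]; auto. exfalso.
  assert (0 < Rabs (G x p - x p)) by (apply Rabs_pos_lt; lra).
  destruct (Hz p (Rabs (G x p - x p) / 2) ltac:(lra)) as [N HN]. specialize (HN N (le_n N)). specialize (Hs N). lra.
Qed.

Lemma dsyn_cont2 L A (b : nat -> R -> R) : 0 < L -> (forall k, continuity (b k)) ->
  (forall t, decay 3 A (fun k => b k t)) ->
  forall t y, continuity_2d_pt (fun t y => dsyn L (fun k => b k t) y) t y.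
Proof.
  intros HL Hc HA. apply (series_cont2 (fun k t y => b k t * (sgn k * kap L k * w L (partner k) y)) (4 * (2 * PI / L * A) * wmax L)).
  - intros k t y. apply continuity_2d_pt_mult. apply (cont2_fst (b k)); auto.
    apply (cont2_snd (fun y => sgn k * kap L k * w L (partner k) y)), cont_scal, w_cont.
  - intros k t y. apply (dsyn_term_bound L A (fun k => b k t)); auto.
Qed.

Lemma syn_cont2 L A (b : nat -> R -> R) : 0 < L -> (forall k, continuity (b k)) ->
  (forall t, decay 2 A (fun k => b k t)) ->
  forall t y, continuity_2d_pt (fun t y => syn L (fun k => b k t) y) t y.
Proof.
  intros HL Hc HA. apply (series_cont2 (fun k t y => b k t * w L k y) (4 * A * wmax L)).
  - intros k t y. apply continuity_2d_pt_mult. apply (cont2_fst (b k)); auto.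
    apply (cont2_snd (w L k)), w_cont.
  - intros k t y. apply (syn_term_bound L 2 A (fun k => b k t)); auto.
Qed.

Lemma quad_time_cont L A (b : nat -> R -> R) k : 0 < L -> (forall k, continuity (b k)) ->
  (forall t, decay 3 A (fun k => b k t)) -> continuity (fun t => quad L (fun i => b i t) k).
Proof.
  intros HL Hc HA. apply (coef_time_cont L (fun t y => dsyn L (fun i => b i t) y ^ 2)); auto.
  intros t y. apply continuity_2d_pt_ext with (fun t y => dsyn L (fun i => b i t) y * dsyn L (fun i => b i t) y).
  - intros; ring.
  - apply continuity_2d_pt_mult; now apply (dsyn_cont2 L A).
Qed.

Lemma continuity_unif_lim (f : R -> R) (fn : nat -> R -> R) C :
  (forall n, continuity (fn n)) -> (forall n t, Rabs (f t - fn n t) <= C * (/2) ^ n) -> continuity f.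
Proof.
  intros Hc Hb t e He.
  assert (HC : 0 <= C). { specialize (Hb O 0). pose proof (Rabs_pos (f 0 - fn O 0)). simpl in Hb; lra. }
  destruct (pow_lt_1_zero (/2) ltac:(rewrite Rabs_right; lra) (e / (3 * (C + 1)))) as [N HN].
  { apply Rdiv_lt_0_compat; lra. }
  specialize (HN N (le_n N)). rewrite Rabs_right in HN by (apply Rle_ge, pow_le; lra).
  apply Rmult_lt_compat_l with (r := C + 1) in HN; [|lra].
  replace ((C + 1) * (e / (3 * (C + 1)))) with (e / 3) in HN by (field; lra).
  pose proof (pow_lt (/2) N ltac:(lra)).
  destruct (Hc N t (e/3) ltac:(lra)) as [d [Hd H2]]. exists d. split; auto. intros s Hs. specialize (H2 s Hs).
  simpl in *. unfold R_dist in *.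
  pose proof (Hb N s) as B1. pose proof (Hb N t) as B2.
  apply Rabs_le_between in B1. apply Rabs_le_between in B2. apply Rabs_lt_between in H2.
  apply Rabs_lt_between. lra.
Qed.

Ltac mul_nonneg := repeat match goal with |- 0 <= _ * _ => apply Rmult_le_pos end; try lra.

Definition perturbed_modes (eps L T : R) (b : nat -> R -> R) : Prop :=
  forall k t, 0 < t < T -> derivable_pt_lim (b k) t
    (- rate eps (kap L k ^ 2) * b k t
     + fs eps (kap L k ^ 2) / bs eps (kap L k ^ 2) * quad L (fun i => b i t) k).

(** Clamping the outer time keeps iterates continuous and bounded on the whole line, so the decay
    bounds can be stated for all times. *)
Definition picard (eps L T : R) (z : nat -> R) (b : nat -> R -> R) (k : nat) (t : R) : R :=
  duhamel (rate eps (kap L k ^ 2)) (z k)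
    (fun s => fs eps (kap L k ^ 2) / bs eps (kap L k ^ 2) * quad L (fun i => b i s) k) (clamp T t).

Lemma ode_diff_der nu z1 z2 h1 h2 t :
  derivable_pt_lim z1 t (- nu * z1 t + h1) -> derivable_pt_lim z2 t (- nu * z2 t + h2) ->
  derivable_pt_lim (fun s => z1 s - z2 s) t (- nu * (z1 t - z2 t) + (h1 - h2)).
Proof.
  intros H1 H2. replace (- nu * (z1 t - z2 t) + (h1 - h2)) with ((- nu * z1 t + h1) - (- nu * z2 t + h2)) by ring.
  now apply (derivable_pt_lim_minus z1 z2).
Qed.

(** Both iterates start from [z], so only the difference of the forcings enters Duhamel's formula.
    The quadratic term lowers the decay from 6 to 5; the last factor is the one that [gain_small]
    bounds by a small multiple of [1 / (1 + jidx k)], which restores the lost power. *)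
Lemma picard_contract eps L T M z b c B d k t : 0 < L -> 0 < T -> 0 <= eps <= 1 ->
  (forall k, continuity (b k)) -> (forall k, continuity (c k)) ->
  (forall t, decay 6 B (fun k => b k t)) -> (forall t, decay 6 B (fun k => c k t)) ->
  0 <= d -> (forall t, decay 6 (d * exp (M * clamp T t)) (fun k => b k t - c k t)) ->
  0 < rate eps (kap L k ^ 2) + M ->
  Rabs (picard eps L T z b k t - picard eps L T z c k t) <=
  (cprod L 5 * (2 * PI / L) ^ 2 * (2 * B)) * d * exp (M * clamp T t) / (1 + jidx k) ^ 5 *
    (5 * Xs eps (kap L k ^ 2) / (rate eps (kap L k ^ 2) + M)).
Proof.
  intros HL HT He Hb Hc HB HC Hd Hbc HM. unfold picard.
  set (mu := kap L k ^ 2) in *. assert (Hmu : 0 <= mu) by (unfold mu; apply pow2_ge_0).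
  set (s := clamp T t). assert (Hs : 0 <= s <= T) by (apply clamp_range; lra).
  set (hb := fun s => fs eps mu / bs eps mu * quad L (fun i => b i s) k).
  set (hc := fun s => fs eps mu / bs eps mu * quad L (fun i => c i s) k).
  assert (D3 : forall e : nat -> R -> R, (forall t, decay 6 B (fun k => e k t)) -> forall t, decay 3 B (fun k => e k t)).
  { intros e H u. apply decay_le_exp with 6%nat; auto; lia. }
  assert (Chb : continuity hb) by (apply cont_scal, (quad_time_cont L B); auto).
  assert (Chc : continuity hc) by (apply cont_scal, (quad_time_cont L B); auto).
  pose proof (decay_nonneg _ _ _ (HB 0)) as HB0.
  pose proof (cprod_pos L 5 HL) as HCp. pose proof (jidx_pos k) as Hj.
  assert (Hw : 0 < (1 + jidx k) ^ 5) by (apply pow_lt; lra).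
  assert (HX : 1 <= Xs eps mu) by (apply Xs_ge1; lra).
  set (K := cprod L 5 * (2 * PI / L) ^ 2 * (2 * B)).
  assert (HK : 0 <= K). { unfold K. pose proof (pow2_ge_0 (2 * PI / L)). mul_nonneg. }
  set (H := 5 * Xs eps mu * (K * d / (1 + jidx k) ^ 5)).
  assert (HH : 0 <= H).
  { unfold H. apply Rmult_le_pos; [lra|]. apply Rmult_le_pos; [nra|]. left; now apply Rinv_0_lt_compat. }
  pose proof (ode_bound T (rate eps mu) M H (fun s => duhamel (rate eps mu) (z k) hb s - duhamel (rate eps mu) (z k) hc s)
    (fun s => hb s - hc s) s) as O.
  cbv beta in O. rewrite !duhamel_0, Rminus_diag, Rabs_R0, Rmult_0_l, Rplus_0_l in O.
  eapply Rle_trans; [apply O; auto|].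
  - apply cont_minus; now apply duhamel_cont.
  - intros u Hu. apply ode_diff_der; now apply duhamel_der.
  - intros u Hu. unfold hb, hc. rewrite <- Rmult_minus_distr_l, Rabs_mult.
    specialize (Hbc u). rewrite clamp_id in Hbc by lra.
    pose proof (quad_diff_decay L 5 B B (d * exp (M * u)) (fun k => b k u) (fun k => c k u) HL ltac:(lia) (HB u) (HC u) Hbc k) as Q.
    simpl in Q. pose proof (fb_bound eps mu He Hmu) as F.
    replace (H * exp (M * u)) with (5 * Xs eps mu * (cprod L 5 * (2 * PI / L) ^ 2 * (d * exp (M * u)) * (B + B) / (1 + jidx k) ^ 5)).
    + apply Rmult_le_compat; auto using Rabs_pos.
    + unfold H, K. field. repeat split; lra.
  - right. unfold H. fold K. field. repeat split; lra.
Qed.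

(** The Kuramoto--Sivashinsky modes solve the perturbed system up to two errors, from [f/b] against
    [-1/2] and from [1/b] against 1. Both carry a factor [eps] and cost four and two powers of the
    wave number, the latter on top of the four of [sigma]. *)
Lemma picard_residual eps L T M a A k t : 0 < L -> 0 < T -> 0 <= eps <= 1 -> 0 <= M ->
  ks_modes L T a -> (forall k t, a k t = a k (clamp T t)) -> (forall t, decay 13 A (fun k => a k t)) ->
  1 <= rate eps (kap L k ^ 2) + M ->
  Rabs (picard eps L T (fun k => a k 0) a k t - a k t) <=
  eps * ((2 * PI / L) ^ 2 * (5 + 4 * (2 * PI / L) ^ 2) * (cprod L 12 * (2 * PI / L) ^ 2 * A * A)
   + 8 * (2 * PI / L) ^ 2 * ((2 * PI / L) ^ 2 + 4 * (2 * PI / L) ^ 4) * A) * exp (M * clamp T t) / (1 + jidx k) ^ 6.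
Proof.
  intros HL HT He HM0 [Hc Ho] Hcl HA HM. rewrite Hcl. unfold picard.
  set (mu := kap L k ^ 2) in *. assert (Hmu : 0 <= mu) by (unfold mu; apply pow2_ge_0).
  set (s := clamp T t). assert (Hs : 0 <= s <= T) by (apply clamp_range; lra).
  set (h := fun s => fs eps mu / bs eps mu * quad L (fun i => a i s) k).
  assert (Ch : continuity h). { apply cont_scal, (quad_time_cont L A); auto. intro; apply decay_le_exp with 13%nat; auto; lia. }
  pose proof (decay_nonneg _ _ _ (HA 0)) as HA0.
  pose proof (cprod_pos L 12 HL) as HCp. pose proof (jidx_pos k) as Hj.
  assert (Hw : 0 < 1 + jidx k) by lra.
  assert (HPL : 0 < 2 * PI / L) by (apply Rdiv_lt_0_compat; pose proof PI_RGT_0; lra).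
  set (K := (2 * PI / L) ^ 2) in *. assert (HK : 0 < K) by (unfold K; apply pow_lt; auto).
  replace ((2 * PI / L) ^ 4) with (K ^ 2) by (unfold K; ring).
  set (Q := cprod L 12 * K * A * A). assert (HQ : 0 <= Q) by (unfold Q; mul_nonneg).
  set (R1 := K * (5 + 4 * K) * Q + 8 * K * (K + 4 * K ^ 2) * A).
  assert (HR1 : 0 <= R1). { unfold R1. assert (0 <= K ^ 2) by apply pow2_ge_0. apply Rplus_le_le_0_compat; mul_nonneg. }
  assert (Hw6 : 0 < (1 + jidx k) ^ 6) by (apply pow_lt; lra).
  set (H := eps * R1 / (1 + jidx k) ^ 6).
  assert (HH : 0 <= H). { unfold H. apply Rmult_le_pos; [nra|]. left; now apply Rinv_0_lt_compat. }
  (* The Kuramoto--Sivashinsky equation is rewritten with the perturbed linear part; [g] is the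
     forcing left for the difference, namely [(f/b + 1/2) quad - sigma (1 - 1/b) a]. *)
  set (g := fun s => h s - (- (/ 2) * quad L (fun i => a i s) k + sigma mu * (1 - / bs eps mu) * a k s)).
  destruct (bs_bounds eps mu He Hmu) as [Hbs _].
  pose proof (ode_bound T (rate eps mu) M H (fun s => duhamel (rate eps mu) (a k 0) h s - a k s) g s) as O.
  cbv beta in O. rewrite !duhamel_0, Rminus_diag, Rabs_R0, Rmult_0_l, Rplus_0_l in O.
  eapply Rle_trans; [apply O; auto|].
  - apply cont_minus; auto. now apply duhamel_cont.
  - lra.
  - intros u Hu. unfold g. apply ode_diff_der. now apply duhamel_der.
    replace (- rate eps mu * a k u + (- (/ 2) * quad L (fun i => a i u) k + sigma mu * (1 - / bs eps mu) * a k u)) with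
      (sigma mu * a k u - / 2 * quad L (fun k => a k u) k) by (unfold rate; field; lra).
    unfold mu. now apply Ho.
  - intros u Hu. apply Rle_trans with H.
    2:{ assert (1 <= exp (M * u)) by (assert (0 <= M * u) by nra; pose proof (exp_ineq1_le (M * u)); lra). nra. }
    replace (g u) with ((fs eps mu / bs eps mu + / 2) * quad L (fun i => a i u) k + - (sigma mu * (1 - / bs eps mu) * a k u)) by (unfold g, h; ring).
    apply Rle_trans with (1 := Rabs_triang _ _). rewrite Rabs_Ropp, !Rabs_mult.
    pose proof (fb_half eps mu He Hmu) as F. pose proof (inv_bs_diff eps mu He Hmu) as I.
    pose proof (quad_decay L 12 A (fun k => a k u) HL ltac:(lia) (HA u) k) as Qd. fold K in Qd. fold Q in Qd.
    pose proof (HA u k) as Ad. cbv beta in Ad.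
    set (x := 1 + jidx k) in *. assert (Hx : 1 <= x) by (unfold x; lra).
    assert (Hmx : mu <= K * x ^ 2) by (apply kap_weight; auto).
    assert (Hx2 : 1 <= x ^ 2) by (apply pow_ge1; auto).
    assert (F2 : mu * (5 + 4 * mu) <= K * (5 + 4 * K) * x ^ 4).
    { apply Rle_trans with (K * x ^ 2 * (5 + 4 * (K * x ^ 2))).
      - apply Rmult_le_compat; nra.
      - replace (K * (5 + 4 * K) * x ^ 4) with (K * x ^ 2 * (5 * x ^ 2 + 4 * (K * x ^ 2))) by ring.
        apply Rmult_le_compat_l; nra. }
    assert (S2 : Rabs (sigma mu) <= (K + 4 * K ^ 2) * x ^ 4) by apply (symbol_growth eps L k HL He).
    assert (I2 : Rabs (1 - / bs eps mu) <= eps * (8 * K * x ^ 2)).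
    { rewrite Rabs_right by lra. destruct I as [_ I]. apply Rle_trans with (1 := I). nra. }
    assert (Hxi : forall n, (6 <= n)%nat -> / x ^ n <= / x ^ 6) by (intros; apply inv_pow_mono; auto).
    assert (Hxp : forall n, 0 < x ^ n) by (intro; apply pow_lt; lra).
    replace H with (eps * (K * (5 + 4 * K)) * (Q * / x ^ 6) + (8 * K * (K + 4 * K ^ 2) * eps) * (A * / x ^ 6))
      by (unfold H, R1; field; pose proof (Hxp 6%nat); lra).
    apply Rplus_le_compat.
    + apply Rle_trans with (eps * (K * (5 + 4 * K) * x ^ 4) * (Q / x ^ 12)).
      * apply Rmult_le_compat; auto using Rabs_pos. apply Rle_trans with (1 := F). apply Rmult_le_compat_l; lra.
      * replace (eps * (K * (5 + 4 * K) * x ^ 4) * (Q / x ^ 12)) with (eps * (K * (5 + 4 * K)) * (Q * / x ^ 8))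
         by (field; lra).
        apply Rmult_le_compat_l. mul_nonneg. apply Rmult_le_compat_l; [auto | apply Hxi; lia].
    (* Six powers are lost here from decay 13, leaving 7; the other error leaves [12 - 4 = 8]. Both
       suffice for the target 6. *)
    + apply Rle_trans with ((K + 4 * K ^ 2) * x ^ 4 * (eps * (8 * K * x ^ 2)) * (A / x ^ 13)).
      * apply Rmult_le_compat; auto using Rabs_pos. apply Rmult_le_pos; apply Rabs_pos. apply Rmult_le_compat; auto using Rabs_pos.
      * replace ((K + 4 * K ^ 2) * x ^ 4 * (eps * (8 * K * x ^ 2)) * (A / x ^ 13)) with ((8 * K * (K + 4 * K ^ 2) * eps) * (A * / x ^ 7))
         by (field; lra).
        pose proof (pow2_ge_0 K).
        apply Rmult_le_compat_l. mul_nonneg. apply Rmult_le_compat_l; [auto | apply Hxi; lia].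
  - pose proof (exp_pos (M * s)).
    replace (eps * R1 * exp (M * s) / (1 + jidx k) ^ 6) with (H * exp (M * s) * 1) by (unfold H; field; lra).
    unfold Rdiv. apply Rmult_le_compat_l. nra. rewrite <- Rinv_1. apply Rinv_le_contravar; lra.
Qed.

Lemma exp_le x y : x <= y -> exp x <= exp y.
Proof. intros [H | ->]; [left; now apply exp_increasing | lra]. Qed.

Lemma perturbed_exists L T a A : 0 < L -> 0 < T -> ks_modes L T a ->
  (forall k t, a k t = a k (clamp T t)) -> (forall t, decay 13 A (fun k => a k t)) ->
  exists C eps1, 0 < C /\ 0 < eps1 < 1 /\ forall eps, 0 < eps <= eps1 ->
  exists b : nat -> R -> R, (forall k, continuity (b k)) /\
    (forall t, decay 6 (A + 1) (fun k => b k t)) /\ (forall k, b k 0 = a k 0) /\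
    perturbed_modes eps L T b /\ (forall t, decay 6 (C * eps) (fun k => b k t - a k t)).
Proof.
  intros HL HT Hks Hcl HA.
  pose proof (decay_nonneg _ _ _ (HA 0)) as HA0. pose proof (cw_pos L HL) as Hcw.
  assert (HPL : 0 < 2 * PI / L) by (apply Rdiv_lt_0_compat; pose proof PI_RGT_0; lra).
  (* Lipschitz constant of the quadratic term from decay 6 to decay 5 on the ball, where every
     sequence has constant at most [A + 1]. *)
  set (Cq := cprod L 5 * (2 * PI / L) ^ 2 * (2 * (A + 1))).
  assert (HCq : 0 < Cq).
  { unfold Cq. pose proof (cprod_pos L 5 HL). pose proof (pow_lt _ 2 HPL).
    apply Rmult_lt_0_compat; [apply Rmult_lt_0_compat|]; lra. }
  (* Chosen so that [Cq * theta * cw L] is exactly the contraction factor one half. *)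
  set (theta := / (2 * cw L * Cq)).
  assert (Hth : 0 < theta) by (apply Rinv_0_lt_compat; apply Rmult_lt_0_compat; lra).
  destruct (gain_small theta Hth) as [M [eps1 [HM [He1 Hgain]]]].
  set (R0 := (2 * PI / L) ^ 2 * (5 + 4 * (2 * PI / L) ^ 2) * (cprod L 12 * (2 * PI / L) ^ 2 * A * A)
   + 8 * (2 * PI / L) ^ 2 * ((2 * PI / L) ^ 2 + 4 * (2 * PI / L) ^ 4) * A).
  assert (HR0 : 0 <= R0).
  { unfold R0. pose proof (pow_lt _ 2 HPL). pose proof (pow_lt _ 4 HPL). pose proof (cprod_pos L 12 HL).
    apply Rplus_le_le_0_compat; mul_nonneg. }
  pose proof (exp_pos (M * T)) as HeM.
  (* The ball has radius [2 eps R0] in the weighted norm, hence at most [C eps] without the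
     exponential weight. Requiring [eps <= 1 / C] keeps it within distance one of [a], which
     justifies the constant [A + 1]. *)
  set (C := 2 * R0 * exp (M * T) + 1). assert (HC : 1 <= C) by (unfold C; nra).
  exists C, (Rmin eps1 (/ C)). split; [lra|]. 
  assert (HCi : 0 < / C) by (apply Rinv_0_lt_compat; lra).
  split. { pose proof (Rmin_l eps1 (/ C)). split; [apply Rmin_pos; lra | lra]. }
  intros eps Heps. pose proof (Rmin_l eps1 (/ C)). pose proof (Rmin_r eps1 (/ C)).
  assert (HCe : C * eps <= 1).
  { apply Rle_trans with (C * / C). apply Rmult_le_compat_l; lra. rewrite Rinv_r; lra. }
  set (D := eps * R0). assert (HD : 0 <= D) by (unfold D; nra).
  assert (HDC : 2 * D * exp (M * T) <= C * eps) by (unfold D, C; nra).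
  set (om := fun p : nat * R => exp (M * clamp T (snd p)) / (1 + jidx (fst p)) ^ 6).
  assert (Hw : forall k n, 0 < (1 + jidx k) ^ n) by (intros; apply pow_lt; pose proof (jidx_pos k); lra).
  assert (Hom : forall p, 0 <= om p).
  { intros [k t]. unfold om. left. apply Rdiv_lt_0_compat; [apply exp_pos | apply Hw]. }
  assert (Hexp : forall t, 0 < exp (M * clamp T t) <= exp (M * T)).
  { intro t. split; [apply exp_pos|]. apply exp_le. pose proof (clamp_range T t ltac:(lra)). nra. }
  set (x0 := fun p : nat * R => a (fst p) (snd p)).
  set (P := fun x : nat * R -> R => forall k, continuity (fun t => x (k, t))).
  set (G := fun (x : nat * R -> R) (p : nat * R) => picard eps L T (fun k => a k 0) (fun k t => x (k, t)) (fst p) (snd p)).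
  assert (Hball : forall x, (forall p, Rabs (x p - x0 p) <= 2 * D * om p) ->
     (forall t, decay 6 (C * eps) (fun k => x (k, t) - a k t)) /\ (forall t, decay 6 (A + 1) (fun k => x (k, t)))).
  { intros x Hx. assert (H1 : forall t, decay 6 (C * eps) (fun k => x (k, t) - a k t)).
    { intros t k. specialize (Hx (k, t)). unfold om, x0 in Hx. simpl fst in Hx. simpl snd in Hx.
      apply Rle_trans with (1 := Hx).
      replace (2 * D * (exp (M * clamp T t) / (1 + jidx k) ^ 6)) with ((2 * D * exp (M * clamp T t)) / (1 + jidx k) ^ 6) by (unfold Rdiv; ring).
      apply Rmult_le_compat_r. left; apply Rinv_0_lt_compat, Hw. specialize (Hexp t). nra. }
    split; auto. intros t. apply decay_le with (A + C * eps); [lra|].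
    assert (HA6 : decay 6 A (fun k => a k t)) by (apply decay_le_exp with 13%nat; auto; lia).
    intro k. specialize (H1 t k). specialize (HA6 k). simpl in H1, HA6.
    replace (x (k, t)) with (a k t + (x (k, t) - a k t)) by ring.
    apply Rle_trans with (1 := Rabs_triang _ _). unfold Rdiv in *. simpl. lra. }
  assert (Hrate : forall k, 1 <= rate eps (kap L k ^ 2) + M /\
     5 * Xs eps (kap L k ^ 2) / (rate eps (kap L k ^ 2) + M) <= theta * cw L / (1 + jidx k)).
  { intro k. pose proof (kap_pos L k HL) as Hk. destruct (Hgain eps (kap L k) ltac:(lra) Hk) as [G1 G2].
    split; auto. pose proof (weight_kap L k HL) as W. pose proof (jidx_pos k).
    pose proof (Xs_ge1 eps (kap L k ^ 2) ltac:(lra) (pow2_ge_0 _)).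
    apply Rmult_le_reg_r with ((rate eps (kap L k ^ 2) + M) * (1 + jidx k)). nra.
    replace (5 * Xs eps (kap L k ^ 2) / (rate eps (kap L k ^ 2) + M) * ((rate eps (kap L k ^ 2) + M) * (1 + jidx k)))
      with (5 * Xs eps (kap L k ^ 2) * (1 + jidx k)) by (field; lra).
    replace (theta * cw L / (1 + jidx k) * ((rate eps (kap L k ^ 2) + M) * (1 + jidx k)))
      with (cw L * (theta * (rate eps (kap L k ^ 2) + M))) by (field; lra).
    apply Rle_trans with (5 * Xs eps (kap L k ^ 2) * (cw L * (1 + kap L k))).
    apply Rmult_le_compat_l; lra. nra. }
  assert (D3 : forall e : nat -> R -> R, (forall t, decay 6 (A + 1) (fun k => e k t)) -> forall t, decay 3 (A + 1) (fun k => e k t)).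
  { intros e He u. apply decay_le_exp with 6%nat; auto; lia. }
  assert (HPG : forall x, P x -> (forall p, Rabs (x p - x0 p) <= 2 * D * om p) -> P (G x)).
  { intros x Px Bx k. unfold G, picard. simpl fst. simpl snd.
    apply (continuity_comp (clamp T)). apply clamp_cont. apply duhamel_cont, cont_scal.
    apply (quad_time_cont L (A + 1) (fun i s => x (i, s))); auto. apply D3. now apply Hball. }
  destruct (contraction_fixed_point (nat * R) om P G x0 D) as [x [Px [Bx Fx]]]; auto.
  - intro k. unfold x0. simpl. destruct Hks; auto.
  - intros x y d Px Py Bx By Hd Hxy [k t]. unfold G. simpl fst. simpl snd.
    destruct (Hrate k) as [R1 R2].
    eapply Rle_trans. apply (picard_contract eps L T M _ _ _ (A + 1) d k t); auto; try lra.
    + now apply Hball.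
    + now apply Hball.
    + intros u i. specialize (Hxy (i, u)). unfold om in Hxy. simpl in Hxy. simpl. unfold Rdiv in *. lra.
    + fold Cq. unfold om. simpl fst. simpl snd.
      specialize (Hexp t). pose proof (Hw k 5%nat). pose proof (Hw k 6%nat). pose proof (jidx_pos k).
      apply Rle_trans with (Cq * d * exp (M * clamp T t) / (1 + jidx k) ^ 5 * (theta * cw L / (1 + jidx k))).
      * apply Rmult_le_compat_l; auto. apply Rmult_le_pos. mul_nonneg. left; now apply Rinv_0_lt_compat.
      * right. unfold theta. field. repeat split; lra.
  - intros [k t]. unfold G, x0. simpl fst. simpl snd. destruct (Hrate k) as [R1 _].
    eapply Rle_trans. apply (picard_residual eps L T M a A k t); auto; lra.
    fold R0. unfold D, om. simpl fst. simpl snd. right. unfold Rdiv; ring.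
  - intros xn x HPn Hx k. apply (continuity_unif_lim _ (fun n t => xn n (k, t)) (2 * D * exp (M * T))).
    + intro n. apply HPn.
    + intros n t. apply Rle_trans with (1 := Hx n (k, t)). unfold om. simpl fst. simpl snd.
      specialize (Hexp t). pose proof (pow_lt (/2) n ltac:(lra)).
      assert (exp (M * clamp T t) / (1 + jidx k) ^ 6 <= exp (M * T) * 1).
      { apply Rmult_le_compat; try lra. left; apply Rinv_0_lt_compat, Hw.
        rewrite <- Rinv_1. apply Rinv_le_contravar; [lra|]. apply pow_ge1. pose proof (jidx_pos k); lra. }
      replace (2 * D * exp (M * T) * (/2) ^ n) with (2 * D * (/2) ^ n * (exp (M * T) * 1)) by ring.
      apply Rmult_le_compat_l; auto. apply Rmult_le_pos; lra.
  - destruct (Hball x Bx) as [B1 B2].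
    exists (fun k t => x (k, t)). split; auto. split; auto. split; [|split]; auto.
    + intro k. rewrite <- Fx. unfold G, picard. simpl. rewrite clamp_id by lra. apply duhamel_0.
    + intros k t Ht. set (h := fun s => fs eps (kap L k ^ 2) / bs eps (kap L k ^ 2) * quad L (fun i => x (i, s)) k).
      assert (Hh : continuity h) by (apply cont_scal, (quad_time_cont L (A + 1) (fun i s => x (i, s))); [auto | exact Px | apply (D3 (fun i s => x (i, s))); exact B2]).
      apply is_derive_Reals. apply (is_derive_ext (fun s => duhamel (rate eps (kap L k ^ 2)) (a k 0) h (clamp T s))).
      { intro s. exact (Fx (k, s)). }
      apply is_derive_Reals. apply deriv_clamp; auto.
      replace (x (k, t)) with (duhamel (rate eps (kap L k ^ 2)) (a k 0) h t).
      * exact (duhamel_der _ _ h t Hh).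
      * rewrite <- (Fx (k, t)). unfold G, picard. simpl. rewrite clamp_id by lra. reflexivity.
Qed.

(** * Classical solutions *)

(* [classical_sol] for arbitrary symbols; the rescaled problem has the symbols of [scaled_csol]. *)
Definition csol (L T : R) (b s f : nat -> R) (phi : R -> R -> R) : Prop :=
  exists py U V : R -> R -> R,
    (forall t y, 0 <= t <= T -> phi t (y + L) = phi t y) /\
    cont2_on 0 T phi /\ cont2_on 0 T py /\ cont2_on 0 T U /\ cont2_on 0 T V /\
    (forall t y, 0 <= t <= T -> derivable_pt_lim (fun z => phi t z) y (py t y)) /\
    (forall t, 0 <= t <= T -> op_image L b (phi t) (U t)) /\
    (forall t, 0 <= t <= T -> exists Sp Fq : R -> R,
       op_image L s (phi t) Sp /\
       op_image L f (fun y => (py t y) ^ 2) Fq /\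
       forall y, V t y = Sp y + Fq y) /\
    (forall t y, 0 < t < T -> derivable_pt_lim (fun s => U s y) t (V t y)).

Lemma decay_mul n r C A c a : 0 <= C -> (forall k, Rabs (c k) <= C * (1 + jidx k) ^ n) ->
  decay (n + r) A a -> decay r (C * A) (fun k => c k * a k).
Proof.
  intros HC Hc Ha k. rewrite Rabs_mult. specialize (Hc k). specialize (Ha k). pose proof (jidx_pos k).
  pose proof (pow_lt (1 + jidx k) n ltac:(lra)). pose proof (pow_lt (1 + jidx k) r ltac:(lra)).
  apply Rle_trans with (C * (1 + jidx k) ^ n * (A / (1 + jidx k) ^ (n + r))).
  - apply Rmult_le_compat; auto using Rabs_pos.
  - right. rewrite pow_add. field. split; lra.
Qed.

Lemma op_image_coef L c g h k : op_image L c g h -> coef L h k = c k * coef L g k.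
Proof.
  intros [_ [_ H]]. destruct (H k) as [a [H1 H2]].
  apply is_coef_coef in H1. apply is_coef_coef in H2. now rewrite H2, H1.
Qed.

Lemma op_image_intro L c g h : continuity g -> continuity h -> periodic L h ->
  (forall k, coef L h k = c k * coef L g k) -> op_image L c g h.
Proof.
  intros Hg Hh Hp H. split; [auto|split; [auto|]]. intro k. exists (coef L g k).
  rewrite <- H. split; now apply coef_is_coef.
Qed.

Lemma op_image_syn L r A c a g : 0 < L -> (2 <= r)%nat -> continuity g -> (forall k, coef L g k = a k) ->
  decay r A (fun k => c k * a k) -> op_image L c g (syn L (fun k => c k * a k)).
Proof.
  intros HL Hr Hg Ha HA. apply op_image_intro; auto.
  - eapply syn_cont; eauto.
  - now apply syn_per.
  - intro k. rewrite Ha. eapply (coef_syn L r A (fun k => c k * a k)); eauto.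
Qed.

(** Decay 6 is what the forcing needs: the quadratic term has decay 5, and the third-order symbol
    [f] leaves 2, enough for a uniformly convergent series. The time derivative of [U] is then taken
    term by term. *)
Lemma csol_of_modes eps L T B (b : nat -> R -> R) : 0 < L -> 0 < T -> 0 < eps <= 1 ->
  (forall k, continuity (b k)) -> (forall t, decay 6 B (fun k => b k t)) -> perturbed_modes eps L T b ->
  csol L T (fun k => bs eps (kap L k ^ 2)) (fun k => sigma (kap L k ^ 2)) (fun k => fs eps (kap L k ^ 2))
    (fun t y => syn L (fun k => b k t) y).
Proof.
  intros HL HT He Hc HB Hode.
  set (K := (2 * PI / L) ^ 2). assert (HK : 0 <= K) by (unfold K; apply pow2_ge_0).
  assert (HK2 : 0 <= K ^ 2) by apply pow2_ge_0.
  assert (He' : 0 <= eps <= 1) by lra.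
  assert (Hsym := fun k => symbol_growth eps L k HL He'). fold K in Hsym. cbv zeta in Hsym.
  assert (D3 : forall t, decay 3 B (fun k => b k t)) by (intro; apply decay_le_exp with 6%nat; auto; lia).
  assert (D2 : forall t, decay 2 B (fun k => b k t)) by (intro; apply decay_le_exp with 6%nat; auto; lia).
  assert (DU : forall t, decay 4 (3 * (1 + 4 * K) * B) (fun k => bs eps (kap L k ^ 2) * b k t)).
  { intro t. apply (decay_mul 2 4 _ B _ (fun k => b k t)); auto. lra. intro k; apply Hsym. }
  assert (DS : forall t, decay 2 ((K + 4 * K ^ 2) * B) (fun k => sigma (kap L k ^ 2) * b k t)).
  { intro t. apply (decay_mul 4 2 _ B _ (fun k => b k t)); auto. lra. intro k; apply Hsym. }
  set (Q := cprod L 5 * (2 * PI / L) ^ 2 * B * B).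
  assert (DF : forall t, decay 2 (15 * (1 + 4 * K) ^ 2 * Q) (fun k => fs eps (kap L k ^ 2) * quad L (fun i => b i t) k)).
  { intro t. apply (decay_mul 3 2 _ Q _ (quad L (fun i => b i t))).
    - pose proof (pow2_ge_0 (1 + 4 * K)). lra.
    - intro k; apply Hsym.
    - apply (quad_decay L 5); auto; lia. }
  assert (CQ : forall k, continuity (fun t => quad L (fun i => b i t) k)) by (intro; apply (quad_time_cont L B); auto).
  assert (Cs : forall t, continuity (syn L (fun k => b k t))) by (intro; apply (syn_cont L 2 B); auto).
  assert (Cd : forall t, continuity (dsyn L (fun k => b k t))) by (intro; apply (dsyn_cont L B); auto).
  assert (Es : forall t k, coef L (syn L (fun k => b k t)) k = b k t).
  { intros t k. apply (coef_syn L 2 B (fun k => b k t)); auto. }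
  set (Sp := fun t y => syn L (fun k => sigma (kap L k ^ 2) * b k t) y).
  set (Fq := fun t y => syn L (fun k => fs eps (kap L k ^ 2) * quad L (fun i => b i t) k) y).
  exists (fun t y => dsyn L (fun k => b k t) y),
    (fun t y => syn L (fun k => bs eps (kap L k ^ 2) * b k t) y), (fun t y => Sp t y + Fq t y).
  split; [|split; [|split; [|split; [|split; [|split; [|split; [|split]]]]]]].
  - intros t y _. now apply syn_per.
  - apply cont2_on_of. now apply (syn_cont2 L B).
  - apply cont2_on_of. now apply (dsyn_cont2 L B).
  - apply cont2_on_of. apply (syn_cont2 L (3 * (1 + 4 * K) * B) (fun k t => bs eps (kap L k ^ 2) * b k t)); auto.
    + intro; now apply cont_scal.
    + intro t. apply decay_le_exp with 4%nat; auto.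
  - apply cont2_on_of. intros t y. apply continuity_2d_pt_plus.
    + apply (syn_cont2 L ((K + 4 * K ^ 2) * B) (fun k t => sigma (kap L k ^ 2) * b k t)); auto. intro; now apply cont_scal.
    + apply (syn_cont2 L (15 * (1 + 4 * K) ^ 2 * Q) (fun k t => fs eps (kap L k ^ 2) * quad L (fun i => b i t) k)); auto.
      intro; apply cont_scal, CQ.
  - intros t y _. now apply (syn_der L B).
  - intros t _. apply (op_image_syn L 4 (3 * (1 + 4 * K) * B) (fun k => bs eps (kap L k ^ 2)) (fun k => b k t)); auto; lia.
  - intros t _. exists (Sp t), (Fq t). split; [|split]; auto.
    + apply (op_image_syn L 2 ((K + 4 * K ^ 2) * B) (fun k => sigma (kap L k ^ 2)) (fun k => b k t)); auto.
    + apply (op_image_syn L 2 (15 * (1 + 4 * K) ^ 2 * Q) (fun k => fs eps (kap L k ^ 2)) (quad L (fun i => b i t))); auto.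
      now apply cont_sq.
  - intros t y Ht.
    assert (Hr : 0 < Rmin t (T - t)) by (apply Rmin_pos; lra).
    assert (EV : Sp t y + Fq t y = Series (fun k => (sigma (kap L k ^ 2) * b k t + fs eps (kap L k ^ 2) * quad L (fun i => b i t) k) * w L k y)).
    { unfold Sp, Fq, syn. rewrite <- Series_plus.
      - apply Series_ext. intro k. ring.
      - eapply ex_series_tel. intro k. apply (syn_term_bound L 2 ((K + 4 * K ^ 2) * B) (fun k => sigma (kap L k ^ 2) * b k t)); auto.
      - eapply ex_series_tel. intro k. apply (syn_term_bound L 2 (15 * (1 + 4 * K) ^ 2 * Q) (fun k => fs eps (kap L k ^ 2) * quad L (fun i => b i t) k)); auto. }
    rewrite EV. unfold syn.
    apply (series_der (fun k s => bs eps (kap L k ^ 2) * b k s * w L k y)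
      (fun k s => (sigma (kap L k ^ 2) * b k s + fs eps (kap L k ^ 2) * quad L (fun i => b i s) k) * w L k y)
      (4 * (3 * (1 + 4 * K) * B) * wmax L)
      (4 * ((K + 4 * K ^ 2) * B + 15 * (1 + 4 * K) ^ 2 * Q) * wmax L) t (Rmin t (T - t))); auto.
    + now rewrite Rminus_diag, Rabs_R0.
    + intros k s Hs. pose proof (Rmin_l t (T - t)). pose proof (Rmin_r t (T - t)). apply Rabs_lt_between in Hs.
      assert (Hs' : 0 < s < T) by lra. specialize (Hode k s Hs').
      destruct (bs_bounds eps (kap L k ^ 2) He' (pow2_ge_0 _)) as [Hb1 _].
      replace ((sigma (kap L k ^ 2) * b k s + fs eps (kap L k ^ 2) * quad L (fun i => b i s) k) * w L k y) with
       (bs eps (kap L k ^ 2) * w L k y * (- rate eps (kap L k ^ 2) * b k s + fs eps (kap L k ^ 2) / bs eps (kap L k ^ 2) * quad L (fun i => b i s) k))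
       by (unfold rate; field; lra).
      assert (E : forall s, bs eps (kap L k ^ 2) * w L k y * b k s = bs eps (kap L k ^ 2) * b k s * w L k y) by (intro; ring).
      apply is_derive_Reals. apply (is_derive_ext _ _ _ _ E).
      apply is_derive_Reals. apply (derivable_pt_lim_scal (b k)); auto.
    + intro k. apply continuity_ext with (fun s => w L k y * (sigma (kap L k ^ 2) * b k s + fs eps (kap L k ^ 2) * quad L (fun i => b i s) k)).
      intro; ring. apply cont_scal, cont_plus. now apply cont_scal. apply cont_scal, CQ.
    + intros k s. apply (syn_term_bound L 4 (3 * (1 + 4 * K) * B) (fun k => bs eps (kap L k ^ 2) * b k s)); auto.
    + intros k s. apply (syn_term_bound L 2 _ (fun k => sigma (kap L k ^ 2) * b k s + fs eps (kap L k ^ 2) * quad L (fun i => b i s) k)); auto.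
      apply (decay_plus 2 _ _ (fun k => sigma (kap L k ^ 2) * b k s) (fun k => fs eps (kap L k ^ 2) * quad L (fun i => b i s) k)); auto.
Qed.

(** * Uniqueness *)

(** What an arbitrary classical solution provides. Continuity of [U] bounds [b] times the
    coefficients uniformly in time, while the image under [sigma] gives decay 4 only at each
    separate time. The mode equation comes from differentiating the coefficients of [U] and dividing
    by [b >= 1]. *)
Lemma csol_modes eps L T phi : 0 < L -> 0 < T -> 0 < eps <= 1 ->
  csol L T (fun k => bs eps (kap L k ^ 2)) (fun k => sigma (kap L k ^ 2)) (fun k => fs eps (kap L k ^ 2)) phi ->
  exists py, (forall t y, 0 <= t <= T -> derivable_pt_lim (phi t) y (py t y)) /\ cont2_on 0 T py /\
   cont2_on 0 T phi /\ (forall t, 0 <= t <= T -> periodic L (phi t)) /\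
   (forall k, continuity (fun t => coef L (phi (clamp T t)) k)) /\
   (exists C, forall t k, 0 <= t <= T -> bs eps (kap L k ^ 2) * Rabs (coef L (phi t) k) <= C) /\
   (forall t, 0 <= t <= T -> exists A, decay 4 A (coef L (phi t))) /\
   (forall t k, 0 < t < T -> derivable_pt_lim (fun t => coef L (phi (clamp T t)) k) t
      (- rate eps (kap L k ^ 2) * coef L (phi (clamp T t)) k +
        fs eps (kap L k ^ 2) / bs eps (kap L k ^ 2) * coef L (fun y => py t y ^ 2) k)).
Proof.
  intros HL HT He [py [U [V [Hper [C0 [C1 [CU [CV [Hd [HU [HV HUt]]]]]]]]]]].
  assert (HT0 : 0 <= T) by lra. assert (He' : 0 <= eps <= 1) by lra.
  assert (Hbs : forall k, 1 <= bs eps (kap L k ^ 2)).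
  { intro k. apply (bs_bounds eps _ He' (pow2_ge_0 _)). }
  assert (S0 : forall t, 0 <= t <= T -> continuity (phi t)) by (intros; eapply cont2_on_section; eauto).
  assert (S1 : forall t, 0 <= t <= T -> continuity (py t)) by (intros; eapply cont2_on_section; eauto).
  assert (SU : forall t, 0 <= t <= T -> continuity (U t)) by (intros; eapply cont2_on_section; eauto).
  assert (EU : forall t k, 0 <= t <= T -> coef L (U t) k = bs eps (kap L k ^ 2) * coef L (phi t) k).
  { intros t k Ht. apply (op_image_coef L (fun k => bs eps (kap L k ^ 2))); auto. }
  destruct (strip_bound (fun t y => U (clamp T t) y) T L HT0 HL (cont2_clamp T U HT0 CU)) as [MU [HMU BU]].
  assert (HC : forall t k, 0 <= t <= T -> bs eps (kap L k ^ 2) * Rabs (coef L (phi t) k) <= L * MU * wmax L).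
  { intros t k Ht. specialize (Hbs k). replace (bs eps (kap L k ^ 2)) with (Rabs (bs eps (kap L k ^ 2))) by (apply Rabs_right; lra).
    rewrite <- Rabs_mult, <- EU by auto. apply coef_bound; auto.
    intros y Hy. specialize (BU t y Ht Hy). simpl in BU. now rewrite clamp_id in BU. }
  exists py. split; [exact Hd|]. split; auto. split; auto. split. { intros t Ht y; auto. }
  split; [|split; [|split]].
  - intro k. apply (coef_time_cont L (fun t y => phi (clamp T t) y)); auto. now apply cont2_clamp.
  - eexists; eauto.
  - intros t Ht. destruct (HV t Ht) as [Sp [Fq [HS [HF _]]]].
    destruct (interval_bound Sp (-(L/2)) (L/2) ltac:(lra)) as [MS [HMS BS]]. { apply HS. }
    eexists. apply (decay4_of_sigma L _ (L * MU * wmax L) (L * MS * wmax L)); auto; intro k.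
    + specialize (HC t k Ht). specialize (Hbs k). pose proof (Rabs_pos (coef L (phi t) k)). nra.
    + rewrite <- (op_image_coef L (fun k => sigma (kap L k ^ 2)) (phi t) Sp k HS). apply coef_bound; auto. apply HS.
  - intros t k Ht. assert (Ht' : 0 <= t <= T) by lra.
    assert (D : derivable_pt_lim (fun s => coef L (U (clamp T s)) k) t (coef L (V (clamp T t)) k)).
    { apply (coef_time_der L T (fun s y => U (clamp T s) y) (fun s y => V (clamp T s) y)); auto.
      - now apply cont2_clamp.
      - intros s Hs. apply SU, clamp_range; auto.
      - intros s y Hs. rewrite (clamp_id T s) by lra. apply (deriv_clamp T (fun s => U s y)); auto. }
    rewrite (clamp_id T t Ht') in D. rewrite (clamp_id T t Ht').
    destruct (HV t Ht') as [Sp [Fq [HS [HF HVe]]]].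
    assert (EV : coef L (V t) k = sigma (kap L k ^ 2) * coef L (phi t) k + fs eps (kap L k ^ 2) * coef L (fun y => py t y ^ 2) k).
    { rewrite (coef_ext L (V t) (fun y => Sp y + Fq y)) by auto.
      rewrite coef_plus by (apply HS || apply HF).
      now rewrite (op_image_coef _ _ _ _ _ HS), (op_image_coef _ _ _ _ _ HF). }
    specialize (Hbs k).
    replace (- rate eps (kap L k ^ 2) * coef L (phi t) k + fs eps (kap L k ^ 2) / bs eps (kap L k ^ 2) * coef L (fun y => py t y ^ 2) k)
      with (/ bs eps (kap L k ^ 2) * coef L (V t) k) by (rewrite EV; unfold rate; field; lra).
    assert (E : forall s, / bs eps (kap L k ^ 2) * coef L (U (clamp T s)) k = coef L (phi (clamp T s)) k).
    { intro s. rewrite EU by (apply clamp_range; auto). field; lra. }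
    apply is_derive_Reals. apply (is_derive_ext _ _ _ _ E). apply is_derive_Reals.
    now apply (derivable_pt_lim_scal (fun s => coef L (U (clamp T s)) k)).
Qed.

(** A truncation at an even index contains both members of every pair, so exchanging partners
    permutes the sum. This is why energies are cut off at [2 * n]. *)
Lemma sum_partner L (d : nat -> R) n :
  sum_f_R0 (fun k => kap L k ^ 2 * d (partner k) ^ 2) (2 * n) = sum_f_R0 (fun k => kap L k ^ 2 * d k ^ 2) (2 * n).
Proof.
  induction n.
  - simpl. now rewrite kap_0.
  - replace (2 * S n)%nat with (S (S (2 * n))) by lia. rewrite !tech5, IHn.
    replace (S (S (2 * n))) with (2 * n + 2)%nat by lia. replace (S (2 * n)) with (2 * n + 1)%nat by lia.
    rewrite partner_odd, partner_even.
    assert (E : kap L (2 * n + 2) = kap L (2 * n + 1)) by (rewrite <- (kap_partner L (2*n+1)), partner_odd; auto).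
    rewrite E. ring.
Qed.

(* The energy is the plain square sum of the modes; dissipation absorbs the nonlinear
   flux through Bessel's inequality as soon as the sum of the gradients is bounded by [G]. *)
Lemma energy_step eps L A Cd G M (f1 f2 g1 g2 : R -> R) n :
  0 < L -> 0 < eps <= 1 -> 0 <= G ->
  (forall mu, 0 <= mu -> 25 * Xs eps mu ^ 2 + G ^ 2 * mu <= 2 * rate eps mu + 2 * M) ->
  (forall y, derivable_pt_lim f1 y (g1 y)) -> (forall y, derivable_pt_lim f2 y (g2 y)) ->
  continuity g1 -> continuity g2 -> periodic L f1 -> periodic L f2 ->
  decay 3 A (coef L (fun y => f1 y - f2 y)) ->
  (forall k, kap L k ^ 2 * coef L (fun y => f1 y - f2 y) k ^ 2 <= Cd / (1 + jidx k) ^ 2) ->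
  (forall y, - (L/2) <= y <= L/2 -> Rabs (g1 y + g2 y) <= G) ->
  let d := coef L (fun y => f1 y - f2 y) in
  sum_f_R0 (fun k => 2 * d k * (- rate eps (kap L k ^ 2) * d k +
     fs eps (kap L k ^ 2) / bs eps (kap L k ^ 2) * (coef L (fun y => g1 y ^ 2) k - coef L (fun y => g2 y ^ 2) k))) (2 * n)
  <= 2 * M * sum_f_R0 (fun k => d k ^ 2) (2 * n) + G ^ 2 * (4 * Cd) / (INR (2 * n) + 2).
Proof.
  intros HL He HG HM D1 D2 Cg1 Cg2 P1 P2 HA HCd HGb d.
  assert (He' : 0 <= eps <= 1) by lra.
  set (e := fun y => g1 y - g2 y). set (q := fun y => e y * (g1 y + g2 y)).
  assert (Ce : continuity e) by now apply cont_minus.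
  assert (Cq : continuity q) by (apply cont_mult; auto; now apply cont_plus).
  assert (De : forall y, derivable_pt_lim (fun y => f1 y - f2 y) y (e y)).
  { intro y. apply (derivable_pt_lim_minus f1 f2); auto. }
  assert (Pf : periodic L (fun y => f1 y - f2 y)) by (intro y; now rewrite P1, P2).
  assert (Pe : periodic L e) by (eapply deriv_per; eauto).
  assert (Eq : forall k, coef L (fun y => g1 y ^ 2) k - coef L (fun y => g2 y ^ 2) k = coef L q k).
  { intro k. rewrite <- coef_minus by now apply cont_sq. apply coef_ext. intro y. unfold q, e. ring. }
  assert (Ed : forall k, coef L e k ^ 2 = kap L k ^ 2 * d (partner k) ^ 2).
  { intro k. rewrite (coef_deriv L (fun y => f1 y - f2 y) e) by auto. fold d.
    replace ((- sgn k * kap L k * d (partner k)) ^ 2) with ((sgn k * sgn k) * (kap L k ^ 2 * d (partner k) ^ 2)) by ring.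
    rewrite sgn_sq; ring. }
  assert (Hpt : forall k, 2 * d k * (- rate eps (kap L k ^ 2) * d k +
     fs eps (kap L k ^ 2) / bs eps (kap L k ^ 2) * (coef L (fun y => g1 y ^ 2) k - coef L (fun y => g2 y ^ 2) k))
     <= 2 * M * d k ^ 2 - G ^ 2 * (kap L k ^ 2 * d k ^ 2) + coef L q k ^ 2).
  { intro k. rewrite Eq. specialize (HM (kap L k ^ 2) (pow2_ge_0 _)).
    pose proof (fb_bound eps (kap L k ^ 2) He' (pow2_ge_0 _)) as F.
    pose proof (Xs_ge1 eps (kap L k ^ 2) ltac:(lra) (pow2_ge_0 _)) as HX.
    set (X := Xs eps (kap L k ^ 2)) in *. set (r := rate eps (kap L k ^ 2)) in *.
    set (F0 := fs eps (kap L k ^ 2) / bs eps (kap L k ^ 2)) in *. set (m := kap L k ^ 2) in *.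
    set (x := d k). set (p := coef L q k).
    assert (F2 : F0 ^ 2 <= 25 * X ^ 2).
    { rewrite <- pow2_abs. replace (25 * X ^ 2) with ((5 * X) ^ 2) by ring. apply pow_incr. split; auto using Rabs_pos. }
    assert (Hx2 : 0 <= x ^ 2) by apply pow2_ge_0.
    (* Young's inequality puts the unbounded factor [f/b] entirely on [d], where the damping absorbs
       it, and leaves the plain square of the flux coefficient for Bessel. *)
    assert (Y : 2 * x * (F0 * p) <= p ^ 2 + F0 ^ 2 * x ^ 2) by (pose proof (pow2_ge_0 (p - F0 * x)); nra).
    assert (Z : F0 ^ 2 * x ^ 2 <= (2 * r + 2 * M - G ^ 2 * m) * x ^ 2) by (apply Rmult_le_compat_r; lra).
    nra. }
  eapply Rle_trans. { apply sum_Rle. intros k _. apply Hpt. }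
  rewrite sum_plus, minus_sum.
  assert (S1 : sum_f_R0 (fun k => 2 * M * d k ^ 2) (2 * n) = 2 * M * sum_f_R0 (fun k => d k ^ 2) (2 * n)).
  { rewrite scal_sum. apply sum_eq. intros; ring. }
  assert (S2 : sum_f_R0 (fun k => G ^ 2 * (kap L k ^ 2 * d k ^ 2)) (2 * n) = G ^ 2 * sum_f_R0 (fun k => kap L k ^ 2 * d k ^ 2) (2 * n)).
  { rewrite scal_sum. apply sum_eq. intros; ring. }
  rewrite S1, S2. clear S1 S2.
  (* The sum of squared flux coefficients is at most the integral of [q^2], hence at most [G^2]
     times that of [e^2]. Parseval up to a tail turns this back into the sum of [kap^2 d^2], which
     the modewise estimate has subtracted. *)
  pose proof (bessel L q (2 * n) HL Cq) as B1.
  assert (B2 : integral (fun y => q y ^ 2) (-(L/2)) (L/2) <= G ^ 2 * integral (fun y => e y ^ 2) (-(L/2)) (L/2)).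
  { rewrite <- integral_scal by now apply cont_sq. apply integral_le; [lra | now apply cont_sq | now apply cont_scal, cont_sq |].
    intros y Hy. unfold q. rewrite Rpow_mult_distr. rewrite Rmult_comm. apply Rmult_le_compat_r. apply pow2_ge_0.
    rewrite <- pow2_abs. apply pow_incr. split; auto using Rabs_pos. }
  assert (DA : decay 2 (2 * PI / L * A) (coef L e)) by (apply (coef_deriv_decay L (fun y => f1 y - f2 y)); auto).
  pose proof (parseval_tail L e _ Cd (2 * n) HL Ce Pe DA) as B3.
  assert (B4 : integral (fun y => e y ^ 2) (-(L/2)) (L/2) <= sum_f_R0 (fun k => kap L k ^ 2 * d k ^ 2) (2 * n) + 4 * Cd / (INR (2 * n) + 2)).
  { rewrite <- sum_partner. rewrite (sum_eq _ (fun k => coef L e k ^ 2)) by (intros; symmetry; apply Ed).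
    apply B3. intro k. rewrite Ed. specialize (HCd (partner k)). rewrite kap_partner, jidx_partner in HCd. exact HCd. }
  assert (HG2 : 0 <= G ^ 2) by apply pow2_ge_0.
  assert (B5 : G ^ 2 * integral (fun y => e y ^ 2) (-(L/2)) (L/2) <= G ^ 2 * (sum_f_R0 (fun k => kap L k ^ 2 * d k ^ 2) (2 * n) + 4 * Cd / (INR (2 * n) + 2))).
  { now apply Rmult_le_compat_l. }
  replace (G ^ 2 * (4 * Cd) / (INR (2 * n) + 2)) with (G ^ 2 * (4 * Cd / (INR (2 * n) + 2))) by (unfold Rdiv; ring).
  lra.
Qed.

Lemma sum_der (u u' : nat -> R -> R) t n : (forall k, derivable_pt_lim (u k) t (u' k t)) ->
  derivable_pt_lim (fun s => sum_f_R0 (fun k => u k s) n) t (sum_f_R0 (fun k => u' k t) n).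
Proof.
  intro H. induction n; simpl; auto.
  apply (derivable_pt_lim_plus (fun s => sum_f_R0 (fun k => u k s) n) (u (S n))); auto.
Qed.

Definition scaled_csol (eps L T : R) : (R -> R -> R) -> Prop :=
  csol L T (fun k => bs eps (kap L k ^ 2)) (fun k => sigma (kap L k ^ 2)) (fun k => fs eps (kap L k ^ 2)).

(** Gronwall's inequality for the truncated energy. Truncation leaves an error of order [1 / n],
    uniform in time, and each single mode of the difference vanishes as [n] grows. Truncating also
    makes differentiation in time a finite sum. *)
Lemma local_unique eps L T G M phi1 phi2 py1 py2 t0 t1 :
  0 < L -> 0 < T -> 0 < eps <= 1 -> 0 <= G -> 0 < M ->
  (forall mu, 0 <= mu -> 25 * Xs eps mu ^ 2 + G ^ 2 * mu <= 2 * rate eps mu + 2 * M) ->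
  scaled_csol eps L T phi1 -> scaled_csol eps L T phi2 ->
  (forall t y, 0 <= t <= T -> derivable_pt_lim (phi1 t) y (py1 t y)) ->
  (forall t y, 0 <= t <= T -> derivable_pt_lim (phi2 t) y (py2 t y)) ->
  0 <= t0 -> t0 <= t1 -> t1 <= T ->
  (forall y, phi1 t0 y = phi2 t0 y) ->
  (forall t y, t0 <= t <= t1 -> - (L/2) <= y <= L/2 -> Rabs (py1 t y + py2 t y) <= G) ->
  forall t y, t0 <= t <= t1 -> phi1 t y = phi2 t y.
Proof.
  intros HL HT He HG HM0 HM CS1 CS2 D1 D2 Ht0 Ht01 Ht1 H0 HGb.
  destruct (csol_modes eps L T phi1 HL HT He CS1) as [p1 [A1 [A2 [A3 [A4 [A5 [[C1 A6] [A7 A8]]]]]]]].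
  destruct (csol_modes eps L T phi2 HL HT He CS2) as [p2 [B1 [B2 [B3 [B4 [B5 [[C2 B6] [B7 B8]]]]]]]].
  assert (E1 : forall t y, 0 <= t <= T -> p1 t y = py1 t y) by (intros; eapply uniqueness_limite; [apply A1 | apply D1]; auto).
  assert (E2 : forall t y, 0 <= t <= T -> p2 t y = py2 t y) by (intros; eapply uniqueness_limite; [apply B1 | apply D2]; auto).
  assert (S1 : forall t, 0 <= t <= T -> continuity (phi1 t)) by (intros; eapply cont2_on_section; eauto).
  assert (S2 : forall t, 0 <= t <= T -> continuity (phi2 t)) by (intros; eapply cont2_on_section; eauto).
  assert (S3 : forall t, 0 <= t <= T -> continuity (p1 t)) by (intros; eapply cont2_on_section; eauto).
  assert (S4 : forall t, 0 <= t <= T -> continuity (p2 t)) by (intros; eapply cont2_on_section; eauto).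
  set (d := fun k t => coef L (phi1 (clamp T t)) k - coef L (phi2 (clamp T t)) k).
  assert (Cd : forall k, continuity (d k)) by (intro; now apply cont_minus).
  assert (Ed : forall t k, 0 <= t <= T -> coef L (fun y => phi1 t y - phi2 t y) k = d k t).
  { intros t k Ht. unfold d. rewrite clamp_id by auto. apply coef_minus; auto. }
  assert (He' : 0 <= eps <= 1) by lra.
  (* From [b >= X^2 >= eps (1 + mu)] the uniform bounds give [(1 + mu) |d| <= (C1 + C2) / eps], and
     [weight2] converts one factor [1 + mu] into the index weight. The dependence on [eps] is
     harmless, since uniqueness is proved for fixed [eps]. *)
  set (K := 2 * cw L ^ 2 * ((C1 + C2) / eps) ^ 2).
  assert (HK : forall t k, 0 <= t <= T -> kap L k ^ 2 * d k t ^ 2 <= K / (1 + jidx k) ^ 2).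
  { intros t k Ht. specialize (A6 t k Ht). specialize (B6 t k Ht).
    pose proof (weight2 L k HL) as W. pose proof (jidx_pos k) as Hj.
    destruct (bs_bounds eps (kap L k ^ 2) He' (pow2_ge_0 _)) as [_ [[Hb _] _]].
    rewrite Xs_sq in Hb by (try apply pow2_ge_0; lra).
    set (m := kap L k ^ 2) in *. assert (Hm : 0 <= m) by (unfold m; apply pow2_ge_0).
    set (x := Rabs (d k t)). assert (Hx : 0 <= x) by apply Rabs_pos.
    assert (Hx1 : eps * (1 + m) * x <= C1 + C2).
    { assert (Hx2 : x <= Rabs (coef L (phi1 t) k) + Rabs (coef L (phi2 t) k)).
      { unfold x, d. rewrite clamp_id by auto. apply Rle_trans with (1 := Rabs_triang _ _). rewrite Rabs_Ropp. lra. }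
      apply Rle_trans with (bs eps m * x). apply Rmult_le_compat_r; nra.
      apply Rle_trans with (bs eps m * (Rabs (coef L (phi1 t) k) + Rabs (coef L (phi2 t) k))).
      apply Rmult_le_compat_l; nra. lra. }
    assert (Hx3 : (1 + m) * x <= (C1 + C2) / eps).
    { apply Rmult_le_reg_l with eps. lra. replace (eps * ((C1 + C2) / eps)) with (C1 + C2) by (field; lra). lra. }
    assert (Hw : 0 < (1 + jidx k) ^ 2) by (apply pow_lt; lra).
    apply Rmult_le_reg_r with ((1 + jidx k) ^ 2); auto. unfold Rdiv at 1. rewrite (Rmult_assoc K), Rinv_l, Rmult_1_r by lra.
    rewrite <- (pow2_abs (d k t)). fold x.
    apply Rle_trans with (m * x ^ 2 * (2 * cw L ^ 2 * (1 + m))).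
    { apply Rmult_le_compat_l; auto. apply Rmult_le_pos; auto. apply pow2_ge_0. }
    apply Rle_trans with (2 * cw L ^ 2 * ((1 + m) * x) ^ 2).
    - replace (2 * cw L ^ 2 * ((1 + m) * x) ^ 2) with ((1 + m) * (x ^ 2 * (2 * cw L ^ 2 * (1 + m)))) by ring.
      rewrite Rmult_assoc. apply Rmult_le_compat_r; [|lra].
      pose proof (pow2_ge_0 (cw L)). pose proof (pow2_ge_0 x). mul_nonneg.
    - unfold K. apply Rmult_le_compat_l. pose proof (pow2_ge_0 (cw L)); lra.
      apply pow_incr. split; auto. apply Rmult_le_pos; lra. }
  assert (HK0 : 0 <= K). { unfold K. pose proof (pow2_ge_0 (cw L)). pose proof (pow2_ge_0 ((C1 + C2) / eps)). mul_nonneg. }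
  pose (E := fun n t => sum_f_R0 (fun k => d k t ^ 2) (2 * n)).
  pose (F := fun k t => 2 * d k t * (- rate eps (kap L k ^ 2) * d k t +
     fs eps (kap L k ^ 2) / bs eps (kap L k ^ 2) * (coef L (fun y => p1 t y ^ 2) k - coef L (fun y => p2 t y ^ 2) k))).
  assert (DE : forall n t, 0 < t < T -> derivable_pt_lim (E n) t (sum_f_R0 (fun k => F k t) (2 * n))).
  { intros n t Ht. apply (sum_der (fun k t => d k t ^ 2) F). intro k.
    pose proof (derivable_pt_lim_minus _ _ t _ _ (A8 t k Ht) (B8 t k Ht)) as Dd.
    assert (E3 : forall s, d k s * d k s = d k s ^ 2) by (intro; ring).
    apply is_derive_Reals. apply (is_derive_ext _ _ _ _ E3). apply is_derive_Reals.
    pose proof (derivable_pt_lim_mult _ _ t _ _ Dd Dd) as Dm.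
    unfold F. eapply eq_ind; [exact Dm|]. unfold minus_fct, d. ring. }
  assert (Hstep : forall n t, t0 < t < t1 -> sum_f_R0 (fun k => F k t) (2 * n) <= 2 * M * E n t + G ^ 2 * (4 * K) / (INR (2 * n) + 2)).
  { intros n t Ht. assert (Ht' : 0 <= t <= T) by lra.
    destruct (A7 t Ht') as [a1 Ha1]. destruct (B7 t Ht') as [a2 Ha2].
    pose proof (energy_step eps L (a1 + a2) K G M (phi1 t) (phi2 t) (p1 t) (p2 t) n HL He HG HM) as ES.
    cbv zeta in ES.
    rewrite (sum_eq (fun k => F k t) (fun k => 2 * coef L (fun y => phi1 t y - phi2 t y) k *
       (- rate eps (kap L k ^ 2) * coef L (fun y => phi1 t y - phi2 t y) k +
        fs eps (kap L k ^ 2) / bs eps (kap L k ^ 2) * (coef L (fun y => p1 t y ^ 2) k - coef L (fun y => p2 t y ^ 2) k))))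
      by (intros k _; unfold F; now rewrite Ed).
    unfold E. rewrite (sum_eq (fun k => d k t ^ 2) (fun k => coef L (fun y => phi1 t y - phi2 t y) k ^ 2))
      by (intros k _; now rewrite Ed).
    apply ES; auto.
    - intro k. rewrite Ed by auto. unfold d. rewrite clamp_id by auto.
      apply (decay_minus 3 a1 a2 (coef L (phi1 t)) (coef L (phi2 t))); apply decay_le_exp with 4%nat; auto.
    - intro k. rewrite Ed by auto. now apply HK.
    - intros y Hy. rewrite E1, E2 by auto. apply HGb; auto. lra. }
  assert (CE : forall n, continuity (E n)).
  { intro n. apply (cont_sum (fun k t => d k t ^ 2)). intro; now apply cont_sq. }
  assert (HE : forall n t, t0 <= t <= t1 -> E n t <= exp (2 * M * T) * (G ^ 2 * (4 * K)) * T / (INR (2 * n) + 2)).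
  { intros n t Ht. set (R0 := G ^ 2 * (4 * K) / (INR (2 * n) + 2)).
    assert (HR0 : 0 <= R0).
    { unfold R0. pose proof (pos_INR (2 * n)). pose proof (pow2_ge_0 G).
      apply Rmult_le_pos; [mul_nonneg | left; apply Rinv_0_lt_compat; lra]. }
    (* The integrating factor removes the term [2 M E]; it is at most one, so the truncation error
       enters at most with its full size. *)
    set (u := fun t => exp (- (2 * M) * t) * E n t).
    assert (Du : forall s, t0 < s < t1 -> derivable_pt_lim u s
       (- (2 * M) * exp (- (2 * M) * s) * E n s + exp (- (2 * M) * s) * sum_f_R0 (fun k => F k s) (2 * n))).
    { intros s Hs. apply (derivable_pt_lim_mult (fun s => exp (- (2 * M) * s)) (E n)). apply exp_lin_der. apply DE; lra. }
    assert (U : u t - u t0 <= R0 * t - R0 * t0).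
    { apply (deriv_le t0 t1 u (fun s => R0 * s) _ (fun _ => R0 * 1) t) with (1 := cont_mult _ _ (exp_lin_cont _) (CE n)) (3 := Du); auto.
      - apply cont_scal, cont_id.
      - intros s _. apply (derivable_pt_lim_scal id). apply derivable_pt_lim_id.
      - intros s Hs. specialize (Hstep n s Hs). fold R0 in Hstep. pose proof (exp_pos (- (2 * M) * s)).
        assert (exp (- (2 * M) * s) <= 1). { rewrite <- exp_0. apply exp_le. nra. }
        apply Rle_trans with (exp (- (2 * M) * s) * R0). nra. nra. }
    assert (Z : u t0 = 0).
    { unfold u, E. rewrite (sum_eq _ (fun _ => 0)), sum_cte. ring. intros k _.
      rewrite <- Ed by lra. rewrite (coef_ext L _ (fun _ => 0)) by (intro; rewrite H0; ring).
      unfold coef. rewrite (integral_ext _ (fun _ => 0)) by (intro; ring). rewrite integral_const. ring. }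
    assert (Eu : E n t = exp (2 * M * t) * u t).
    { unfold u. rewrite <- Rmult_assoc, <- exp_plus. replace (2 * M * t + - (2 * M) * t) with 0 by ring. rewrite exp_0. ring. }
    rewrite Eu. replace (exp (2 * M * T) * (G ^ 2 * (4 * K)) * T / (INR (2 * n) + 2)) with (exp (2 * M * T) * (R0 * T)) by (unfold R0, Rdiv; ring).
    pose proof (exp_pos (2 * M * t)). assert (exp (2 * M * t) <= exp (2 * M * T)) by (apply exp_le; nra).
    apply Rle_trans with (exp (2 * M * t) * (R0 * T)).
    - apply Rmult_le_compat_l; [lra|]. nra.
    - apply Rmult_le_compat_r; auto. nra. }
  assert (Hd : forall t k, t0 <= t <= t1 -> d k t = 0).
  { intros t k Ht. assert (d k t ^ 2 <= 0).
    { apply (lim_le _ _ (exp (2 * M * T) * (G ^ 2 * (4 * K)) * T) k). intros N HN.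
      rewrite Rplus_0_l. specialize (HE N t Ht).
      assert (Hk : d k t ^ 2 <= E N t).
      { unfold E. apply Rle_trans with (sum_f_R0 (fun i => d i t ^ 2 * (if Nat.eq_dec i k then 1 else 0)) (2 * N)).
        - rewrite sum_delta by lia. lra.
        - apply sum_Rle. intros i _. pose proof (pow2_ge_0 (d i t)). destruct (Nat.eq_dec i k); lra. }
      apply Rle_trans with (1 := Hk). apply Rle_trans with (1 := HE).
      apply Rmult_le_compat_l.
      - pose proof (exp_pos (2 * M * T)). pose proof (pow2_ge_0 G). mul_nonneg.
      - pose proof (pos_INR N). apply Rinv_le_contravar. lra. rewrite mult_INR. simpl (INR 2). lra. }
    nra. }
  intros t y Ht. apply (coef_inj L); auto; try (apply S1; lra); try (apply S2; lra); try (apply A4; lra); try (apply B4; lra).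
  intro k. specialize (Hd t k Ht). unfold d in Hd. rewrite clamp_id in Hd by lra. lra.
Qed.

(** Only one solution has an a priori gradient bound. Where the solutions agree, so do their
    gradients, and over a time step [h] each gradient moves by less than one half; the sum then
    stays below [2 g + 1]. The step comes from uniform continuity on the whole strip, so finitely
    many steps reach [T]. *)
Lemma csol_unique eps L T g M phi1 phi2 : 0 < L -> 0 < T -> 0 < eps <= 1 -> 0 <= g -> 0 < M ->
  (forall mu, 0 <= mu -> 25 * Xs eps mu ^ 2 + (2 * g + 1) ^ 2 * mu <= 2 * rate eps mu + 2 * M) ->
  scaled_csol eps L T phi1 -> scaled_csol eps L T phi2 ->
  (forall t y l, 0 <= t <= T -> derivable_pt_lim (phi1 t) y l -> Rabs l <= g) ->
  (forall y, phi1 0 y = phi2 0 y) -> forall t y, 0 <= t <= T -> phi1 t y = phi2 t y.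
Proof.
  intros HL HT He Hg HM0 HM CS1 CS2 Hb H0.
  destruct (csol_modes eps L T phi1 HL HT He CS1) as [p1 [A1 [A2 _]]].
  destruct (csol_modes eps L T phi2 HL HT He CS2) as [p2 [B1 [B2 _]]].
  assert (HT0 : 0 <= T) by lra.
  assert (H12 : 0 < / 2) by lra.
  destruct (uniform_continuity_2d (fun t y => p1 (clamp T t) y) 0 T (-(L/2)) (L/2)
    (fun t y _ _ => cont2_clamp T p1 HT0 A2 t y) (mkposreal _ H12)) as [d1 Hd1].
  destruct (uniform_continuity_2d (fun t y => p2 (clamp T t) y) 0 T (-(L/2)) (L/2)
    (fun t y _ _ => cont2_clamp T p2 HT0 B2 t y) (mkposreal _ H12)) as [d2 Hd2].
  set (h := Rmin d1 d2 / 2). assert (Hm : 0 < Rmin d1 d2) by (apply Rmin_pos; apply cond_pos).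
  assert (Hh : 0 < h) by (unfold h; lra).
  assert (h < d1 /\ h < d2) as [Hh1 Hh2].
  { pose proof (Rmin_l d1 d2). pose proof (Rmin_r d1 d2). unfold h; lra. }
  assert (Hn : forall n t y, 0 <= t <= T -> t <= INR n * h -> phi1 t y = phi2 t y).
  { induction n; intros t y Ht Htn.
    - simpl in Htn. replace t with 0 by lra. apply H0.
    - destruct (Rle_dec t (INR n * h)) as [|Hgt]; [now apply IHn|].
      rewrite S_INR in Htn. pose proof (pos_INR n).
      set (t0 := INR n * h) in *. assert (Ht0 : 0 <= t0) by (unfold t0; nra).
      assert (Ht1 : t <= t0 + h) by (unfold t0; lra).
      assert (Heq : forall y, phi1 t0 y = phi2 t0 y) by (intro; apply IHn; lra).
      assert (Hpe : forall y, p1 t0 y = p2 t0 y).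
      { intro z. apply (uniqueness_limite (phi1 t0) z). apply A1; lra.
        apply is_derive_Reals. apply (is_derive_ext (phi2 t0)). intro; now rewrite Heq.
        apply is_derive_Reals. apply B1; lra. }
      apply (local_unique eps L T (2 * g + 1) M phi1 phi2 p1 p2 t0 t); auto; try lra.
      intros s z Hs Hz.
      assert (X1 : Rabs (p1 s z - p1 t0 z) < /2).
      { rewrite <- (clamp_id T s), <- (clamp_id T t0) by lra. apply Hd1; try lra.
        rewrite Rabs_right; lra. rewrite Rminus_diag, Rabs_R0; apply cond_pos. }
      assert (X2 : Rabs (p2 s z - p2 t0 z) < /2).
      { rewrite <- (clamp_id T s), <- (clamp_id T t0) by lra. apply Hd2; try lra.
        rewrite Rabs_right; lra. rewrite Rminus_diag, Rabs_R0; apply cond_pos. }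
      assert (X3 : Rabs (p1 s z) <= g) by (apply (Hb s z); [lra | apply A1; lra]).
      rewrite Hpe in X1.
      apply Rabs_le_between in X3. apply Rabs_lt_between in X1. apply Rabs_lt_between in X2. apply Rabs_le. lra. }
  destruct (INR_unbounded (T / h)) as [n Hnn].
  intros t y Ht. apply (Hn n); auto.
  apply Rmult_gt_compat_r with (r := h) in Hnn; auto. unfold Rdiv in Hnn. rewrite Rmult_assoc, Rinv_l in Hnn; lra.
Qed.

(** * Scaling *)

Lemma kap_scale L q k : 0 < L -> 0 < q -> kap (L / q) k = q * kap L k.
Proof. intros. unfold kap. field. lra. Qed.

Lemma amp_scale L q k : 0 < L -> 0 < q -> amp (L / q) k = sqrt q * amp L k.
Proof.
  intros HL Hq. destruct k; simpl.
  - rewrite <- !sqrt_inv, <- sqrt_mult_alt by lra. f_equal. field. lra.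
  - rewrite <- sqrt_mult_alt by lra. f_equal. field. lra.
Qed.

Lemma w_scale L q k y : 0 < L -> 0 < q -> w (L / q) k y = sqrt q * w L k (q * y).
Proof.
  intros HL Hq. rewrite !w_phase, amp_scale, kap_scale by auto.
  rewrite Rmult_assoc. do 3 f_equal. ring.
Qed.

Lemma coef_scale L q f k : 0 < L -> 0 < q -> continuity f ->
  coef (L / q) (fun y => f (q * y)) k = sqrt q / q * coef L f k.
Proof.
  intros HL Hq Hf. unfold coef.
  rewrite (integral_ext _ (fun y => (sqrt q / q) * (q * (f (q * y + 0) * w L k (q * y + 0))))).
  - assert (Hc : continuity (fun y => f y * w L k y)) by (apply cont_mult; auto using w_cont).
    rewrite integral_scal.
    + f_equal. unfold integral. pose proof (RInt_comp_lin (fun y => f y * w L k y) q 0 (-(L/q/2)) (L/q/2)) as E.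
      replace (q * -(L/q/2) + 0) with (-(L/2)) in E by (field; lra).
      replace (q * (L/q/2) + 0) with (L/2) in E by (field; lra).
      apply E. now apply cont_integrable.
    + apply cont_scal. apply (continuity_comp (fun y => q * y + 0) (fun y => f y * w L k y)); auto.
      apply cont_plus; [apply cont_scal, cont_id | apply cont_const].
  - intro y. rewrite w_scale by auto. rewrite Rplus_0_r. field. lra.
Qed.

Lemma comp_scal_cont f q a : continuity f -> continuity (fun y => a * f (q * y)).
Proof.
  intro H. apply cont_scal. apply (continuity_comp (fun y => q * y) f); auto. apply cont_scal, cont_id.
Qed.

(** Under dilation the coefficients of argument and image acquire the same factor, independent of
    the mode, so the symbol is untouched. *)
Lemma op_image_scale L q a c c' g h g' h' : 0 < L -> 0 < q -> continuity g -> op_image L c g h ->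
  (forall y, g' y = a * g (q * y)) ->
  (forall k, c' k = c k) -> (forall y, h' y = a * h (q * y)) -> op_image (L / q) c' g' h'.
Proof.
  intros HL Hq Hg Ho Eg Ec Eh. pose proof Ho as [Hh [Hp _]].
  assert (Cg : continuity g').
  { apply continuity_ext with (fun y => a * g (q * y)); auto. now apply comp_scal_cont. }
  assert (Ch : continuity h').
  { apply continuity_ext with (fun y => a * h (q * y)); auto. now apply comp_scal_cont. }
  apply op_image_intro; auto.
  - intro y. rewrite !Eh. replace (q * (y + L / q)) with (q * y + L) by (field; lra). now rewrite Hp.
  - intro k. rewrite (coef_ext _ _ _ k Eg), (coef_ext _ _ _ k Eh).
    rewrite !coef_scal by (apply (continuity_comp (fun y => q * y)); auto; apply cont_scal, cont_id).
    rewrite !coef_scale by auto. rewrite (op_image_coef L c g h k Ho), Ec. ring.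
Qed.

Lemma cont2_on_scale T q p a F F' : 0 < p -> 0 < q -> 0 < a -> cont2_on 0 T F ->
  (forall t y, F' t y = a * F (p * t) (q * y)) -> cont2_on 0 (T / p) F'.
Proof.
  intros Hp Hq Ha H E t y Ht e He.
  assert (Hr : forall s, 0 <= s <= T / p -> 0 <= p * s <= T).
  { intros s Hs. split. nra. replace T with (p * (T / p)) by (field; lra). apply Rmult_le_compat_l; lra. }
  destruct (H (p * t) (q * y) (Hr t Ht) (e / a)) as [d [Hd H2]]. now apply Rdiv_lt_0_compat.
  exists (Rmin (d / p) (d / q)). split. { apply Rmin_pos; now apply Rdiv_lt_0_compat. }
  intros t' y' Ht' H3 H4. rewrite !E, <- Rmult_minus_distr_l, Rabs_mult, (Rabs_right a) by lra.
  pose proof (Rmin_l (d / p) (d / q)). pose proof (Rmin_r (d / p) (d / q)).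
  replace e with (a * (e / a)) by (field; lra). apply Rmult_lt_compat_l; auto. apply H2; auto.
  - rewrite <- Rmult_minus_distr_l, Rabs_mult, (Rabs_right p) by lra.
    replace d with (p * (d / p)) by (field; lra). apply Rmult_lt_compat_l; lra.
  - rewrite <- Rmult_minus_distr_l, Rabs_mult, (Rabs_right q) by lra.
    replace d with (q * (d / q)) by (field; lra). apply Rmult_lt_compat_l; lra.
Qed.

Lemma deriv_scale f g q a x l : (forall z, g z = a * f (q * z)) -> derivable_pt_lim f (q * x) l ->
  derivable_pt_lim g x (a * (q * l)).
Proof.
  intros E H. assert (E' : forall z, a * f (q * z) = g z) by auto.
  apply is_derive_Reals. apply (is_derive_ext _ _ _ _ E'). apply is_derive_Reals.
  apply (derivable_pt_lim_scal (fun z => f (q * z))).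
  pose proof (derivable_pt_lim_scal id q x 1 (derivable_pt_lim_id x)) as Q. rewrite Rmult_1_r in Q.
  rewrite Rmult_comm. exact (derivable_pt_lim_comp (fun z => q * z) f x _ _ Q H).
Qed.

(** The powers balance: [V] and the square of the gradient both scale by [q^6], the former as [q^2]
    for the amplitude times [q^4] for time, the latter as the square of [q^3]. So [f] is unchanged
    and [s] takes [q^4]. Arbitrary [q > 0] is allowed because uniqueness transports solutions back
    with the inverse factor. *)
Lemma csol_scale L T b s f phi q L' T' b' s' f' phi' : 0 < L -> 0 < q -> csol L T b s f phi ->
  L' = L / q -> T' = T / q ^ 4 -> (forall k, b' k = b k) -> (forall k, s' k = q ^ 4 * s k) ->
  (forall k, f' k = f k) -> (forall t y, phi' t y = q ^ 2 * phi (q ^ 4 * t) (q * y)) ->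
  csol L' T' b' s' f' phi'.
Proof.
  intros HL Hq [py [U [V [Hper [C0 [C1 [CU [CV [Hd [HU [HV HUt]]]]]]]]]]] -> -> Eb Es Ef Ephi.
  assert (Hp : forall n, 0 < q ^ n) by (intro; now apply pow_lt).
  assert (Hr : forall t, 0 <= t <= T / q ^ 4 -> 0 <= q ^ 4 * t <= T).
  { intros t Ht. pose proof (Hp 4%nat). split. nra. replace T with (q ^ 4 * (T / q ^ 4)) by (field; lra). apply Rmult_le_compat_l; lra. }
  assert (S0 : forall t, 0 <= t <= T -> continuity (phi t)) by (intros; eapply cont2_on_section; eauto).
  assert (S1 : forall t, 0 <= t <= T -> continuity (py t)) by (intros; eapply cont2_on_section; eauto).
  exists (fun t y => q ^ 3 * py (q ^ 4 * t) (q * y)), (fun t y => q ^ 2 * U (q ^ 4 * t) (q * y)),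
    (fun t y => q ^ 6 * V (q ^ 4 * t) (q * y)).
  split; [|split; [|split; [|split; [|split; [|split; [|split; [|split]]]]]]].
  - intros t y Ht. rewrite !Ephi. replace (q * (y + L / q)) with (q * y + L) by (field; lra). now rewrite Hper by auto.
  - apply (cont2_on_scale T q (q ^ 4) (q ^ 2) phi); auto.
  - apply (cont2_on_scale T q (q ^ 4) (q ^ 3) py); auto.
  - apply (cont2_on_scale T q (q ^ 4) (q ^ 2) U); auto.
  - apply (cont2_on_scale T q (q ^ 4) (q ^ 6) V); auto.
  - intros t y Ht. replace (q ^ 3 * py (q ^ 4 * t) (q * y)) with (q ^ 2 * (q * py (q ^ 4 * t) (q * y))) by ring.
    apply (deriv_scale (phi (q ^ 4 * t))); auto.
  - intros t Ht. apply (op_image_scale L q (q ^ 2) b b' (phi (q ^ 4 * t)) (U (q ^ 4 * t))); auto.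
  - intros t Ht. destruct (HV _ (Hr t Ht)) as [Sp [Fq [HS [HF HVe]]]].
    exists (fun y => q ^ 6 * Sp (q * y)), (fun y => q ^ 6 * Fq (q * y)). split; [|split].
    + assert (HS' : op_image L s' (phi (q ^ 4 * t)) (fun y => q ^ 4 * Sp y)).
      { pose proof HS as [O1 [O2 _]]. apply op_image_intro; auto using cont_scal.
        - intro y. now rewrite O2.
        - intro k. rewrite coef_scal, (op_image_coef _ _ _ _ _ HS), Es by auto. ring. }
      apply (op_image_scale L q (q ^ 2) s' s' (phi (q ^ 4 * t)) (fun y => q ^ 4 * Sp y)); auto.
      intro y. ring.
    + apply (op_image_scale L q (q ^ 6) f f' (fun y => py (q ^ 4 * t) y ^ 2) Fq); auto.
      * apply cont_sq, S1; auto.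
      * intro y. ring.
    + intro y. rewrite HVe. ring.
  - intros t y Ht. replace (q ^ 6 * V (q ^ 4 * t) (q * y)) with (q ^ 2 * (q ^ 4 * V (q ^ 4 * t) (q * y))) by ring.
    apply (deriv_scale (fun s => U s (q * y))); auto. apply HUt.
    pose proof (Hp 4%nat). split. nra. replace T with (q ^ 4 * (T / q ^ 4)) by (field; lra). apply Rmult_lt_compat_l; lra.
Qed.

Lemma lam_scale eps l0 k : 0 < eps -> 0 < l0 -> lam (l0 / sqrt eps) k = eps * kap l0 k ^ 2.
Proof.
  intros He Hl. rewrite lam_kap, kap_scale by (auto; now apply sqrt_lt_R0).
  rewrite Rpow_mult_distr, pow2_sqrt by lra. ring.
Qed.

Lemma symbols_scale eps l0 k : 0 < eps -> 0 < l0 ->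
  bsym (1 + eps) (l0 / sqrt eps) k = bs eps (kap l0 k ^ 2) /\
  ssym (1 + eps) (l0 / sqrt eps) k = eps ^ 2 * sigma (kap l0 k ^ 2) /\
  fsym (1 + eps) (l0 / sqrt eps) k = fs eps (kap l0 k ^ 2).
Proof.
  intros He Hl. unfold bsym, ssym, fsym, Xk. rewrite lam_scale by auto.
  split; [reflexivity|]. split; [unfold sigma; ring | reflexivity].
Qed.

Theorem theorem1p2 :
  exists m0 : nat, forall m : nat, (m0 <= m)%nat ->
  forall (l0 T : R) (Phi0 : R -> R) (Phi : R -> R -> R),
    l0 > 4 * PI -> T > 0 ->
    in_Hsharp m l0 Phi0 -> KS_solution l0 T Phi0 Phi ->
    exists eps0, 0 < eps0 < 1 /\
    exists C, C > 0 /\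
    forall eps, 0 < eps <= eps0 ->
      exists phi : R -> R -> R,
        classical_sol (1 + eps) (l0 / sqrt eps) (T / eps ^ 2) phi /\
        init_cond eps l0 Phi0 phi /\
        (forall psi : R -> R -> R,
           classical_sol (1 + eps) (l0 / sqrt eps) (T / eps ^ 2) psi ->
           init_cond eps l0 Phi0 psi ->
           forall t y, 0 <= t <= T / eps ^ 2 -> psi t y = phi t y) /\
        (forall t y, 0 <= t <= T / eps ^ 2 -> Rabs y <= l0 / (2 * sqrt eps) ->
           Rabs (phi t y - eps * Phi (t * eps ^ 2) (y * sqrt eps)) <= C * eps ^ 2).
Proof.
  exists 13%nat. intros m Hm l0 T Phi0 Phi Hl HT HH HK.
  assert (HL : 0 < l0) by (pose proof PI_RGT_0; lra).
  destruct (ks_regularity m l0 T Phi0 Phi HL HT Hm HH HK) as [Hks [[A HA] [Hi Hsyn]]].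
  set (a := fun k t => coef l0 (Phi (clamp T t)) k).
  change (ks_modes l0 T a) in Hks. change (forall t, decay 13 A (fun k => a k t)) in HA.
  change (forall t y, 0 <= t <= T -> Phi t y = syn l0 (fun k => a k t) y) in Hsyn.
  assert (Hcl : forall k t, a k t = a k (clamp T t)).
  { intros k t. unfold a. rewrite (clamp_id T (clamp T t)); auto. apply clamp_range; lra. }
  pose proof (decay_nonneg _ _ _ (HA 0)) as HA0. pose proof (wmax_pos l0 HL) as HW.
  destruct (perturbed_exists l0 T a A HL HT Hks Hcl HA) as [C [eps1 [HC [He1 Hex]]]].
  assert (HPL : 0 < 2 * PI / l0) by (apply Rdiv_lt_0_compat; pose proof PI_RGT_0; lra).
  (* Bound on the gradient of the rescaled solution, from decay with constant [A + 1]. It does not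
     depend on [eps], so the threshold [eps2] for uniqueness can be fixed before [eps]. *)
  set (g := 4 * (2 * PI / l0 * (A + 1)) * wmax l0).
  assert (Hg : 0 <= g) by (unfold g; mul_nonneg).
  destruct (energy_small (2 * g + 1) ltac:(lra)) as [M [eps2 [HM [He2 Hen]]]].
  exists (Rmin eps1 eps2). pose proof (Rmin_l eps1 eps2). pose proof (Rmin_r eps1 eps2).
  split. { split; [apply Rmin_pos; lra | lra]. }
  exists (4 * C * wmax l0). split. { apply Rlt_gt, Rmult_lt_0_compat; lra. }
  intros eps Heps. destruct (Hex eps ltac:(lra)) as [b [Hbc [Hbd [Hb0 [Hbm Hba]]]]].
  set (q := sqrt eps). assert (Hq : 0 < q) by (apply sqrt_lt_R0; lra).
  assert (Hq2 : q ^ 2 = eps) by (apply pow2_sqrt; lra).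
  assert (Hq4 : q ^ 4 = eps ^ 2) by (rewrite <- Hq2; ring).
  assert (He0 : 0 < eps <= 1) by lra.
  set (psi := fun t y => syn l0 (fun k => b k t) y).
  assert (Hpsi : scaled_csol eps l0 T psi) by (apply (csol_of_modes eps l0 T (A + 1)); auto).
  assert (Hsym := fun k => symbols_scale eps l0 k (proj1 He0) HL). fold q in Hsym.
  assert (Dpsi : forall t y l, 0 <= t <= T -> derivable_pt_lim (psi t) y l -> Rabs l <= g).
  { intros t y l Ht Hd. assert (D3 : decay 3 (A + 1) (fun k => b k t)) by (apply decay_le_exp with 6%nat; auto; lia).
    rewrite (uniqueness_limite _ _ _ _ Hd (syn_der l0 (A + 1) _ y HL D3)). now apply dsyn_bound. }
  assert (Hpsi0 : forall y, psi 0 y = Phi0 y).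
  { intro y. destruct HK as [? [? [? [? [? [_ [Hinit _]]]]]]]. rewrite <- Hinit, Hsyn by lra. unfold psi.
    apply Series_ext. intro k. now rewrite Hb0. }
  assert (Hrange : forall t, 0 <= t <= T / eps ^ 2 -> 0 <= t * eps ^ 2 <= T).
  { intros t Ht. assert (0 < eps ^ 2) by (apply pow_lt; lra). split. nra.
    replace T with (T / eps ^ 2 * eps ^ 2) by (field; lra). apply Rmult_le_compat_r; lra. }
  exists (fun t y => eps * psi (t * eps ^ 2) (y * q)). split; [|split; [|split]].
  - change (csol (l0 / q) (T / eps ^ 2) (bsym (1 + eps) (l0 / q)) (ssym (1 + eps) (l0 / q)) (fsym (1 + eps) (l0 / q))
      (fun t y => eps * psi (t * eps ^ 2) (y * q))).
    eapply csol_scale with (q := q); [exact HL | exact Hq | exact Hpsi | reflexivity | now rewrite Hq4 | | | |].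
    + intro k; apply Hsym.
    + intro k. rewrite Hq4. apply Hsym.
    + intro k; apply Hsym.
    + intros t y. rewrite Hq2, Hq4. now rewrite (Rmult_comm t), (Rmult_comm y).
  - intros y _. rewrite Rmult_0_l, Hpsi0. reflexivity.
  - intros chi Hchi Hchi0 t y Ht.
    (* The competitor is brought to the fixed period and time interval by the inverse scaling, where
       it meets [psi]. *)
    set (chi' := fun t y => (/ q) ^ 2 * chi ((/ q) ^ 4 * t) (/ q * y)).
    assert (Hqi : 0 < / q) by now apply Rinv_0_lt_compat.
    assert (HLq : 0 < l0 / q) by now apply Rdiv_lt_0_compat.
    assert (Hs : scaled_csol eps l0 T chi').
    { eapply csol_scale with (q := / q); [exact HLq | exact Hqi | exact Hchi | | | | | |].
      - field. lra.
      - rewrite <- Hq4. field. lra.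
      - intro k; symmetry; apply Hsym.
      - intro k. destruct (Hsym k) as [_ [E _]]. rewrite E, <- Hq4. field. lra.
      - intro k; symmetry; apply Hsym.
      - reflexivity. }
    (* The initial condition prescribes the competitor on a single period only; periodicity of both
       functions extends the equality to the line. *)
    assert (Hinit : forall z, psi 0 z = chi' 0 z).
    { intro z. destruct (per_reduce l0 z HL) as [z0 [Hz0 Hz]].
      rewrite (Hz (psi 0)) by now apply syn_per.
      rewrite (Hz (chi' 0)) by (destruct Hs as [? [? [? [Hp _]]]]; intro v; apply Hp; lra).
      rewrite Hpsi0. unfold chi'. rewrite Rmult_0_r, Hchi0.
      - fold q. rewrite <- Hq2. replace (/ q * z0 * q) with z0 by (field; lra). field. lra.
      - fold q. rewrite Rabs_mult, (Rabs_right (/ q)) by lra.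
        replace (l0 / (2 * q)) with (/ q * (l0 / 2)) by (field; lra). apply Rmult_le_compat_l; [lra|]. apply Rabs_le; lra. }
    rewrite (csol_unique eps l0 T g M psi chi' HL HT He0 Hg HM) with (t := t * eps ^ 2); auto.
    + unfold chi'. rewrite <- Hq4, <- Hq2.
      replace ((/ q) ^ 4 * (t * q ^ 4)) with t by (field; lra).
      replace (/ q * (y * q)) with y by (field; lra). field. lra.
    + intros mu Hmu. apply Hen; lra.
  (* The coefficient error [C eps] sums to a uniform error of the same order, and the amplitude of
     the scaling contributes the second factor [eps]. *)
  - intros t y Ht _. specialize (Hrange t Ht). rewrite Hsyn by auto. rewrite <- Rmult_minus_distr_l.
    unfold psi. fold q. set (s := t * eps ^ 2) in *.
    assert (D1 : decay 2 (A + 1) (fun k => b k s)) by (apply decay_le_exp with 6%nat; auto; lia).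
    assert (D2 : decay 2 A (fun k => a k s)) by (apply decay_le_exp with 13%nat; auto; lia).
    rewrite <- (syn_minus l0 (A + 1) A) by auto. rewrite Rabs_mult, (Rabs_right eps) by lra.
    replace (4 * C * wmax l0 * eps ^ 2) with (eps * (4 * (C * eps) * wmax l0)) by ring.
    apply Rmult_le_compat_l; [lra|]. apply (syn_bound l0 6 (C * eps) (fun k => b k s - a k s)); try lia; auto.
Qed.
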